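(* Let $q$ be a nonzero complex parameter, not a root of unity, and let $A\in\mathrm{End}(\mathbb C^N)$ be one of the matrices of types (1)–(4) described in the context, with parameters having finite nonzero limits as $q\to 1$. Suppose that $\det\bigl(\lim_{q\to1}A\bigr)=1$. Then $A$ satisfies the equations of the quantum conjugacy class of $A_0=\lim_{q\to1}A$, namely: (i) the reflection equation $R_{21}A_1R_{12}A_2=A_2R_{21}A_1R_{12}$; (ii) if $\mathfrak g=\mathfrak{so}(N)$ or $\mathfrak{sp}(N)$: $A_2S_{12}A_2\varpi=\epsilon q^{-N+\epsilon}\varpi=\varpi A_2S_{12}A_2$; (iii) if $A$ is of type (1) or (2): $(A+q^{-P})(A-q^{-M})=0$, and $$\mathrm{Tr}_q(A)=\begin{cases}[P]_q-[M]_q,&\mathfrak g=\mathfrak{sl}(N),\\ [P-1]_q-[M-1]_q,&\mathfrak g=\mathfrak{so}(N),\\ [P+1]_q-[M+1]_q,&\mathfrak g=\mathfrak{sp}(N),\end{cases}$$ where $P$ and $M=N-P$ are the multiplicities of the eigenvalues $+1$ and $-1$ of $A_0$, i.e. $(P,M)=(N-m,m)$ for the overall sign $+$ and $(P,M)=(m,N-m)$ for the overall sign $-$ in $A$; (iv) if $A$ is of type (3) or (4): $\bigl(A-\sqrt{-1}\,q^{-\frac N2+\epsilon}\bigr)\bigl(A+\sqrt{-1}\,q^{-\frac N2+\epsilon}\bigr)=0$ and $\mathrm{Tr}_q(A)=0$.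
   Context: $\mathfrak g$ is a simple complex Lie algebra $\mathfrak{sl}(N)$, $\mathfrak{so}(N)$ or $\mathfrak{sp}(N)$; $e_{ij}$ are matrix units; $i'=N+1-i$; $[z]_q=\frac{q^z-q^{-z}}{q-q^{-1}}$. The matrices $A$ (nonzero parameters $y_i,z_i\in\mathbb C$ possibly depending on $q$): (1) $\mathfrak g=\mathfrak{sl}(N)$ or $\mathfrak{so}(N)$, $m\in\mathbb N$, $m\le N/2$: $A=\pm\bigl(\sum_{i=1}^m q^{-m}(1-q^{-N+2m})e_{ii}+\sum_{m<i<m'}q^{-m}e_{ii}+\sum_{i\le m\text{ or }i'\le m}y_ie_{ii'}\bigr)$ with $y_iy_{i'}=q^{-N}$. (2) $\mathfrak g=\mathfrak{sp}(N)$, $m\in2\mathbb N$, $m\le N/2$: $A=\pm\bigl(\sum_{i=1}^m q^{-m}(1-q^{-N+2m})e_{ii}+\sum_{m<i<m'}q^{-m}e_{ii}+\sum_{i\text{ odd},\ i\le m\text{ or }i'\le m}z_i(e_{i,i'-1}-e_{i+1,i'})\bigr)$ with $z_iz_{i'-1}=q^{-N}$ for all odd $i$ occurring in the sum. (3) $\mathfrak g=\mathfrak{sp}(N)$: $A=\sum_{i=1}^Ny_ie_{ii'}$ with $y_iy_{i'}=-q^{-N-2}$. (4) $\mathfrak g=\mathfrak{so}(N)$, $N$ even: $A=\sum_{1\le i\le N-1,\ i\text{ odd}}z_i(e_{i,i'-1}-e_{i+1,i'})$ with $z_iz_{i'-1}=-q^{-N+2}$ for odd $i\le N/2$. R-matrix.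 For $\mathfrak{sl}(N)$: $R=q\sum_{i}e_{ii}\otimes e_{ii}+\sum_{i\ne j}e_{ii}\otimes e_{jj}+(q-q^{-1})\sum_{i<j}e_{ji}\otimes e_{ij}$. For $\mathfrak{so}(N),\mathfrak{sp}(N)$: $R=\sum_{i,j} q^{\delta_{ij}-\delta_{ij'}}e_{ii}\otimes e_{jj}+(q-q^{-1})\sum_{j<i}(e_{ij}\otimes e_{ji}-\kappa_i\kappa_jq^{\rho_i-\rho_j}e_{ij}\otimes e_{i'j'})$, with all $\kappa_i=1$ for $\mathfrak{so}(N)$, and for $\mathfrak{sp}(N)$ $\kappa_i=1$ if $i\le N/2$, $\kappa_i=-1$ otherwise. $\rho_i=(\rho,\varepsilon_i)$ are the coordinates of the half-sum of positive roots: $\rho_i=\frac{N+1}2-i$ for $\mathfrak{sl}(N)$; $\rho_i=\frac N2-i$ (for $\mathfrak{so}(N)$), $\rho_i=\frac N2+1-i$ (for $\mathfrak{sp}(N)$) for $i\le N/2$, $\rho_{i'}=-\rho_i$ (so $\rho_i=0$ if $i=i'$). $P$ acting on $\mathbb C^N\otimes\mathbb C^N$ is the flip, $S=PR$, $R_{12}=R$, $R_{21}=PRP$, $A_1=A\otimes1$, $A_2=1\otimes A$ (in (iii) $P$ denotes an integer). $\epsilon=+1$ for $\mathfrak{so}(N)$, $\epsilon=-1$ for $\mathfrak{sp}(N)$. $\varpi$ is the $U_q(\mathfrak g)$-invariant projector of $\mathbb C^N\otimes\mathbb C^N$ onto its one-dimensional trivial submodule (equivalently the spectral projector of $S$ for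 the eigenvalue $\epsilon q^{-N+\epsilon}$). The $q$-trace is $\mathrm{Tr}_q(A)=\sum_{i=1}^Nq^{2\rho_i}A_{ii}$. *)

(* Defs.v *)
From mathcomp Require Import all_boot all_order all_algebra.
From mathcomp Require Import all_classical all_reals all_analysis.
From mathcomp Require Import complex mxtens.

Set Implicit Arguments.
Unset Strict Implicit.
Unset Printing Implicit Defensive.

Import Order.TTheory GRing.Theory Num.Theory.
Import numFieldNormedType.Exports.

Local Open Scope classical_set_scope.
Local Open Scope ring_scope.

(* R[i] packaged as a numClosedFieldType, so that the norm topology of an
   abstract numFieldType (and the induced one on matrices) is inferred. *)
Definition Cplx (R : realType) : numClosedFieldType := R[i].

(* Conventions.  Basis indices are 'I_N, i.e. 0-based: the index written i (from
   1 to N) in the mathematics is i.+1 for i : 'I_N.  Hence i' = N + 1 - i is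
   rev_ord i, "i <= m" is (i < m)%N, and "i odd" is ~~ odd i. *)

Inductive lie_type := SL | SO | SP.

(* sl(N), so(N) or sp(N) is a simple Lie algebra. *)
Definition simple_type (g : lie_type) (N : nat) : bool :=
  match g with
  | SL => (2 <= N)%N
  | SO => (3 <= N)%N && (N != 4)%N
  | SP => (2 <= N)%N && ~~ odd N
  end.

(* The value at SL is never used. *)
Definition eps_sign (g : lie_type) : int :=
  match g with SL => 0 | SO => 1 | SP => -1 end.

(* Twice the coordinates of the half-sum of positive roots; for so(N) with N odd
   the coordinates themselves are half-integers. *)
Definition two_rho (g : lie_type) (N : nat) (i : 'I_N) : int :=
  let half (k : int) : int :=
    if (i.+1.*2 <= N)%N then k - i.+1.*2%:Z
    else if ((rev_ord i).+1.*2 <= N)%N then - (k - (rev_ord i).+1.*2%:Z)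
    else 0 in
  match g with
  | SL => N.+1%:Z - i.+1.*2%:Z
  | SO => half N%:Z
  | SP => half N.+2%:Z
  end.

Definition kappa_sign (C : pzRingType) (g : lie_type) (N : nat) (i : 'I_N) : C :=
  match g with
  | SP => if (i < N./2)%N then 1 else -1
  | _ => 1
  end.

Section Quantum.
Variable C : fieldType.

Definition qint (q : C) (z : int) : C := (q ^ z - q ^ (- z)) / (q - q^-1).

Section Matrices.
Variable N : nat.
Implicit Types (A : 'M[C]_N) (i j : 'I_N).

Definition qtrace (g : lie_type) (q : C) A : C :=
  \sum_i q ^ two_rho g i * A i i.

Definition flip_mx : 'M[C]_(N * N) :=
  \sum_(i < N) \sum_(j < N) delta_mx i j *t delta_mx j i.

(* s is a square root of q, so that s ^ two_rho g i stands for q ^ rho_i. *)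
Definition Rmx (g : lie_type) (s : C) : 'M[C]_(N * N) :=
  let q := s ^+ 2 in
  match g with
  | SL =>
      q *: (\sum_(i < N) delta_mx i i *t delta_mx i i)
      + \sum_(i < N) \sum_(j < N | j != i) delta_mx i i *t delta_mx j j
      + (q - q^-1) *:
          (\sum_(i < N) \sum_(j < N | (i < j)%N) delta_mx j i *t delta_mx i j)
  | _ =>
      \sum_(i < N) \sum_(j < N)
        q ^ ((i == j)%:Z - (i == rev_ord j)%:Z)
          *: (delta_mx i i *t delta_mx j j)
      + (q - q^-1) *:
          (\sum_(i < N) \sum_(j < N | (j < i)%N)
             (delta_mx i j *t delta_mx j i
              - (kappa_sign C g i * kappa_sign C g j * s ^ (two_rho g i - two_rho g j))
                  *: (delta_mx i j *t delta_mx (rev_ord i) (rev_ord j))))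
  end.

Definition R21 (g : lie_type) (s : C) : 'M[C]_(N * N) :=
  flip_mx *m Rmx g s *m flip_mx.

Definition Smx (g : lie_type) (s : C) : 'M[C]_(N * N) := flip_mx *m Rmx g s.

Definition leg1 A : 'M[C]_(N * N) := A *t 1%:M.
Definition leg2 A : 'M[C]_(N * N) := 1%:M *t A.

End Matrices.

(* W is the projector onto the a-eigenspace of T whose kernel is the T-invariant
   complement of that eigenspace (matrices act on column vectors). *)
Definition spectral_projector (n : nat) (T : 'M[C]_n) (a : C) (W : 'M[C]_n) :=
  [/\ W *m W = W, W *m T = T *m W &
      forall v : 'cV[C]_n, W *m v = v <-> T *m v = a *: v].

(* The projector varpi onto the trivial submodule of C^N (x) C^N. *)
Definition is_varpi (g : lie_type) (N : nat) (s : C) (W : 'M[C]_(N * N)) :=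
  let q := s ^+ 2 in
  spectral_projector (Smx N g s)
    ((eps_sign g)%:~R * q ^ (- N%:Z + eps_sign g)) W.

End Quantum.

(* The four families of matrices; the boolean is the overall sign in the first
   two of them (true for -). *)
Inductive mx_family :=
  Type1 of nat & bool | Type2 of nat & bool | Type3 | Type4.

Definition family_ok (g : lie_type) (N : nat) (t : mx_family) : Prop :=
  match t with
  | Type1 m _ => (g = SL \/ g = SO) /\ (m.*2 <= N)%N
  | Type2 m _ => [/\ g = SP, ~~ odd m & (m.*2 <= N)%N]
  | Type3 => g = SP
  | Type4 => g = SO /\ ~~ odd N
  end.

Section Shapes.
Variables (C : fieldType) (N : nat).
Implicit Types (t : mx_family) (q : C) (y : 'I_N -> C) (i : 'I_N).

(* The indices of the parameters y_i (types 1, 3) or z_i (types 2, 4) that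
   actually appear in the matrix. *)
Definition occurs t i : bool :=
  match t with
  | Type1 m _ => (i < m)%N || (rev_ord i < m)%N
  | Type2 m _ => ~~ odd i && ((i < m)%N || (rev_ord i < m)%N)
  | Type3 => true
  | Type4 => ~~ odd i
  end.

(* The common diagonal part of types 1 and 2. *)
Definition diag_part (m : nat) q : 'M[C]_N :=
  \sum_(i < N | (i < m)%N)
     (q ^- m * (1 - q ^ (- N%:Z + m.*2%:Z))) *: delta_mx i i
  + \sum_(i < N | (m <= i)%N && (i < N - m)%N) q ^- m *: delta_mx i i.

Definition y_part t y : 'M[C]_N :=
  \sum_(i < N | occurs t i) y i *: delta_mx i (rev_ord i).

(* ord_pred (rev_ord i) is i' - 1 and ordS i is i + 1; types 2 and 4 have N even
   and the sum runs over odd (1-based) i, so neither wraps around. *)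
Definition z_part t y : 'M[C]_N :=
  \sum_(i < N | occurs t i)
     y i *: (delta_mx i (ord_pred (rev_ord i)) - delta_mx (ordS i) (rev_ord i)).

Definition Amx t q y : 'M[C]_N :=
  match t with
  | Type1 m neg => (-1) ^+ neg *: (diag_part m q + y_part t y)
  | Type2 m neg => (-1) ^+ neg *: (diag_part m q + z_part t y)
  | Type3 => y_part t y
  | Type4 => z_part t y
  end.

Definition param_rel t q y : Prop :=
  match t with
  | Type1 _ _ =>
      forall i, occurs t i -> y i * y (rev_ord i) = q ^- N
  | Type2 _ _ =>
      forall i, occurs t i -> y i * y (ord_pred (rev_ord i)) = q ^- N
  | Type3 =>
      forall i, occurs t i -> y i * y (rev_ord i) = - q ^ (- N%:Z - 2)
  | Type4 =>
      forall i, occurs t i -> (i < N./2)%N ->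
        y i * y (ord_pred (rev_ord i)) = - q ^ (- N%:Z + 2)
  end.

End Shapes.

Definition generic_q (C : fieldType) : set C :=
  [set q | q != 0 /\ forall n : nat, (0 < n)%N -> q ^+ n != 1].
Arguments generic_q : clear implicits.

(* Neighbourhoods of q = 1 among the generic values of q (q = 1 itself is not
   generic). *)
Definition near_one (R : realType) : set_system (Cplx R) :=
  within (generic_q (Cplx R)) (nbhs (1 : Cplx R)).
Arguments near_one : clear implicits.

(* Main.v *)
(* Multiplied by the flip, the reflection equation reads
   [S A_2 S A_2 = A_2 S A_2 S] with [S = P R]: an identity between operators on
   arrays of coordinates [v a b].  Row [b] of every matrix [A] of the four
   families has at most one entry [y b] off the diagonal, in a column [sg b],
   with [y b * y (sg b)] a constant [al * be]; hence [A_2] only mixes [v a b]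
   with [v a (sg b)].  Off the coordinates [v a a'] the operator [S] is the
   Hecke braiding of sl(N), and the equation splits into systems of at most
   eight coordinates, which are field identities.  What remains are the
   coordinates [phi a] and [bet a], proportional to [v a a'] and [v a (sg a')],
   which [A_2] exchanges.  On [bet] the operator [S] acts by two-by-two blocks,
   on [phi] by partial sums with weights [q^(- 2 rho)]; these sums telescope.

   For (ii), [S] is symmetric, and for generic [q] an eigenvector for
   [eps q^(-N+eps)] has no coordinates outside [v a a'] and constant [phi], as
   one sees by comparing consecutive rows.  On such vectors [A_2 S A_2] is
   computed by the same telescoping sums.  For (iii) and (iv),
   [A^2 = (al - be) A + al be], and the q-trace is a geometric sum; in the limit
   [q = 1] this makes [A0] an involution of trace [+-(N - 2m)], which determines
   the multiplicities of its eigenvalues. *)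

Require Import Defs.
From mathcomp Require Import all_boot all_order all_algebra.
From mathcomp Require Import all_classical all_reals all_analysis.
From mathcomp Require Import complex mxtens.
From mathcomp Require Import zify ring.

Set Implicit Arguments.
Unset Strict Implicit.
Unset Printing Implicit Defensive.

Import Order.TTheory GRing.Theory Num.Theory.
Import numFieldNormedType.Exports.

Local Open Scope classical_set_scope.
Local Open Scope ring_scope.

(** * Coordinates *)

(** The families differ in the Lie algebra, in the size of the middle block and in whether
    neighbouring indices are twisted, so the computation on [phi] and [bet] is done once, for
    abstract weights [p] and diagonals [dp], [dt]. In these coordinates [S] is block diagonal, with
    blocks [T] on [phi] and [Qm] on [bet], and [A] is the two-by-two block matrix with rows [dp, 1]
    and [ga, dt]; the equation becomes four block identities. The exchange of the outer blocks by
    [T] leaves rank one terms, and the q-trace of the middle block is the value for which they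
    cancel. The case that fixes the generality is type (4) with [N/2] odd: there [sg] fixes two
    indices, and the middle block is diagonal but not scalar. Hence this block is only asked to
    satisfy the quadratic relation of [A], its own reflection equation, and two conditions tying it
    to [th], the eigenvalue of [Qm] on constants. The factor in (ii) arises as [al * be * th], where
    [al] and [- be] are the roots of the quadratic relation. The right-hand equation of (ii) is the
    transpose of the left-hand one: [A^T] has the same shape as [A], with [y] replaced by its
    composite with [sg]. *)

Definition mirror (N a : nat) : nat := (N.-1 - a)%N.

Definition paired (N m a : nat) := (a < m)%N || (N - m <= a)%N.

Lemma paired_mirror N m a : (m.*2 <= N)%N -> (a < N)%N -> paired N m (mirror N a) = paired N m a.
Proof. by rewrite /paired /mirror; lia. Qed.

Lemma mirror_lt N a : (a < N)%N -> (mirror N a < N)%N.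
Proof. rewrite /mirror; lia. Qed.

Lemma mirrorK N a : (a < N)%N -> mirror N (mirror N a) = a.
Proof. rewrite /mirror; lia. Qed.

(** With [tw] on, [twist tw (mirror N a)] is the column of the entry in row [a] of the sums over odd
    [i] in types (2) and (4). *)
Definition twist (tw : bool) (a : nat) : nat := if tw then (if odd a then a.-1 else a.+1) else a.

Lemma twistK tw a : twist tw (twist tw a) = a.
Proof.
rewrite /twist; case: tw => //; case: (boolP (odd a)) => oa.
  have -> : odd a.-1 = false by lia.
  lia.
by have -> : odd a.+1 by lia.
Qed.

Section Shape.
Variables (C : fieldType) (N : nat).

(* [leg2 A] on the array [v a b] of coordinates along [e_a (x) e_b], when row [b]
   of [A] has the entries [d b] on the diagonal and [y b] in column [sg b]. *)
Definition actA (sg : nat -> nat) (d y : nat -> C) (v : nat -> nat -> C) a b : C :=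
  d b * v a b + y b * v a (sg b).

(* The indices form three consecutive blocks, of sizes m, N - 2m and m; the
   involution [sg] exchanges the outer two, and [A] is diagonal on the middle one. *)
Record shape (m : nat) (sg : nat -> nat) (d y : nat -> C) (al be : C) : Prop :=
 Shape {
  sh_m : (m.*2 <= N)%N;
  sh_12 : forall a, (a < m)%N -> (N - m <= sg a < N)%N;
  sh_21 : forall a, (N - m <= a < N)%N -> (sg a < m)%N;
  sh_inv : forall a, (a < N)%N -> paired N m a -> sg (sg a) = a;
  sh_com : forall a, (a < N)%N -> paired N m a -> sg (mirror N a) = mirror N (sg a);
  sh_ord : forall a b, (a < m)%N -> (b < m)%N -> (a < b)%N -> b != sg (mirror N a) ->
     (sg b < sg a)%N;
  sh_d1 : forall a, (a < m)%N -> d a = al - be;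
  sh_d2 : forall a, (N - m <= a < N)%N -> d a = 0;
  sh_y : forall a, (a < N)%N -> paired N m a -> y a * y (sg a) = al * be;
  sh_y0 : forall a, (a < N)%N -> ~~ paired N m a -> y a = 0;
  sh_dm : forall a, (a < N)%N -> ~~ paired N m a -> (d a - al) * (d a + be) = 0;
  sh_ab : al * be != 0 }.

Section Theory.
Variables (m : nat) (sg : nat -> nat) (d y : nat -> C) (al be : C).
Hypothesis sh : shape m sg d y al be.

Lemma paired_cases a : (a < N)%N -> paired N m a -> (a < m)%N \/ (N - m <= a < N)%N.
Proof. by move=> aN /orP[]; [left | right; apply/andP]. Qed.

Lemma sg_ltN a : (a < N)%N -> paired N m a -> (sg a < N)%N.
Proof.
move=> aN /paired_cases -/(_ aN)[] h; first by have /andP[] := sh_12 sh h.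
have := sh_21 sh h; have := sh_m sh; lia.
Qed.

Lemma paired_sg a : (a < N)%N -> paired N m a -> paired N m (sg a).
Proof.
move=> aN /paired_cases -/(_ aN)[] h; rewrite /paired.
  by have /andP[-> _] := sh_12 sh h; rewrite orbT.
by rewrite (sh_21 sh h).
Qed.

(** In the families [sg] is [mirror] up to an exchange of neighbours, so only a pair [a],
    [sg (mirror N a)] can keep its order. [sh_ord] covers the first block, [sh_inv] transports it to
    the last one, and the two blocks are exchanged as wholes. *)
Lemma sg_rev a b : (a < N)%N -> (b < N)%N -> paired N m a -> paired N m b ->
  a != b -> b != sg (mirror N a) -> (sg a < sg b)%N = (b < a)%N.
Proof.
suff H x z : (x < N)%N -> (z < N)%N -> paired N m x -> paired N m z ->
    x != z -> z != sg (mirror N x) -> (x < z)%N -> (sg z < sg x)%N.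
  move=> aN bN pa pb nab nbt; have /orP[ab|ba] : (a < b)%N || (b < a)%N by rewrite -neq_ltn.
    by have := H _ _ aN bN pa pb nab nbt ab; lia.
  have nat' : a != sg (mirror N b).
    apply: contra_neq nbt => e.
    have e' : sg a = mirror N b.
      by rewrite e (sh_inv sh) ?mirror_lt ?(paired_mirror (sh_m sh)).
    by rewrite (sh_com sh aN pa) e' mirrorK.
  by rewrite eq_sym in nab; rewrite (H _ _ bN aN pb pa nab nat' ba).
move=> xN zN px neg_2rho nxz nzt xz.
have ix := sh_inv sh xN px; have iz := sh_inv sh zN neg_2rho.
have mN := sh_m sh.
case: (paired_cases xN px) => hx; case: (paired_cases zN neg_2rho) => hz.
- exact: (sh_ord sh).
- have := sh_12 sh hx; have := sh_21 sh hz; lia.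
- lia.
- have hx' := sh_21 sh hx; have hz' := sh_21 sh hz.
  rewrite ltnNge leq_eqVlt negb_or; apply/andP; split.
    by apply: contra_neq nxz => e; rewrite -ix e.
  apply/negP => lt.
  have ne : sg z != sg (mirror N (sg x)).
    rewrite (sh_com sh) ?sg_ltN ?paired_sg // ix.
    apply: contra_neq nzt => e.
    by rewrite -e iz.
  have := sh_ord sh hx' hz' lt ne.
  by rewrite ix iz; lia.
Qed.

End Theory.
End Shape.

(** * The Hecke sectors *)

Section HeckeSectors.
Variables (C : fieldType) (q : C) (N : nat).
Hypothesis q0 : q != 0.

Let lam := q - q^-1.

Definition hecke (v : nat -> nat -> C) a b : C :=
  if a == b then q * v a b else v b a + (if (a < b)%N then lam else 0) * v a b.

Section HeckeSector.
Variables (m : nat) (sg : nat -> nat) (d y : nat -> C) (al be : C).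
Hypothesis sh : shape N m sg d y al be.
Variables (S : (nat -> nat -> C) -> nat -> nat -> C).
Let A := actA sg d y.

(** The eight coordinates along [e_x (x) e_z] and [e_z (x) e_x], with [x] in [{a, sg a}] and [z] in
    [{b, sg b}], form a closed system. [S] has to agree with the Hecke braiding only there, so that
    the lemma serves sl(N) as well as so(N) and sp(N). *)
Lemma RE_pair a b v :
  (a < N)%N -> (b < N)%N -> paired N m a -> paired N m b ->
  a != b -> a != sg b -> b != sg (mirror N a) -> b != mirror N a ->
  (forall u x z, x \in [:: a; sg a] -> z \in [:: b; sg b] -> S u x z = hecke u x z) ->
  (forall u x z, x \in [:: b; sg b] -> z \in [:: a; sg a] -> S u x z = hecke u x z) ->
  S (A (S (A v))) a b = A (S (A (S v))) a b.
Proof.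
move=> aN bN pa pb nab nab' nbt nbr g1 g2.
have ia := sh_inv sh aN pa. have ib := sh_inv sh bN pb.
have ya0 : y a != 0.
  by apply: contra_neq (sh_ab sh) => ya0; rewrite -(sh_y sh aN pa) ya0 mul0r.
have yb0 : y b != 0.
  by apply: contra_neq (sh_ab sh) => yb0; rewrite -(sh_y sh bN pb) yb0 mul0r.
have ysa : y (sg a) = al * be / y a by rewrite -(sh_y sh aN pa); field.
have ysb : y (sg b) = al * be / y b by rewrite -(sh_y sh bN pb); field.
have nab'' : sg a != b by apply: contra_neq nab' => <-.
have nsab : sg a != sg b by apply: contra_neq nab => e; rewrite -ia e.
have E1 : (sg a < sg b)%N = ~~ (a < b)%N.
  by rewrite (sg_rev sh) //; lia.
have E2 : (sg a < b)%N = ~~ (a < sg b)%N.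
  rewrite -[X in (sg a < X)%N]ib (sg_rev sh) ?(sg_ltN sh) ?(paired_sg sh) //; first by lia.
  apply: contra_neq nbr => e.
  by rewrite -ib e (sh_inv sh) ?mirror_lt ?(paired_mirror (sh_m sh)).
(* All comparisons follow from those of [a] with [b] and of [a] with [sg b]. The blocks containing
   [a] and [b] decide one of the two; the final [ifP] splits on the other. *)
have St : [\/ [/\ d a = al - be, d (sg a) = 0, d b = al - be, d (sg b) = 0 & (a < sg b)%N],
   [/\ d a = al - be, d (sg a) = 0, d (sg b) = al - be, d b = 0 & (a < b)%N],
   [/\ d (sg a) = al - be, d a = 0, d b = al - be, d (sg b) = 0 & (b < a)%N]
   | [/\ d (sg a) = al - be, d a = 0, d (sg b) = al - be, d b = 0 & (sg b < a)%N]].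
  have mN := sh_m sh.
  case: (paired_cases aN pa) => ha; case: (paired_cases bN pb) => hb.
  - constructor 1; rewrite ?(sh_d1 sh ha) ?(sh_d1 sh hb) ?(sh_d2 sh (sh_12 sh ha)) ?(sh_d2 sh (sh_12 sh hb)).
    by split=> //; have := sh_12 sh hb; lia.
  - constructor 2; rewrite ?(sh_d1 sh ha) ?(sh_d2 sh hb) ?(sh_d1 sh (sh_21 sh hb)) ?(sh_d2 sh (sh_12 sh ha)).
    by split=> //; lia.
  - constructor 3; rewrite ?(sh_d2 sh ha) ?(sh_d1 sh hb) ?(sh_d2 sh (sh_12 sh hb)) ?(sh_d1 sh (sh_21 sh ha)).
    by split=> //; lia.
  - constructor 4; rewrite ?(sh_d2 sh ha) ?(sh_d2 sh hb) ?(sh_d1 sh (sh_21 sh hb)) ?(sh_d1 sh (sh_21 sh ha)).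
    by split=> //; have := sh_21 sh hb; lia.
have N1 : (b < a)%N = ~~ (a < b)%N by lia.
have N2 : (sg b < a)%N = ~~ (a < sg b)%N by lia.
have N3 : (b < sg a)%N = (a < sg b)%N by lia.
have N4 : (sg b < sg a)%N = (a < b)%N by lia.
have h1 u : S u a b = u b a + (if (a < b)%N then lam else 0) * u a b.
  by rewrite g1 ?inE ?eqxx // /hecke (negPf nab).
have h2 u : S u a (sg b) = u (sg b) a + (if (a < sg b)%N then lam else 0) * u a (sg b).
  by rewrite g1 ?inE ?eqxx ?orbT // /hecke (negPf nab').
have h3 u : S u (sg a) b = u b (sg a) + (if ~~ (a < sg b)%N then lam else 0) * u (sg a) b.
  by rewrite g1 ?inE ?eqxx ?orbT // /hecke (negPf nab'') E2.
have h4 u : S u (sg a) (sg b) = u (sg b) (sg a) + (if ~~ (a < b)%N then lam else 0) * u (sg a) (sg b).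
  by rewrite g1 ?inE ?eqxx ?orbT // /hecke (negPf nsab) E1.
have h5 u : S u b a = u a b + (if ~~ (a < b)%N then lam else 0) * u b a.
  by rewrite g2 ?inE ?eqxx ?orbT // /hecke eq_sym (negPf nab) N1.
have h6 u : S u (sg b) a = u a (sg b) + (if ~~ (a < sg b)%N then lam else 0) * u (sg b) a.
  by rewrite g2 ?inE ?eqxx ?orbT // /hecke eq_sym (negPf nab') N2.
have h7 u : S u b (sg a) = u (sg a) b + (if (a < sg b)%N then lam else 0) * u b (sg a).
  by rewrite g2 ?inE ?eqxx ?orbT // /hecke eq_sym (negPf nab'') N3.
have h8 u : S u (sg b) (sg a) = u (sg a) (sg b) + (if (a < b)%N then lam else 0) * u (sg b) (sg a).
  by rewrite g2 ?inE ?eqxx ?orbT // /hecke eq_sym (negPf nsab) N4.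
rewrite /A /actA.
rewrite ?(h1, h2, h3, h4, h5, h6, h7, h8, ia, ib).
rewrite ?(h1, h2, h3, h4, h5, h6, h7, h8, ia, ib).
rewrite ysa ysb /lam.
case: St => -[-> -> -> ->].
all: move=> o; rewrite ?N1 ?N2 in o; rewrite ?o ?(negPf o) ?if_neg /=.
all: by case: ifP => _ /=; field; rewrite ?q0 ?ya0 ?yb0.
Qed.

(** A middle index lies between [a] and [sg a], which settles every comparison; the identity holds
    for either root [al], [- be] as the value of [d b]. *)
Lemma RE_pair_fix a b v :
  (a < N)%N -> (b < N)%N -> paired N m a -> ~~ paired N m b ->
  (forall u x, x \in [:: a; sg a] -> S u x b = hecke u x b) ->
  (forall u x, x \in [:: a; sg a] -> S u b x = hecke u b x) ->
  S (A (S (A v))) a b = A (S (A (S v))) a b /\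
  S (A (S (A v))) b a = A (S (A (S v))) b a.
Proof.
move=> aN bN pa pb g1 g2.
have ia := sh_inv sh aN pa.
have ya0 : y a != 0.
  by apply: contra_neq (sh_ab sh) => ya0; rewrite -(sh_y sh aN pa) ya0 mul0r.
have ysa : y (sg a) = al * be / y a by rewrite -(sh_y sh aN pa); field.
have yb : y b = 0 by exact: (sh_y0 sh).
have db : d b = al \/ d b = - be.
  have /eqP := sh_dm sh bN pb; rewrite mulf_eq0 subr_eq0 addr_eq0.
  by case/orP=> /eqP; [left | right].
have mN := sh_m sh.
have bm : (m <= b < N - m)%N by move: pb; rewrite /paired; lia.
have St : [/\ d a = al - be, d (sg a) = 0 , (a < b)%N & (b < sg a)%N] \/
   [/\ d (sg a) = al - be, d a = 0, (b < a)%N & (sg a < b)%N].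
  case: (paired_cases aN pa) => ha.
    left; rewrite (sh_d1 sh ha) (sh_d2 sh (sh_12 sh ha)); split=> //; first lia.
    have := sh_12 sh ha; lia.
  right; rewrite (sh_d2 sh ha) (sh_d1 sh (sh_21 sh ha)); split=> //; first lia.
  have := sh_21 sh ha; lia.
have h1 u : S u a b = hecke u a b by rewrite g1 ?inE ?eqxx.
have h2 u : S u (sg a) b = hecke u (sg a) b by rewrite g1 ?inE ?eqxx ?orbT.
have h3 u : S u b a = hecke u b a by rewrite g2 ?inE ?eqxx.
have h4 u : S u b (sg a) = hecke u b (sg a) by rewrite g2 ?inE ?eqxx ?orbT.
have nab : a == b = false by case: St => -[]; lia.
have nsab : sg a == b = false by case: St => -[]; lia.
rewrite /A /actA !(h1, h2, h3, h4, ia) /hecke (eq_sym b) (eq_sym b (sg a)) nab nsab.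
rewrite !(h1, h2, h3, h4, ia) /hecke (eq_sym b) (eq_sym b (sg a)) nab nsab.
rewrite yb ysa !ia !mul0r /lam.
case: St => -[-> -> o1 o2].
  have -> : (b < a)%N = false by lia.
  have -> : (sg a < b)%N = false by lia.
  by rewrite o1 o2; case: db => ->; split; field; rewrite ?q0 ?ya0.
have -> : (a < b)%N = false by lia.
have -> : (b < sg a)%N = false by lia.
by rewrite o1 o2; case: db => ->; split; field; rewrite ?q0 ?ya0.
Qed.
Lemma RE_self a v :
  (a < N)%N -> paired N m a ->
  (forall u x z, x \in [:: a; sg a] -> z \in [:: a; sg a] -> S u x z = hecke u x z) ->
  S (A (S (A v))) a a = A (S (A (S v))) a a /\
  S (A (S (A v))) a (sg a) = A (S (A (S v))) a (sg a).
Proof.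
move=> aN pa g.
have ia := sh_inv sh aN pa.
have ya0 : y a != 0.
  by apply: contra_neq (sh_ab sh) => ya0; rewrite -(sh_y sh aN pa) ya0 mul0r.
have ysa : y (sg a) = al * be / y a by rewrite -(sh_y sh aN pa); field.
have h1 u : S u a a = hecke u a a by rewrite g ?inE ?eqxx.
have h2 u : S u a (sg a) = hecke u a (sg a) by rewrite g ?inE ?eqxx ?orbT.
have h3 u : S u (sg a) a = hecke u (sg a) a by rewrite g ?inE ?eqxx ?orbT.
have h4 u : S u (sg a) (sg a) = hecke u (sg a) (sg a) by rewrite g ?inE ?eqxx ?orbT.
have St : [/\ d a = al - be, d (sg a) = 0 & (a < sg a)%N] \/
   [/\ d (sg a) = al - be, d a = 0 & (sg a < a)%N].
  have mN := sh_m sh.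
  case: (paired_cases aN pa) => ha.
    left; rewrite (sh_d1 sh ha) (sh_d2 sh (sh_12 sh ha)); split=> //.
    have := sh_12 sh ha; lia.
  right; rewrite (sh_d2 sh ha) (sh_d1 sh (sh_21 sh ha)); split=> //.
  have := sh_21 sh ha; lia.
have nab : a == sg a = false by case: St => -[]; lia.
have nab' : sg a == a = false by rewrite eq_sym.
rewrite /A /actA ?(h1, h2, h3, h4, ia) /hecke ?(nab, nab', eqxx).
rewrite ?(h1, h2, h3, h4, ia) /hecke ?(nab, nab', eqxx).
rewrite ysa !ia /lam.
case: St => -[-> -> o1].
  have -> : (sg a < a)%N = false by lia.
  by rewrite o1; split; field; rewrite ?q0 ?ya0.
have -> : (a < sg a)%N = false by lia.
by rewrite o1; split; field; rewrite ?q0 ?ya0.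
Qed.

Lemma RE_fix a b v :
  (a < N)%N -> (b < N)%N -> ~~ paired N m a -> ~~ paired N m b -> d a = d b ->
  (forall u, S u a b = hecke u a b) -> (forall u, S u b a = hecke u b a) ->
  S (A (S (A v))) a b = A (S (A (S v))) a b.
Proof.
move=> aN bN pa pb dab h1 h2.
have ya := sh_y0 sh aN pa; have yb := sh_y0 sh bN pb.
case: (eqVneq a b) => [e | nab].
  subst b; rewrite /A /actA ?h1 /hecke eqxx ?h1 /hecke ?eqxx ya; ring.
have nba : b == a = false by rewrite eq_sym (negPf nab).
rewrite /A /actA ?(h1, h2) /hecke (negPf nab) ?nba ?(h1, h2) /hecke (negPf nab) ?nba.
by rewrite dab ya yb; ring.
Qed.

End HeckeSector.

End HeckeSectors.

(** * The sector of weight zero *)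

Section ZeroWeightSectors.
Variables (C : fieldType) (q : C) (N : nat).
Hypothesis q0 : q != 0.
Let lam := q - q^-1.

Section ZeroWeight.
Variables (m : nat) (tw : bool) (eps : C) (p : nat -> C) (dp dt : nat -> C) (al be : C).

(** The eigenvalue on constants of [S] acting on [bet]. Without twist [bet] lives on the coordinates
    [v a a], where the Hecke braiding is [q]; with twist the sign in [dm_y_twist] and the factor [q]
    in [dm_nrm_twist] make the constants eigenvectors for [- q^-1]. *)
Let th : C := if tw then - q^-1 else q.

Let r a : C := (if (a < twist tw a)%N then lam else 0) - th.

Definition psum (f : nat -> C) i k := \sum_(i <= j < k) p j * f j.

(* [S] on the coordinates [phi]; [p a] stands for [q^(- 2 rho_a)]. *)
Definition phiS (f : nat -> C) a : C :=
  eps * ((if a == mirror N a then 1 else q^-1) * (p (mirror N a) * f (mirror N a))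
         - lam * psum f 0 (mirror N a))
  + (if (a < mirror N a)%N then lam else 0) * f a.

(* The restriction of phiS to the functions on the middle block. *)
Definition phiSmid (f : nat -> C) a : C :=
  eps * ((if a == mirror N a then 1 else q^-1) * (p (mirror N a) * f (mirror N a))
         - lam * psum f m (mirror N a))
  + (if (a < mirror N a)%N then lam else 0) * f a.

(* [S] on the coordinates [bet]. *)
Definition betaS0 (f : nat -> C) a : C :=
  - r a * f (twist tw a) + (if (a < twist tw a)%N then lam else 0) * f a.

Definition betaS f a : C := if paired N m a then betaS0 f a else 0.
Definition crossA a : C := if paired N m a then al * be else 0.
Let mid a := (m <= a < N - m)%N.

Hypotheses (mN : (m.*2 <= N)%N) (tw_m : tw ==> ~~ odd m && ~~ odd N).
Hypothesis eps2 : eps * eps = 1.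
Hypothesis p1 : forall k, (k.+1 < m)%N -> p k.+1 = q ^+ 2 * p k.
Hypothesis p2 : forall k, (N - m <= k < N)%N -> p k.+1 = q ^+ 2 * p k.
Hypothesis prv : forall k, (k < N)%N -> p k * p (mirror N k) = 1.
Hypothesis dp1 : forall a, (a < m)%N -> dp a = 0.
Hypothesis dp2 : forall a, (N - m <= a < N)%N -> dp a = al - be.
Hypothesis dt1 : forall a, (a < m)%N -> dt a = al - be.
Hypothesis dt2 : forall a, (N - m <= a < N)%N -> dt a = 0.
(** The four conditions on the middle block. [Tdp] sends [dp] to [th] times [al * be / dp], by the
    quadratic relation; [Tdp_comm] is the reflection equation of the block alone; [sum_dp]
    prescribes its q-trace. *)
Hypothesis dpm : forall a, mid a -> (dp a - al) * (dp a + be) = 0.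
Hypothesis Tdp : forall a, mid a -> phiSmid dp a = th * (dp a - (al - be)).
Hypothesis Tdp_comm : forall f a, mid a ->
  dp a * phiSmid (fun j => dp j * phiSmid f j) a =
  phiSmid (fun j => dp j * phiSmid (fun i => dp i * f i) j) a.
Hypothesis sum_dp : lam * psum dp m (N - m) = (al - be) * (eps * th + q^-1 * p (N - m)).

(** * Partial sums, and [phiS] block by block *)

Lemma psumS f i k : (i <= k)%N -> psum f i k.+1 = psum f i k + p k * f k.
Proof. by move=> ik; rewrite /psum big_nat_recr. Qed.

Lemma psumnn f i : psum f i i = 0.
Proof. by rewrite /psum big_geq. Qed.

Lemma psum_cat f i j k : (i <= j <= k)%N -> psum f i k = psum f i j + psum f j k.
Proof. by move=> /andP[ij jk]; rewrite /psum (big_cat_nat ij jk). Qed.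

Lemma psum_ext f g i k : (forall j, (i <= j < k)%N -> f j = g j) -> psum f i k = psum g i k.
Proof. by move=> e; rewrite /psum; apply: eq_big_nat => j /e ->. Qed.

Lemma psum0 f i k : (forall j, (i <= j < k)%N -> f j = 0) -> psum f i k = 0.
Proof. by move=> e; rewrite /psum big_nat big1 // => j /e ->; rewrite mulr0. Qed.

Lemma psumD f g i k : psum (fun j => f j + g j) i k = psum f i k + psum g i k.
Proof. by rewrite /psum -big_split /=; apply: eq_bigr => j _; rewrite mulrDr. Qed.

Lemma psumZ c f i k : psum (fun j => c * f j) i k = c * psum f i k.
Proof. by rewrite /psum mulr_sumr; apply: eq_bigr => j _; rewrite mulrCA. Qed.

Lemma phiS_ext f g a : (a < N)%N -> (forall j, (j < N)%N -> f j = g j) -> phiS f a = phiS g a.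
Proof.
move=> aN e; rewrite /phiS !e //; last by rewrite mirror_lt.
by rewrite (psum_ext (g := g)) // => j /andP[_ h]; apply: e; apply: ltn_trans h (mirror_lt aN).
Qed.

Lemma phiS_D f g a : phiS (fun j => f j + g j) a = phiS f a + phiS g a.
Proof. by rewrite /phiS psumD; ring. Qed.

Lemma phiS_Z c f a : phiS (fun j => c * f j) a = c * phiS f a.
Proof. by rewrite /phiS psumZ; ring. Qed.

Lemma phiSmid_ext f g a : mid a -> (forall j, mid j -> f j = g j) -> phiSmid f a = phiSmid g a.
Proof.
move=> aN e; have aN' : mid (mirror N a) by move: aN; rewrite /mid /mirror; clear; lia.
rewrite /phiSmid !e // (psum_ext (g := g)) // => j h; apply: e.
by move: h aN'; rewrite /mid; clear; lia.
Qed.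

Lemma phiS_mid f a : mid a -> phiS f a = phiSmid f a - eps * lam * psum f 0 m.
Proof.
move=> aN; rewrite /phiS /phiSmid (@psum_cat f 0 m); first by ring.
by move: aN; rewrite /mid /mirror; lia.
Qed.

Lemma phiS_2 f a : (N - m <= a < N)%N ->
  phiS f a = eps * (q^-1 * (p (mirror N a) * f (mirror N a)) - lam * psum f 0 (mirror N a)).
Proof.
move=> h; rewrite /phiS; have -> : (a == mirror N a) = false by rewrite /mirror; lia.
have -> : (a < mirror N a)%N = false by rewrite /mirror; lia.
by ring.
Qed.

Lemma phiS_2_ext f g a : (N - m <= a < N)%N -> (forall j, (j < m)%N -> f j = g j) -> phiS f a = phiS g a.
Proof.
move=> h e; rewrite !phiS_2 // e; last by rewrite /mirror; lia.
by rewrite (psum_ext (g := g)) // => j hj; apply: e; move: hj; rewrite /mirror; lia.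
Qed.

Lemma phiS_1 f a : (a < m)%N ->
  phiS f a = eps * (q^-1 * (p (mirror N a) * f (mirror N a))
     - lam * (psum f 0 m + psum f m (N - m) + psum f (N - m) (mirror N a))) + lam * f a.
Proof.
move=> h; rewrite /phiS; have -> : (a == mirror N a) = false by rewrite /mirror; lia.
have -> : (a < mirror N a)%N = true by rewrite /mirror; lia.
rewrite (@psum_cat f 0 m (mirror N a)) 1?(@psum_cat f m (N - m) (mirror N a)); first by ring.
all: by rewrite /mirror; lia.
Qed.

Lemma twist_1 a : (a < m)%N -> (twist tw a < m)%N.
Proof. by move: tw_m; rewrite /twist; case: tw => //= /andP[om oN]; case: ifP => oa h; lia. Qed.

Lemma twist_2 a : (N - m <= a < N)%N -> (N - m <= twist tw a < N)%N.
Proof. by move: tw_m; rewrite /twist; case: tw => //= /andP[om oN]; case: ifP => oa h; lia. Qed.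

Lemma betaS0_D f g a : betaS0 (fun j => f j + g j) a = betaS0 f a + betaS0 g a.
Proof. by rewrite /betaS0; ring. Qed.

Lemma betaS0_Z c f a : betaS0 (fun j => c * f j) a = c * betaS0 f a.
Proof. by rewrite /betaS0; ring. Qed.

Lemma betaS0_const c a : betaS0 (fun=> c) a = th * c.
Proof. by rewrite /betaS0 /r; ring. Qed.

Lemma betaS0_2 f a : betaS0 (betaS0 f) a = f a + lam * betaS0 f a.
Proof.
rewrite /betaS0 twistK /r twistK.
case: (ltngtP a (twist tw a)) => h; rewrite /th /lam; first by case: tw; field.
  by case: tw; field.
by rewrite -h; case: tw; field.
Qed.

Lemma betaS0_id f a : ~~ tw -> betaS0 f a = th * f a.
Proof.
by rewrite /betaS0 /r /twist /th; case: tw => //= _; rewrite ltnn; ring.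
Qed.

Lemma betaS0_even f a : tw -> ~~ odd a -> betaS0 f a = - q * f a.+1 + lam * f a.
Proof.
rewrite /betaS0 /r /twist /th; case: tw => //= _ /negPf->; rewrite ltnSn /lam.
by field.
Qed.

Lemma betaS0_odd f a : tw -> odd a -> betaS0 f a = - q^-1 * f a.-1.
Proof.
rewrite /betaS0 /r /twist /th; case: tw => //= _ oa; rewrite oa.
have -> : (a < a.-1)%N = false by lia.
by ring.
Qed.

(** On a twisted pair the weights form a left eigenvector of the two-by-two block of [betaS0] for
    [th], because the second weight is [q ^+ 2] times the first. Hence the bounds must not split a
    pair, and the range must avoid the middle block. *)
Lemma psum_betaS0 f i k : (i <= k)%N -> (tw ==> ~~ odd i && ~~ odd k) ->
  (k <= m)%N || (N - m <= i)%N && (k <= N)%N -> psum (betaS0 f) i k = th * psum f i k.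
Proof.
move=> ik; case: (boolP tw) => [tw1 /= /andP[oi ok] | tw0 _ _]; last first.
  by rewrite (psum_ext (g := fun j => th * f j)) ?psumZ // => j _; rewrite betaS0_id.
have -> : k = (i + (k - i)./2.*2)%N.
  by rewrite even_halfK ?subnKC // oddB // (negPf oi) (negPf ok).
move: ((k - i)./2) => n.
elim: n => [|n IHn] h; first by rewrite addn0 !psumnn mulr0.
rewrite doubleS !addnS.
rewrite !psumS ?IHn; try lia.
rewrite betaS0_even //; last by lia.
rewrite betaS0_odd //=; last by lia.
have -> : p (i + n.*2).+1 = q ^+ 2 * p (i + n.*2)%N.
  by case/orP: h => h; [apply: p1 | apply: p2]; lia.
have -> : th = - q^-1 by rewrite /th tw1.
by rewrite /lam; field.
Qed.

(** A partial sum ending between two pairs is only multiplied by [th]; one ending inside a pair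
    leaves a boundary term, which the neighbouring row of [betaS0] absorbs. *)
Lemma phiS_betaS0_2 f a : (N - m <= a < N)%N -> phiS (betaS0 f) a = betaS0 (phiS f) a.
Proof.
move=> ha; case: (boolP tw) => [tw1 | tw0]; last first.
  rewrite betaS0_id // -phiS_Z; apply: phiS_2_ext => // j _; by rewrite betaS0_id.
have th' : th = - q^-1 by rewrite /th tw1.
have /andP[om oN] : ~~ odd m && ~~ odd N by move: tw_m; rewrite tw1.
case: (boolP (odd a)) => oa.
  have ha' : (N - m <= a.-1 < N)%N by lia.
  have -> : betaS0 (phiS f) a = - q^-1 * phiS f a.-1 by rewrite betaS0_odd.
  rewrite !phiS_2 //.
  have orv : ~~ odd (mirror N a) by rewrite /mirror; lia.
  have -> : mirror N a.-1 = (mirror N a).+1 by rewrite /mirror; lia.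
  rewrite psum_betaS0 ?orv ?implybT //; last by rewrite /mirror; lia.
  rewrite psumS // betaS0_even // th'.
  have -> : p (mirror N a).+1 = q ^+ 2 * p (mirror N a) by apply: p1; rewrite /mirror; lia.
  by rewrite /lam; field.
have ha' : (N - m <= a.+1 < N)%N.
  case/andP: ha => h1 h2; clear - h1 h2 oa oN; lia.
rewrite betaS0_even // !phiS_2 //.
have orv : ~~ odd (mirror N a.+1) by rewrite /mirror; lia.
have -> : mirror N a = (mirror N a.+1).+1 by rewrite /mirror; lia.
rewrite !psumS // betaS0_odd //= psum_betaS0 ?orv ?implybT //; last by rewrite /mirror; lia.
rewrite betaS0_even // th'.
have -> : p (mirror N a.+1).+1 = q ^+ 2 * p (mirror N a.+1) by apply: p1; rewrite /mirror; lia.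
by rewrite /lam; field.
Qed.

(** In a row of the first block the middle of [g] enters only through its weighted sum, so [g] may
    be arbitrary there apart from that sum. This covers both [betaS b], which vanishes on the
    middle, and the functions built from [dp]. *)
Lemma phiS_betaS0_1 f g a : (a < m)%N ->
  (forall j, (j < N)%N -> paired N m j -> g j = betaS0 f j) ->
  psum g m (N - m) = th * psum f m (N - m) ->
  phiS g a = betaS0 (phiS f) a.
Proof.
move=> ha gQ gm.
have gP1 : psum g 0 m = th * psum f 0 m.
  rewrite (psum_ext (g := betaS0 f)) ?psum_betaS0 // ?leqnn //.
    by move: tw_m; case: tw => //= /andP[].
  by move=> j hj; apply: gQ; rewrite ?/paired; lia.
have g2 k : (N - m <= k <= N)%N -> (tw ==> ~~ odd k) ->
    psum g (N - m) k = th * psum f (N - m) k.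
  move=> hk ok; rewrite (psum_ext (g := betaS0 f)) ?psum_betaS0 //; try lia.
  by move=> j hj; apply: gQ; rewrite ?/paired; lia.
case: (boolP tw) => [tw1 | tw0]; last first.
  rewrite betaS0_id // !phiS_1 // gP1 gm !g2 ?(negPf tw0) //; last by rewrite /mirror; lia.
  by rewrite !gQ ?betaS0_id // /paired /mirror; first ring; lia.
have th' : th = - q^-1 by rewrite /th tw1.
have /andP[om oN] : ~~ odd m && ~~ odd N by move: tw_m; rewrite tw1.
case: (boolP (odd a)) => oa.
  have ha' : (a.-1 < m)%N by lia.
  have -> : betaS0 (phiS f) a = - q^-1 * phiS f a.-1 by rewrite betaS0_odd.
  rewrite !phiS_1 // gP1 gm.
  have orv : ~~ odd (mirror N a) by rewrite /mirror; lia.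
  have -> : mirror N a.-1 = (mirror N a).+1 by rewrite /mirror; lia.
  rewrite g2 ?orv ?implybT //; last by rewrite /mirror; lia.
  rewrite !gQ /paired; try by rewrite ?/mirror; lia.
  rewrite psumS; last by rewrite /mirror; lia.
  rewrite betaS0_even // betaS0_odd // th'.
  have -> : p (mirror N a).+1 = q ^+ 2 * p (mirror N a) by apply: p2; rewrite /mirror; lia.
  by rewrite /lam; field.
have ha' : (a.+1 < m)%N by lia.
rewrite betaS0_even // !phiS_1 // gP1 gm.
have orv : ~~ odd (mirror N a.+1) by rewrite /mirror; lia.
have -> : mirror N a = (mirror N a.+1).+1 by rewrite /mirror; lia.
rewrite !psumS; try by rewrite /mirror; lia.
rewrite g2 ?orv ?implybT //; last by rewrite /mirror; lia.
rewrite !gQ /paired; try by rewrite ?/mirror; lia.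
rewrite (@betaS0_odd f (mirror N a.+1).+1) //= !betaS0_even // th'.
have -> : p (mirror N a.+1).+1 = q ^+ 2 * p (mirror N a.+1) by apply: p2; rewrite /mirror; lia.
by rewrite /lam; field.
Qed.

(** Telescoping: by [p2] and [prv], [p k * phiS f k] is the increment of
    [- eps * q^-1 * p k * psum f 0 (N - k)]. *)
Lemma psum_phiS_2 f k : (N - m <= k <= N)%N ->
  psum (phiS f) (N - m) k =
  eps * q^-1 * (p (N - m)%N * psum f 0 m - p k * psum f 0 (N - k)).
Proof.
move=> /andP[]; elim: k => [|k IHk] h1 h2.
  have -> : (N - m = 0)%N by lia.
  have -> : m = 0%N by lia.
  by rewrite subn0 psumnn; have -> : N = 0%N by [lia]; rewrite psumnn; ring.
case: (ltngtP (N - m) k.+1) h1 => // [lt _ | <- _]; last first.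
  by have -> : (N - (N - m) = m)%N by [lia]; rewrite psumnn; ring.
rewrite psumS ?IHk; try lia.
rewrite phiS_2; last by lia.
have -> : (N - k = (mirror N k).+1)%N by rewrite /mirror; lia.
have -> : (N - k.+1 = mirror N k)%N by rewrite /mirror; lia.
rewrite psumS // p2; last by lia.
have e := prv (k := k); have {e} : p k * p (mirror N k) = 1 by apply: e; lia.
by rewrite /lam => e; field.
Qed.

(** The left side is what the last block contributes to row [a] of [phiS (phiS f)]. Going to the
    last block and back is thus the identity up to a rank one term in [psum f 0 m]. *)
Lemma phiS_2_cross f a : (a < m)%N ->
  eps * (q^-1 * (p (mirror N a) * phiS f (mirror N a)) - lam * psum (phiS f) (N - m) (mirror N a))
  = f a - lam * q^-1 * p (N - m)%N * psum f 0 m.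
Proof.
move=> ha; rewrite psum_phiS_2; last by rewrite /mirror; lia.
rewrite phiS_2; last by rewrite /mirror; lia.
have -> : (N - mirror N a = a.+1)%N by rewrite /mirror; lia.
have -> : mirror N (mirror N a) = a by rewrite /mirror; lia.
rewrite psumS //.
have e : p a * p (mirror N a) = 1 by apply: prv; lia.
transitivity (eps * eps * (p a * p (mirror N a) * f a) -
    eps * eps * (lam * q^-1 * p (N - m)%N * psum f 0 m)); last by rewrite e eps2 !mul1r.
by rewrite /lam; field.
Qed.

Lemma betaS0_1_ext f g a : (a < m)%N -> (forall j, (j < m)%N -> f j = g j) -> betaS0 f a = betaS0 g a.
Proof. by move=> h e; rewrite /betaS0 !e // twist_1. Qed.

Lemma betaS0_2_ext f g a : (N - m <= a < N)%N -> (forall j, (N - m <= j < N)%N -> f j = g j) ->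
  betaS0 f a = betaS0 g a.
Proof. by move=> h e; rewrite /betaS0 !e // twist_2. Qed.

Lemma phiSmid_D f g a : phiSmid (fun j => f j + g j) a = phiSmid f a + phiSmid g a.
Proof. by rewrite /phiSmid psumD; ring. Qed.

Lemma phiSmid_Z c f a : phiSmid (fun j => c * f j) a = c * phiSmid f a.
Proof. by rewrite /phiSmid psumZ; ring. Qed.

Lemma phiSmid0 f a : mid a -> (forall j, mid j -> f j = 0) -> phiSmid f a = 0.
Proof.
move=> ma f0; rewrite (phiSmid_ext (g := fun=> 0 * 0)) //; first by rewrite phiSmid_Z mul0r.
by move=> j mj; rewrite f0 ?mul0r.
Qed.

(** [phiSmid] is self-adjoint for the bilinear form with weights [p]: its partial sums run over
    [i + j < N - 1], symmetric in [i] and [j], and its antidiagonal term is invariant under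
    [mirror]. *)
Lemma psum_phiSmid_sym f g :
  psum (fun j => g j * phiSmid f j) m (N - m) = psum (fun j => f j * phiSmid g j) m (N - m).
Proof.
have widen h a : mid a -> psum h m (mirror N a) =
    \sum_(m <= i < N - m) (if (i < mirror N a)%N then p i * h i else 0).
  by move=> ma; rewrite /psum (big_nat_widen _ _ (N - m)%N) ?big_mkcond //; move: ma; rewrite /mid /mirror; lia.
pose W h1 h2 := \sum_(m <= j < N - m) \sum_(m <= i < N - m)
  (if (i < mirror N j)%N then p j * h1 j * (p i * h2 i) else 0).
pose V h1 h2 := \sum_(m <= j < N - m)
  (if j == mirror N j then 1 else q^-1) * (p j * h1 j) * (p (mirror N j) * h2 (mirror N j)).
pose U := \sum_(m <= j < N - m) (if (j < mirror N j)%N then lam else 0) * (p j * f j * g j).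
have key h1 h2 : psum (fun j => h1 j * phiSmid h2 j) m (N - m) =
    eps * V h1 h2 - eps * lam * W h1 h2
    + \sum_(m <= j < N - m) (if (j < mirror N j)%N then lam else 0) * (p j * h2 j * h1 j).
  rewrite /V /W !mulr_sumr -sumrB -big_split /= /psum.
  apply: eq_big_nat => j mj.
  have -> : \sum_(m <= i < N - m) (if (i < mirror N j)%N then p j * h1 j * (p i * h2 i) else 0)
     = p j * h1 j * psum h2 m (mirror N j).
    rewrite widen // mulr_sumr; apply: eq_bigr => i _.
    by case: ifP; rewrite ?mulr0.
  rewrite /phiSmid; move: (if _ == _ then _ else _) (if _ then lam else 0) (psum _ _ _) => c1 c2 c3. ring.
have eV : V g f = V f g.
  rewrite /V big_nat_rev /=; apply: eq_big_nat => j mj.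
  have -> : (m + (N - m) - j.+1 = mirror N j)%N by rewrite /mirror; lia.
  have -> : mirror N (mirror N j) = j by rewrite /mirror; lia.
  by rewrite (eq_sym (mirror N j)); ring.
have eW : W g f = W f g.
  rewrite /W exchange_big /=; apply: eq_big_nat => j mj.
  apply: eq_big_nat => i mi.
  have -> : (j < mirror N i)%N = (i < mirror N j)%N by rewrite /mirror; lia.
  by case: ifP => // _; ring.
rewrite !key eV eW; congr (_ + _); apply: eq_bigr => j _; ring.
Qed.

Lemma dp_quad a : mid a -> dp a * (dp a - (al - be)) = al * be.
Proof.
move=> ma; apply/eqP; rewrite -subr_eq0; apply/eqP.
by rewrite -[RHS](dpm ma); ring.
Qed.

(** By self-adjointness the sum moves [phiSmid] onto [dp], where [Tdp] evaluates it. *)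
Lemma psum_dp_phiSmid f :
  psum (fun j => dp j * phiSmid f j) m (N - m) =
  th * psum (fun j => (dp j - (al - be)) * f j) m (N - m).
Proof.
rewrite psum_phiSmid_sym -psumZ; apply: psum_ext => j mj.
by rewrite Tdp //; ring.
Qed.

Lemma phiS_dp_2 f a : (N - m <= a < N)%N -> phiS (fun j => dp j * f j) a = 0.
Proof.
move=> ha; rewrite phiS_2 // dp1 ?mul0r ?mulr0; last by rewrite /mirror; lia.
rewrite psum0 ?mulr0 ?subr0 ?mulr0 // => j hj.
by rewrite dp1 ?mul0r //; move: hj; rewrite /mirror; lia.
Qed.

Lemma phiS_dp_mid f a : mid a -> phiS (fun j => dp j * f j) a = phiSmid (fun j => dp j * f j) a.
Proof.
move=> ha; rewrite phiS_mid // psum0 ?mulr0 ?subr0 // => j hj.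
by rewrite dp1 ?mul0r.
Qed.

Lemma betaS_1 f a : (a < m)%N -> betaS f a = betaS0 f a.
Proof. by rewrite /betaS /paired => ->. Qed.

Lemma betaS_2 f a : (N - m <= a < N)%N -> betaS f a = betaS0 f a.
Proof. by rewrite /betaS /paired => /andP[-> _]; rewrite orbT. Qed.

Lemma betaS_mid f a : mid a -> betaS f a = 0.
Proof. by rewrite /betaS /paired /mid => h; case: ifP => //; lia. Qed.

Lemma crossA_1 a : (a < m)%N -> crossA a = al * be.
Proof. by rewrite /crossA /paired => ->. Qed.

Lemma crossA_2 a : (N - m <= a < N)%N -> crossA a = al * be.
Proof. by rewrite /crossA /paired => /andP[-> _]; rewrite orbT. Qed.

Lemma betaS0_crossA f a : (a < N)%N -> paired N m a -> betaS0 (fun j => crossA j * f j) a = al * be * betaS0 f a.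
Proof.
move=> aN /orP[h | h]; rewrite -betaS0_Z.
  by apply: betaS0_1_ext => // j hj; rewrite crossA_1.
by apply: betaS0_2_ext => [|j hj]; rewrite ?h // crossA_2.
Qed.

Lemma blocks a : (a < N)%N -> [\/ (a < m)%N, mid a | (N - m <= a < N)%N].
Proof.
move=> aN; case: (ltnP a m) => h; first by constructor 1.
case: (ltnP a (N - m)) => h'; [constructor 2 | constructor 3]; rewrite /mid; lia.
Qed.

(** The block from [phi] to [phi] of the reflection equation. [phiS_row_off] is the block from [bet]
    to [phi], [betaS0_row_diag] from [bet] to [bet], and [betaS0_row_off] from [phi] to [bet]. *)
Lemma phiS_row_diag f a : (a < N)%N ->
  phiS (fun j => dp j * phiS (fun i => dp i * f i) j + betaS (fun i => crossA i * f i) j) a =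
  dp a * phiS (fun j => dp j * phiS f j) a + betaS (fun j => crossA j * phiS f j) a.
Proof.
move=> aN; set F := fun j => _.
have F1 j : (j < m)%N -> F j = betaS0 (fun i => al * be * f i) j.
  by move=> hj; rewrite /F dp1 // mul0r add0r betaS_1 // betaS0_crossA ?betaS0_Z /paired ?hj //; lia.
have F2 j : (N - m <= j < N)%N -> F j = betaS0 (fun i => al * be * f i) j.
  move=> hj; rewrite /F phiS_dp_2 // mulr0 add0r betaS_2 // betaS0_crossA ?betaS0_Z /paired //; lia.
have Fm j : mid j -> F j = dp j * phiSmid (fun i => dp i * f i) j.
  by move=> hj; rewrite /F betaS_mid // phiS_dp_mid // addr0.
have e1 : psum F 0 m = al * be * (th * psum f 0 m).
  rewrite (@psum_ext _ _ 0 m F1) psum_betaS0 ?psumZ //; [ring | | by rewrite leqnn].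
  by move: tw_m; case: tw => //= /andP[].
case: (blocks aN) => ha.
(* On the middle [F] is not [betaS0] of anything, but the quadratic relation [dp_quad] gives its
   weighted sum the value that [phiS_betaS0_1] asks for. *)
- have em : psum F m (N - m) = th * psum (fun i => al * be * f i) m (N - m).
    rewrite (@psum_ext _ _ m (N - m) Fm) psum_dp_phiSmid; congr (_ * _); apply: psum_ext => j hj.
    by rewrite -(dp_quad hj); ring.
  rewrite (@phiS_betaS0_1 (fun i => al * be * f i)) //; last first.
    by move=> j jN /orP[] hj; [apply: F1 | apply: F2]; rewrite ?hj.
  rewrite dp1 // mul0r add0r betaS_1 // betaS0_crossA /paired ?ha // -betaS0_Z.
  by apply: betaS0_1_ext => // j _; rewrite phiS_Z.
- rewrite phiS_mid // e1 (phiSmid_ext ha Fm) -Tdp_comm // phiS_dp_mid // betaS_mid // addr0.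
  rewrite (phiSmid_ext (f := fun j => dp j * phiS f j)
     (g := fun j => dp j * phiSmid f j + (- (eps * lam * psum f 0 m)) * dp j)) //; last first.
    by move=> j hj; rewrite phiS_mid //; ring.
  by rewrite phiSmid_D phiSmid_Z Tdp // -(dp_quad ha); ring.
- rewrite (phiS_2_ext ha F1) phiS_betaS0_2 // phiS_dp_2 // mulr0 add0r betaS_2 // betaS0_crossA ?/paired; try lia.
  rewrite -betaS0_Z; apply: betaS0_2_ext => // j _; by rewrite phiS_Z.
Qed.

Section Beta.
Variable b : nat -> C.
Hypothesis b0 : forall j, mid j -> b j = 0.

Lemma phiS_row_off a : (a < N)%N ->
  phiS (fun j => dp j * phiS b j + betaS (fun i => dt i * b i) j) a =
  dp a * phiS (betaS b) a + betaS (fun j => dt j * betaS b j) a.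
Proof.
move=> aN; set F := fun j => _.
have F1 j : (j < m)%N -> F j = (al - be) * betaS0 b j.
  move=> hj; rewrite /F dp1 // mul0r add0r betaS_1 // -betaS0_Z.
  by apply: betaS0_1_ext => // i hi; rewrite dt1.
have F2 j : (N - m <= j < N)%N -> F j = (al - be) * phiS b j.
  move=> hj; rewrite /F dp2 // betaS_2 //.
  rewrite (betaS0_2_ext (g := fun=> 0) hj) ?betaS0_const ?mulr0 ?addr0 // => i hi.
  by rewrite dt2 ?mul0r.
have Fm j : mid j -> F j = - (eps * lam * psum b 0 m) * dp j.
  by move=> hj; rewrite /F betaS_mid // phiS_mid // (phiSmid0 hj b0); ring.
have qP1 : psum (betaS0 b) 0 m = th * psum b 0 m.
  rewrite psum_betaS0 //; last by rewrite leqnn.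
  by move: tw_m; case: tw => //= /andP[].
have e1 : psum F 0 m = (al - be) * (th * psum b 0 m).
  by rewrite (@psum_ext _ _ 0 m F1) psumZ qP1.
case: (blocks aN) => ha.
- rewrite dp1 // mul0r add0r phiS_1 // e1 (@psum_ext _ _ m (N - m) Fm) psumZ (F1 a ha).
  have hr : (N - m <= mirror N a < N)%N by rewrite /mirror; lia.
  have -> : psum F (N - m) (mirror N a) = (al - be) * psum (phiS b) (N - m) (mirror N a).
    by rewrite -psumZ; apply: psum_ext => j hj; apply: F2; lia.
  rewrite (F2 _ hr) betaS_1 //.
  have -> : betaS0 (fun j => dt j * betaS b j) a = (al - be) * (b a + lam * betaS0 b a).
    rewrite -betaS0_2 -betaS0_Z; apply: betaS0_1_ext => // j hj; by rewrite dt1 // betaS_1.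
  have X := phiS_2_cross b ha.
  have -> : b a = eps * (q^-1 * (p (mirror N a) * phiS b (mirror N a)) - lam * psum (phiS b) (N - m) (mirror N a))
      + lam * q^-1 * p (N - m)%N * psum b 0 m by rewrite X; ring.
  (* Isolates [lam * psum dp m (N - m)]: with its value [sum_dp] the rank one terms in [psum b 0 m]
     cancel. *)
  transitivity (eps * (q^-1 * (p (mirror N a) * ((al - be) * phiS b (mirror N a)))
      - lam * ((al - be) * (th * psum b 0 m) + (al - be) * psum (phiS b) (N - m) (mirror N a)))
      + eps * eps * lam * psum b 0 m * (lam * psum dp m (N - m))
      + lam * ((al - be) * betaS0 b a)); first by ring.
  by rewrite sum_dp eps2; ring.
- rewrite phiS_mid // e1 (phiSmid_ext ha Fm) phiSmid_Z Tdp // betaS_mid // phiS_mid //.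
  rewrite (phiSmid0 ha); last by move=> j hj; rewrite betaS_mid.
  rewrite (psum_ext (f := betaS b) (g := betaS0 b)); last by move=> j hj; rewrite betaS_1.
  by rewrite qP1; ring.
- rewrite (phiS_2_ext ha F1) phiS_Z dp2 // betaS_2 //.
  rewrite (betaS0_2_ext (g := fun=> 0) ha) ?betaS0_const ?mulr0 ?addr0; last first.
    by move=> i hi; rewrite dt2 ?mul0r.
  by congr (_ * _); apply: phiS_2_ext => // j hj; rewrite betaS_1.
Qed.

Lemma betaS0_row_diag a : (a < N)%N -> paired N m a ->
  betaS (fun j => dt j * betaS (fun i => dt i * b i) j + crossA j * phiS b j) a =
  dt a * betaS (fun j => dt j * betaS b j) a + crossA a * phiS (betaS b) a.
Proof.
move=> aN pa; case: (blocks aN) => ha; last 1 first.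
- rewrite betaS_2 // dt2 // mul0r add0r.
  rewrite (betaS0_2_ext (g := fun j => al * be * phiS b j) ha); last first.
    by move=> j hj; rewrite dt2 // crossA_2 //; ring.
  rewrite betaS0_Z -phiS_betaS0_2 // crossA_2 //; congr (_ * _); apply: phiS_2_ext => // j hj.
  by rewrite betaS_1.
- rewrite !betaS_1 // dt1 // crossA_1 //.
  rewrite (betaS0_1_ext (g := fun j => (al - be) ^+ 2 * betaS0 b j + al * be * phiS b j) ha); last first.
    move=> j hj; rewrite dt1 // betaS_1 // crossA_1 // (betaS0_1_ext (g := fun j => (al - be) * b j) hj) ?betaS0_Z; first by ring.
    by move=> i hi; rewrite dt1.
  rewrite betaS0_D !betaS0_Z.
  rewrite (betaS0_1_ext (f := fun j => dt j * _) (g := fun j => (al - be) * betaS0 b j) ha); last first.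
    by move=> j hj; rewrite dt1 // betaS_1.
  rewrite betaS0_Z (@phiS_betaS0_1 b) //; first by ring.
    by move=> j _ pj; rewrite /betaS pj.
  by rewrite !psum0 ?mulr0 // => j hj; rewrite ?b0 ?betaS_mid.
- by move: pa ha; rewrite /paired /mid; lia.
Qed.

End Beta.

Lemma betaS0_row_off f a : (a < N)%N -> paired N m a ->
  betaS (fun j => dt j * betaS (fun i => crossA i * f i) j + crossA j * phiS (fun i => dp i * f i) j) a =
  dt a * betaS (fun j => crossA j * phiS f j) a + crossA a * phiS (fun j => dp j * phiS f j) a.
Proof.
move=> aN pa; case: (blocks aN) => ha; last 1 first.
- rewrite betaS_2 // dt2 // mul0r add0r phiS_dp_2 // mulr0.
  rewrite (betaS0_2_ext (g := fun=> 0) ha) ?betaS0_const ?mulr0 // => j hj.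
  by rewrite dt2 // phiS_dp_2 //; ring.
(* [E] collects what the last block contributes to a row of the first. It is kept opaque: its value
   on [dp * phiS f] comes from [phiS_2_cross], and the other occurrences match on both sides. *)
- pose E h j := eps * (q^-1 * (p (mirror N j) * h (mirror N j)) - lam * psum h (N - m) (mirror N j)).
  have T1E h j : (j < m)%N -> phiS h j = E h j - eps * lam * (psum h m (N - m) + psum h 0 m) + lam * h j.
    by move=> hj; rewrite phiS_1 // /E; ring.
  rewrite !betaS_1 // dt1 // crossA_1 //.
  have dpE j : (j < m)%N -> phiS (fun i => dp i * f i) j =
      (al - be) * E f j + - (eps * lam * psum (fun i => dp i * f i) m (N - m)).
    move=> hj; rewrite T1E // [psum _ 0 m]psum0; last by move=> i hi; rewrite dp1 ?mul0r.
    rewrite dp1 // /E dp2; last by rewrite /mirror; lia.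
    rewrite (psum_ext (i := (N - m)%N) (g := fun i => (al - be) * f i)) ?psumZ; first by ring.
    by move=> i hi; rewrite dp2 //; move: hi; rewrite /mirror; lia.
  have Ecr : E (fun j => dp j * phiS f j) a = (al - be) * (f a - lam * q^-1 * p (N - m)%N * psum f 0 m).
    rewrite -(phiS_2_cross f ha) /E dp2; last by rewrite /mirror; lia.
    rewrite (psum_ext (i := (N - m)%N) (g := fun i => (al - be) * phiS f i)) ?psumZ; first by ring.
    by move=> i hi; rewrite dp2 //; move: hi; rewrite /mirror; lia.
  clearbody E.
  rewrite (betaS0_1_ext (g := fun j => al * be * ((al - be) * betaS0 f j + (al - be) * E f j)
     + - (al * be * (eps * lam * psum (fun i => dp i * f i) m (N - m)))) ha); last first.
    move=> j hj; rewrite dt1 // betaS_1 // crossA_1 // betaS0_crossA /paired ?hj //; last by lia.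
    by rewrite dpE //; ring.
  rewrite betaS0_D betaS0_const betaS0_Z betaS0_D !betaS0_Z betaS0_2.
  rewrite (betaS0_1_ext (f := fun j => crossA j * phiS f j) (g := fun j => al * be * (E f j + lam * f j
     + - (eps * lam * (psum f m (N - m) + psum f 0 m)))) ha); last first.
    by move=> j hj; rewrite crossA_1 // T1E //; ring.
  rewrite betaS0_Z !betaS0_D betaS0_const betaS0_Z.
  rewrite T1E // dp1 // (@psum0 (fun j => dp j * phiS f j) 0 m); last by move=> i hi; rewrite dp1 ?mul0r.
  rewrite Ecr.
  have -> : psum (fun j => dp j * phiS f j) m (N - m) =
     th * (psum (fun j => dp j * f j) m (N - m) - (al - be) * psum f m (N - m))
     - eps * lam * psum f 0 m * psum dp m (N - m).
    have -> : psum (fun j => dp j * f j) m (N - m) - (al - be) * psum f m (N - m) =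
       psum (fun j => (dp j - (al - be)) * f j) m (N - m).
      rewrite -mulNr -psumZ -psumD; apply: psum_ext => j _; ring.
    rewrite -psum_dp_phiSmid -mulNr -(psumZ (- (eps * lam * psum f 0 m))) -psumD; apply: psum_ext => j hj.
    by rewrite phiS_mid //; ring.
  apply/eqP; rewrite -subr_eq0; apply/eqP.
  transitivity (al * be * lam * psum f 0 m * ((al - be) * (eps * th + q^-1 * p (N - m)%N)
      - eps * eps * (lam * psum dp m (N - m)))); first by ring.
  by rewrite sum_dp eps2 mul1r subrr mulr0.
- by move: pa ha; rewrite /paired /mid; lia.
Qed.

Lemma psum_const2 k : (N - m <= k <= N)%N ->
  lam * psum (fun=> 1) (N - m) k = q^-1 * (p k - p (N - m)%N).
Proof.
move=> /andP[]; elim: k => [|k IHk] h1 h2.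
  have -> : (N - m = 0)%N by lia.
  by rewrite psumnn; ring.
case: (ltngtP (N - m) k.+1) h1 => // [lt _ | <- _]; last by rewrite psumnn; ring.
rewrite psumS ?mulrDr ?IHk ?p2; try lia.
by rewrite /lam; field.
Qed.

(** Prepares (ii): on the trivial submodule [phi] is a constant [x] and [bet] vanishes, so these are
    the [phi] coordinates of [A S A]. Their common value shows that [A S A] acts there by
    [al * be * th]; [off_const] treats the [bet] coordinates. *)
Lemma diag_const x a : (a < N)%N ->
  dp a * phiS (fun j => dp j * x) a + betaS (fun j => crossA j * x) a = al * be * th * x.
Proof.
move=> aN; case: (blocks aN) => ha.
- rewrite dp1 // mul0r add0r betaS_1 // betaS0_crossA ?/paired ?ha // betaS0_const; ring.
- rewrite phiS_dp_mid // (phiSmid_ext (g := fun j => x * dp j) ha) ?phiSmid_Z ?Tdp // ?betaS_mid //.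
    by rewrite -(dp_quad ha); ring.
  by move=> j _; rewrite mulrC.
- rewrite phiS_dp_2 // mulr0 add0r betaS_2 // betaS0_crossA ?/paired ?betaS0_const; try lia.
  ring.
Qed.

Lemma off_const x a : (a < N)%N -> paired N m a ->
  dt a * betaS (fun j => crossA j * x) a + crossA a * phiS (fun j => dp j * x) a = 0.
Proof.
move=> aN pa; case: (blocks aN) => ha; last by rewrite dt2 // phiS_dp_2 //; ring.
  rewrite dt1 // betaS_1 // crossA_1 // betaS0_crossA // betaS0_const phiS_1 // psum0; last first.
    by move=> j hj; rewrite dp1 ?mul0r.
  rewrite (dp1 ha) dp2; last by rewrite /mirror; lia.
  rewrite (psum_ext (g := fun j => x * dp j)); last by move=> j _; rewrite mulrC.
  rewrite (psum_ext (i := (N - m)%N) (g := fun j => (al - be) * x * 1)); last first.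
    by move=> j hj; rewrite dp2 ?mulr1 //; move: hj; rewrite /mirror; lia.
  rewrite !psumZ.
  transitivity (al * be * ((al - be) * (eps * eps) * (th * x) + eps * (q^-1 * (p (mirror N a) * ((al - be) * x))
    - x * (lam * psum dp m (N - m)) - (al - be) * x * (lam * psum (fun=> 1) (N - m) (mirror N a)))));
    first by rewrite eps2; ring.
  by rewrite sum_dp psum_const2; [ring | rewrite /mirror; lia].
by move: pa ha; rewrite /paired /mid; lia.
Qed.

Lemma betaS_D f g a : betaS (fun j => f j + g j) a = betaS f a + betaS g a.
Proof. by rewrite /betaS betaS0_D; case: ifP; rewrite ?addr0. Qed.

Lemma betaS_ext f g a : (forall j, f j = g j) -> betaS f a = betaS g a.
Proof. by move=> e; rewrite /betaS /betaS0 !e. Qed.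

End ZeroWeight.

(* [dp] and [dt] are the diagonal of [A] as it acts on [phi] and on [bet]. *)
Record weights (m : nat) (tw : bool) (eps : C) (p dp dt : nat -> C) (al be : C) : Prop :=
 Weights {
  w_m : (m.*2 <= N)%N;
  w_tw : tw ==> ~~ odd m && ~~ odd N;
  w_eps : eps * eps = 1;
  w_p1 : forall k, (k.+1 < m)%N -> p k.+1 = q ^+ 2 * p k;
  w_p2 : forall k, (N - m <= k < N)%N -> p k.+1 = q ^+ 2 * p k;
  w_prv : forall k, (k < N)%N -> p k * p (mirror N k) = 1;
  w_dp1 : forall a, (a < m)%N -> dp a = 0;
  w_dp2 : forall a, (N - m <= a < N)%N -> dp a = al - be;
  w_dt1 : forall a, (a < m)%N -> dt a = al - be;
  w_dt2 : forall a, (N - m <= a < N)%N -> dt a = 0;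
  w_dpm : forall a, (m <= a < N - m)%N -> (dp a - al) * (dp a + be) = 0;
  w_Tdp : forall a, (m <= a < N - m)%N ->
    phiSmid m eps p dp a = (if tw then - q^-1 else q) * (dp a - (al - be));
  w_comm : forall f a, (m <= a < N - m)%N ->
    dp a * phiSmid m eps p (fun j => dp j * phiSmid m eps p f j) a =
    phiSmid m eps p (fun j => dp j * phiSmid m eps p (fun i => dp i * f i) j) a;
  w_sum : lam * psum p dp m (N - m) =
    (al - be) * (eps * (if tw then - q^-1 else q) + q^-1 * p (N - m)%N) }.

Section Sector.
Variables (m : nat) (tw : bool) (eps : C) (p dp dt : nat -> C) (al be : C).
Hypothesis W : weights m tw eps p dp dt al be.
Variables (f b : nat -> C).
Hypothesis b0 : forall j, (m <= j < N - m)%N -> b j = 0.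

Let T := phiS eps p.
Let Qm := betaS m tw.
Let ga := crossA m al be.
Let x1 j := dp j * f j + b j.
Let y1 j := dt j * b j + ga j * f j.
Let x3 j := dp j * T x1 j + Qm y1 j.
Let y3 j := dt j * Qm y1 j + ga j * T x1 j.
Let u2 j := dp j * T f j + Qm b j.
Let v2 j := dt j * Qm b j + ga j * T f j.

Lemma sector_diag a : (a < N)%N -> T x3 a = dp a * T u2 a + Qm v2 a.
Proof.
case: W => mN *.
transitivity (T (fun j =>
   (dp j * T (fun i => dp i * f i) j + Qm (fun i => ga i * f i) j) +
   (dp j * T b j + Qm (fun i => dt i * b i) j)) a).
  apply: phiS_ext => // j _.
  by rewrite /x3 /x1 /y1 /T phiS_D /Qm betaS_D; ring.
rewrite /T phiS_D (@phiS_row_diag m tw eps p dp al be) // (@phiS_row_off m tw eps p dp dt al be) //.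
by rewrite /u2 /v2 /T /Qm /ga phiS_D betaS_D; ring.
Qed.

Lemma sector_off a : (a < N)%N -> paired N m a -> Qm y3 a = dt a * Qm v2 a + ga a * T u2 a.
Proof.
case: W => mN *.
transitivity (Qm (fun j =>
   (dt j * Qm (fun i => ga i * f i) j + ga j * T (fun i => dp i * f i) j) +
   (dt j * Qm (fun i => dt i * b i) j + ga j * T b j)) a).
  apply: betaS_ext => j.
  by rewrite /y3 /x1 /y1 /T phiS_D /Qm betaS_D; ring.
rewrite /Qm betaS_D (@betaS0_row_off m tw eps p dp dt al be) //.
rewrite (@betaS0_row_diag m tw eps p dt al be) //.
by rewrite /u2 /v2 /T /Qm /ga phiS_D betaS_D; ring.
Qed.

End Sector.

Lemma sector_diag_const m tw eps p dp dt al be x a :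
  weights m tw eps p dp dt al be -> (a < N)%N ->
  dp a * phiS eps p (fun j => dp j * x) a + betaS m tw (fun j => crossA m al be j * x) a =
  al * be * (if tw then - q^-1 else q) * x.
Proof. by case=> *; rewrite (@diag_const m tw eps p dp al be). Qed.

Lemma sector_off_const m tw eps p dp dt al be x a :
  weights m tw eps p dp dt al be -> (a < N)%N -> paired N m a ->
  dt a * betaS m tw (fun j => crossA m al be j * x) a
    + crossA m al be a * phiS eps p (fun j => dp j * x) a = 0.
Proof. by case=> *; rewrite (@off_const m tw eps p dp dt al be). Qed.

End ZeroWeightSectors.

(** * The reflection equation in coordinates *)

Section BraidedReflection.
Variables (C : fieldType) (q : C) (N : nat).
Hypothesis q0 : q != 0.
Let lam := q - q^-1.

Section HeckeOnly.
Variables (m : nat) (sg : nat -> nat) (d y : nat -> C) (al be : C).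
Hypothesis sh : shape N m sg d y al be.
Hypothesis sg_mirror : forall a, (a < N)%N -> paired N m a -> sg a = mirror N a.
Hypothesis dmid : forall a b, (a < N)%N -> (b < N)%N -> ~~ paired N m a -> ~~ paired N m b -> d a = d b.

Lemma hecke_RE v a b : (a < N)%N -> (b < N)%N ->
  hecke q (actA sg d y (hecke q (actA sg d y v))) a b
  = actA sg d y (hecke q (actA sg d y (hecke q v))) a b.
Proof.
move=> aN bN; have mN := sh_m sh.
case: (boolP (paired N m a)) => pa; case: (boolP (paired N m b)) => pb.
- case: (eqVneq a b) => [<-|nab]; first by case: (RE_self q0 sh (S := hecke q) (a := a) v).
  case: (eqVneq a (sg b)) => [e|nasb].
    have -> : b = sg a by rewrite e (sh_inv sh).
    by case: (RE_self q0 sh (S := hecke q) (a := a) v).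
  apply: (RE_pair q0 sh) => //.
    by rewrite sg_mirror ?mirrorK ?mirror_lt ?paired_mirror // eq_sym.
  apply: contra_neq nasb => ->; by rewrite sg_mirror ?mirrorK ?mirror_lt ?paired_mirror.
- by case: (RE_pair_fix q0 sh (S := hecke q) (a := a) (b := b) v).
- by case: (RE_pair_fix q0 sh (S := hecke q) (a := b) (b := a) v).
- by apply: (RE_fix sh) => //; apply: dmid.
Qed.

End HeckeOnly.

Section Orthosymplectic.
Variables (m : nat) (sg : nat -> nat) (d y : nat -> C) (al be : C).
Variables (tw : bool) (eps : C) (p nrm : nat -> C).

(* Vectors of the trivial submodule are those with [nrm a * v a a'] independent of
   [a] and no other coordinates. *)
Definition Sop (v : nat -> nat -> C) (a b : nat) : C :=
  if b == mirror N a then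
    (if a == mirror N a then 1 else q^-1) * v b a + (if (a < b)%N then lam else 0) * v a b
    - lam * (nrm a)^-1 * \sum_(0 <= j < mirror N a) nrm (mirror N j) * v j (mirror N j)
  else hecke q v a b.

(** The exception [b = mirror N a] in [dm_mid] admits the two central indices of type (4), where [d]
    takes opposite values; that coordinate belongs to [phi]. *)
Record datum : Prop := Datum {
  dm_sh : shape N m sg d y al be;
  dm_W : weights q N m tw eps p (fun a => d (mirror N a)) (fun a => d (twist tw a)) al be;
  dm_nrm0 : forall a, (a < N)%N -> nrm a != 0;
  dm_nrm_mirror : forall a, (a < N)%N -> nrm (mirror N a) = eps * p a * nrm a;
  dm_nrm_twist : forall a, (a < N)%N -> tw -> paired N m a -> ~~ odd a -> nrm a = q * nrm a.+1;
  dm_y_twist : forall a, (a < N)%N -> tw -> paired N m a -> y (twist tw a) = - y a;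
  dm_sg : forall a, (a < N)%N -> paired N m a -> sg a = twist tw (mirror N a);
  dm_mid : forall a b, (a < N)%N -> (b < N)%N -> ~~ paired N m a -> ~~ paired N m b ->
     b != mirror N a -> d a = d b }.

Hypothesis D : datum.
Let sh := dm_sh D.
Let A := actA sg d y.
Let T := phiS q N eps p.
Let Qm := betaS q N m tw.
Let ga := crossA N m al be.

Definition phi v a : C := nrm a * v a (mirror N a).
(** The factor [y (mirror N a)] makes [A] add [bet] to [phi] with coefficient one, so that the
    entries of [A] enter [bet_A] only through the products [y a * y (sg a)]. *)
Definition bet v a : C := y (mirror N a) * nrm a * v a (sg (mirror N a)).

Let mN : (m.*2 <= N)%N := sh_m sh.

Lemma sg_mirrorE a : (a < N)%N -> paired N m a -> sg (mirror N a) = twist tw a.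
Proof. by move=> aN pa; rewrite (dm_sg D) ?mirror_lt ?paired_mirror ?mirrorK. Qed.

Lemma twist_lt a : (a < N)%N -> paired N m a -> (twist tw a < N)%N.
Proof.
by move=> aN pa; rewrite -sg_mirrorE // (sg_ltN sh) ?mirror_lt ?paired_mirror.
Qed.

Lemma twist_pairedE a : (a < N)%N -> paired N m a -> paired N m (twist tw a).
Proof.
by move=> aN pa; rewrite -sg_mirrorE // (paired_sg sh) ?mirror_lt ?paired_mirror.
Qed.

Lemma twist_neq_mirror a : (a < N)%N -> paired N m a -> twist tw a != mirror N a.
Proof.
move=> aN pa; rewrite -sg_mirrorE //.
have pr : paired N m (mirror N a) by rewrite paired_mirror.
case: (paired_cases (mirror_lt aN) pr) => h.
  by have := sh_12 sh h; move: h; lia.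
by have := sh_21 sh h; move: h; lia.
Qed.

Lemma twist_mirrorE a : (a < N)%N -> paired N m a -> twist tw (mirror N a) = mirror N (twist tw a).
Proof.
move=> aN pa; rewrite -(dm_sg D) // -sg_mirrorE // -(sh_com sh) ?mirror_lt ?paired_mirror //.
by rewrite mirrorK.
Qed.

Lemma bet_mid v a : (m <= a < N - m)%N -> bet v a = 0.
Proof.
move=> h; rewrite /bet (sh_y0 sh) ?mul0r //; first by rewrite /mirror; lia.
by rewrite paired_mirror // /paired; lia.
Qed.

Lemma phi_A v a : (a < N)%N -> phi (A v) a = d (mirror N a) * phi v a + bet v a.
Proof. by move=> aN; rewrite /phi /bet /A /actA; ring. Qed.

Lemma bet_A v a : (a < N)%N -> bet (A v) a = d (twist tw a) * bet v a + ga a * phi v a.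
Proof.
move=> aN; case: (boolP (paired N m a)) => pa; last first.
  have h : (m <= a < N - m)%N by move: pa; rewrite /paired; lia.
  by rewrite !bet_mid // /ga /crossA (negPf pa); ring.
have pr : paired N m (mirror N a) by rewrite paired_mirror.
rewrite /bet /phi /A /actA /ga /crossA pa -(sh_y sh (mirror_lt aN) pr).
by rewrite (sh_inv sh) ?mirror_lt // sg_mirrorE //; ring.
Qed.

(** By [dm_nrm_mirror] the factors [nrm (mirror N j)] in [Sop] become the weights [eps * p j]. *)
Lemma phi_S v a : (a < N)%N -> phi (Sop v) a = T (phi v) a.
Proof.
move=> aN; have n0 := dm_nrm0 D aN.
rewrite /phi /Sop eqxx /T /phiS mirrorK // /psum.
have -> : \sum_(0 <= j < mirror N a) nrm (mirror N j) * v j (mirror N j) =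
          eps * \sum_(0 <= j < mirror N a) p j * (nrm j * v j (mirror N j)).
  rewrite mulr_sumr; apply: eq_big_nat => j /andP[_ h].
  rewrite (dm_nrm_mirror D); first by ring.
  by apply: ltn_trans h (mirror_lt aN).
have e : nrm a = eps * p (mirror N a) * nrm (mirror N a).
  by rewrite -(dm_nrm_mirror D) ?mirror_lt // mirrorK.
have -> : forall x y z, nrm a * (x * v (mirror N a) a + y * v a (mirror N a) - lam * (nrm a)^-1 * z)
   = x * (nrm a * v (mirror N a) a) + y * (nrm a * v a (mirror N a)) - lam * z.
  by move=> x z t; field.
by rewrite {1}e /lam; case: ifP => _; case: ifP => _; ring.
Qed.

(** [S] exchanges the coordinates [(a, twist tw a)] and [(twist tw a, a)], that is, the indices [a]
    and [twist tw a] of [bet]; the quotient of their normalising factors is the coefficient of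
    [betaS0]. *)
Lemma bet_S v a : (a < N)%N -> bet (Sop v) a = Qm (bet v) a.
Proof.
move=> aN; case: (boolP (paired N m a)) => pa; last first.
  have h : (m <= a < N - m)%N by move: pa; rewrite /paired; lia.
  by rewrite !bet_mid // /Qm /betaS (negPf pa).
rewrite /Qm /betaS pa /betaS0 /bet /Sop sg_mirrorE // (negPf (twist_neq_mirror aN pa)) /hecke.
rewrite sg_mirrorE ?twist_lt ?twist_pairedE // twistK -twist_mirrorE //.
have twh : tw -> y (twist tw (mirror N a)) = - y (mirror N a).
  by move=> h; apply: (dm_y_twist D); rewrite ?mirror_lt ?paired_mirror.
have [tw1 | tw0] := orP (orbN tw); last first.
  have -> : twist tw a = a by rewrite /twist (negPf tw0).
  have -> : twist tw (mirror N a) = mirror N a by rewrite /twist (negPf tw0).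
  by rewrite eqxx ltnn (negPf tw0); ring.
have na := dm_nrm_twist D.
rewrite twh //.
have -> : a == twist tw a = false by rewrite /twist tw1; case: ifP; lia.
rewrite /twist tw1 /lam; case: (boolP (odd a)) => oa.
  have -> : (a < a.-1)%N = false by lia.
  have e : nrm a.-1 = q * nrm a.
    rewrite na //; try lia; first by congr (_ * nrm _); lia.
    by have := twist_pairedE aN pa; rewrite /twist tw1 oa.
  by rewrite e; field.
rewrite ltnSn (na a) // /lam.
by field.
Qed.

Lemma Qm_extN f g a : (a < N)%N -> (forall j, (j < N)%N -> f j = g j) -> Qm f a = Qm g a.
Proof.
move=> aN e; rewrite /Qm /betaS; case: (boolP (paired N m a)) => // pa.
by rewrite /betaS0 !e // twist_lt.
Qed.

Lemma phi_AS v a : (a < N)%N -> phi (A (Sop v)) a = d (mirror N a) * T (phi v) a + Qm (bet v) a.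
Proof. by move=> aN; rewrite phi_A // phi_S // bet_S. Qed.

Lemma bet_AS v a : (a < N)%N ->
  bet (A (Sop v)) a = d (twist tw a) * Qm (bet v) a + ga a * T (phi v) a.
Proof. by move=> aN; rewrite bet_A // phi_S // bet_S. Qed.

Lemma phi_ASA v a : (a < N)%N -> phi (A (Sop (A v))) a =
  d (mirror N a) * T (fun j => d (mirror N j) * phi v j + bet v j) a
  + Qm (fun j => d (twist tw j) * bet v j + ga j * phi v j) a.
Proof.
move=> aN; rewrite phi_AS //; congr (_ * _ + _).
  by apply: phiS_ext => // j jN; rewrite phi_A.
by apply: Qm_extN => // j jN; rewrite bet_A.
Qed.

Lemma bet_ASA v a : (a < N)%N -> bet (A (Sop (A v))) a =
  d (twist tw a) * Qm (fun j => d (twist tw j) * bet v j + ga j * phi v j) a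
  + ga a * T (fun j => d (mirror N j) * phi v j + bet v j) a.
Proof.
move=> aN; rewrite bet_AS //; congr (_ * _ + _ * _).
  by apply: Qm_extN => // j jN; rewrite bet_A.
by apply: phiS_ext => // j jN; rewrite phi_A.
Qed.

Lemma RE_phi v a : (a < N)%N ->
  Sop (A (Sop (A v))) a (mirror N a) = A (Sop (A (Sop v))) a (mirror N a).
Proof.
move=> aN; apply: (mulfI (dm_nrm0 D aN)).
rewrite -/(phi _ a) -[RHS]/(phi _ a) phi_S // phi_AS //.
rewrite /T (phiS_ext q eps p aN (phi_ASA v)).
rewrite /T (phiS_ext q eps p aN (phi_AS v)) (Qm_extN aN (bet_AS v)).
exact: (sector_diag q0 (dm_W D)) (bet_mid v) _ aN.
Qed.

Lemma RE_bet v a : (a < N)%N -> paired N m a ->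
  Sop (A (Sop (A v))) a (sg (mirror N a)) = A (Sop (A (Sop v))) a (sg (mirror N a)).
Proof.
move=> aN pa.
have y0 : y (mirror N a) * nrm a != 0.
  rewrite mulf_neq0 ?(dm_nrm0 D) //.
  have pr : paired N m (mirror N a) by rewrite paired_mirror.
  by apply: contra_neq (sh_ab sh) => e; rewrite -(sh_y sh (mirror_lt aN) pr) e mul0r.
apply: (mulfI y0).
rewrite -/(bet _ a) -[RHS]/(bet _ a) bet_S // bet_AS //.
rewrite (Qm_extN aN (bet_ASA v)).
rewrite /T (phiS_ext q eps p aN (phi_AS v)) (Qm_extN aN (bet_AS v)).
exact: (sector_off q0 (dm_W D)) (bet_mid v) _ aN pa.
Qed.

Lemma Sop_hecke v a b : b != mirror N a -> Sop v a b = hecke q v a b.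
Proof. by rewrite /Sop => /negPf->. Qed.

Lemma mirror_swap a b : (a < N)%N -> (b < N)%N -> (a == mirror N b) = (b == mirror N a).
Proof. by move=> aN bN; apply/eqP/eqP => ->; rewrite mirrorK. Qed.

Lemma sg_swap a b : (a < N)%N -> (b < N)%N -> paired N m a -> paired N m b ->
  (sg a == b) = (a == sg b).
Proof. by move=> aN bN pa pb; apply/eqP/eqP => [<- | ->]; rewrite (sh_inv sh). Qed.

Lemma good_pair a b x z : (a < N)%N -> (b < N)%N -> paired N m a -> paired N m b ->
  b != mirror N a -> b != sg (mirror N a) ->
  x \in [:: a; sg a] -> z \in [:: b; sg b] -> z != mirror N x.
Proof.
move=> aN bN pa pb h1 h2.
have pr : paired N m (mirror N a) by rewrite paired_mirror.
rewrite !inE => /orP[] /eqP-> /orP[] /eqP-> //.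
- by rewrite sg_swap ?mirror_lt.
- by rewrite -(sh_com sh).
- by rewrite -(sh_com sh) // sg_swap ?(sh_inv sh) ?mirror_lt ?(sg_ltN sh) ?(paired_sg sh) // mirror_lt.
Qed.

Lemma orthosymplectic_RE v a b : (a < N)%N -> (b < N)%N ->
  Sop (A (Sop (A v))) a b = A (Sop (A (Sop v))) a b.
Proof.
move=> aN bN.
case: (eqVneq b (mirror N a)) => [->|h1]; first exact: RE_phi.
case: (boolP (paired N m a)) => pa; case: (boolP (paired N m b)) => pb.
- case: (eqVneq b (sg (mirror N a))) => [->|h2]; first exact: RE_bet.
  have gd x z : x \in [:: a; sg a] -> z \in [:: b; sg b] -> z != mirror N x.
    exact: good_pair.
  case: (eqVneq a b) => [e|nab].
    subst b; case: (RE_self q0 sh (S := Sop) v aN pa) => // u x z hx hz.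
    by rewrite Sop_hecke // gd.
  case: (eqVneq a (sg b)) => [e|nasb].
    have e' : b = sg a by rewrite e (sh_inv sh).
    rewrite e'; case: (RE_self q0 sh (S := Sop) v aN pa) => // u x z hx hz.
    rewrite Sop_hecke // gd // e' (sh_inv sh) //.
    by move: hz; rewrite !inE orbC.
  apply: (RE_pair q0 sh) => // u x z hx hz; rewrite Sop_hecke //; first exact: gd.
  rewrite mirror_swap ?gd //.
    by move: hz; rewrite !inE => /orP[]/eqP-> //; rewrite (sg_ltN sh).
  by move: hx; rewrite !inE => /orP[]/eqP-> //; rewrite (sg_ltN sh).
- have g x : x \in [:: a; sg a] -> (x < N)%N && (b != mirror N x).
    rewrite !inE => /orP[] /eqP->; first by rewrite aN.
    rewrite (sg_ltN sh) //=; apply: contraNneq pb => ->.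
    by rewrite paired_mirror ?(sg_ltN sh) ?(paired_sg sh).
  case: (RE_pair_fix q0 sh (S := Sop) v aN bN pa pb) => // u x /g /andP[xN hx].
    by rewrite Sop_hecke.
  by rewrite Sop_hecke // mirror_swap.
- have g x : x \in [:: b; sg b] -> (x < N)%N && (x != mirror N a).
    rewrite !inE => /orP[] /eqP->; first by rewrite bN.
    rewrite (sg_ltN sh) //=; apply: contraNneq pa => e.
    by rewrite -(paired_mirror mN aN) -e (paired_sg sh).
  case: (RE_pair_fix q0 sh (S := Sop) v bN aN pb pa) => // u x /g /andP[xN hx].
    by rewrite Sop_hecke // mirror_swap.
  by rewrite Sop_hecke.
- apply: (RE_fix sh) => //; first exact: (dm_mid D).
    by move=> u; rewrite Sop_hecke.
  by move=> u; rewrite Sop_hecke // mirror_swap.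
Qed.

(** * The operator [A S A] on the trivial submodule *)

Section Trivial.
Variables (v : nat -> nat -> C) (x : C).
Hypothesis v0 : forall a b, (a < N)%N -> (b < N)%N -> b != mirror N a -> v a b = 0.
Hypothesis v1 : forall a, (a < N)%N -> phi v a = x.

Let off a b := (b != mirror N a) && ~~ (paired N m a && (b == sg (mirror N a))).

(** [off] singles out the coordinates belonging neither to [phi] nor to [bet]. They are stable under
    [sg] on the second leg and under the flip, hence stay zero when [A] and [S] are applied to a
    trivial vector. *)
Lemma off_sg a b : (a < N)%N -> (b < N)%N -> paired N m b -> off a b -> off a (sg b).
Proof.
move=> aN bN pb /andP[h1 h2]; apply/andP; split.
  apply: contraNneq h2 => e.
  have pa : paired N m a by rewrite -(paired_mirror mN aN) -e (paired_sg sh).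
  by rewrite pa /= -e (sh_inv sh).
apply: contraNN h1 => /andP[pa /eqP e].
by rewrite -(sh_inv sh bN pb) e (sh_inv sh) ?mirror_lt ?paired_mirror.
Qed.

Lemma off_sym a b : (a < N)%N -> (b < N)%N -> off a b -> off b a.
Proof.
move=> aN bN /andP[h1 h2]; apply/andP; split; first by rewrite mirror_swap.
apply: contraNN h2 => /andP[pb /eqP e].
have pa : paired N m a by rewrite e (paired_sg sh) ?mirror_lt ?paired_mirror.
rewrite pa /= (sh_com sh) //.
by rewrite -mirror_swap ?(sg_ltN sh) // e (sh_inv sh) ?mirror_lt ?paired_mirror.
Qed.

Lemma A_off a b : (a < N)%N -> (b < N)%N -> off a b -> A v a b = 0.
Proof.
move=> aN bN o; rewrite /A /actA v0 ?(andP o).1 // mulr0 add0r.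
case: (boolP (paired N m b)) => pb; last by rewrite (sh_y0 sh) ?mul0r.
by rewrite v0 ?mulr0 ?(sg_ltN sh) // (andP (off_sg aN bN pb o)).1.
Qed.

Lemma SA_off a b : (a < N)%N -> (b < N)%N -> off a b -> Sop (A v) a b = 0.
Proof.
move=> aN bN o; rewrite Sop_hecke ?(andP o).1 // /hecke (A_off aN bN o).
by rewrite (A_off bN aN (off_sym aN bN o)) !mulr0 addr0; case: ifP.
Qed.

Let th : C := if tw then - q^-1 else q.

Lemma ASA_trivial a b : (a < N)%N -> (b < N)%N -> A (Sop (A v)) a b = al * be * th * v a b.
Proof.
move=> aN bN.
have bet0 j : (j < N)%N -> bet v j = 0.
  move=> jN; case: (boolP (paired N m j)) => pj; last first.
    by rewrite bet_mid //; move: pj; rewrite /paired; lia.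
  by rewrite /bet v0 ?mulr0 ?sg_mirrorE ?twist_lt ?twist_neq_mirror.
have e1 j : (j < N)%N -> d (mirror N j) * phi v j + bet v j = d (mirror N j) * x.
  by move=> jN; rewrite bet0 // v1 // addr0.
have e2 j : (j < N)%N -> d (twist tw j) * bet v j + ga j * phi v j = ga j * x.
  by move=> jN; rewrite bet0 // v1 // mulr0 add0r.
case: (eqVneq b (mirror N a)) => [->|h1].
  apply: (mulfI (dm_nrm0 D aN)); rewrite -/(phi _ a) phi_ASA //.
  rewrite /T (phiS_ext q eps p aN e1) (Qm_extN aN e2).
  have -> : nrm a * (al * be * th * v a (mirror N a)) = al * be * th * phi v a by rewrite /phi; ring.
  rewrite v1 //.
  exact: (sector_diag_const q0 x (dm_W D)).
rewrite (v0 aN bN h1) mulr0.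
case: (boolP (paired N m a && (b == sg (mirror N a)))) => [/andP[pa /eqP->]|h2].
  have y0 : y (mirror N a) * nrm a != 0.
    rewrite mulf_neq0 ?(dm_nrm0 D) //.
    have pr : paired N m (mirror N a) by rewrite paired_mirror.
    by apply: contra_neq (sh_ab sh) => e; rewrite -(sh_y sh (mirror_lt aN) pr) e mul0r.
  apply: (mulfI y0); rewrite mulr0 -/(bet _ a) bet_ASA //.
  rewrite /T (phiS_ext q eps p aN e1) (Qm_extN aN e2).
  exact: (sector_off_const q0 x (dm_W D)).
have o : off a b by rewrite /off h1.
rewrite {1}/A /actA SA_off // mulr0 add0r.
case: (boolP (paired N m b)) => pb; last by rewrite (sh_y0 sh) ?mul0r.
by rewrite SA_off ?mulr0 ?(sg_ltN sh) // off_sg.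
Qed.

End Trivial.

End Orthosymplectic.
End BraidedReflection.

(** * The weights attached to rho *)

Section Exponents.
Variables (N : nat) (sp : bool).

(* The second branch also gives a value at [k = N], so that [neg_2rho_last] holds
   up to [k = N - 1]. *)
Definition neg_2rho (k : nat) : int :=
  if (k.+1.*2 <= N)%N then k.+1.*2%:Z - (if sp then N.+2 else N)%:Z
  else if (N <= k.*2)%N then k.*2%:Z - N%:Z + (if sp then 2 else 0)
  else 0.

Lemma neg_2rho_first k : (k.+2.*2 <= N)%N -> neg_2rho k.+1 = neg_2rho k + 2.
Proof.
move=> h; rewrite /neg_2rho h.
have -> : (k.+1.*2 <= N)%N by lia.
lia.
Qed.

Lemma neg_2rho_last k : (N <= k.*2)%N -> neg_2rho k.+1 = neg_2rho k + 2.
Proof.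
move=> h; rewrite /neg_2rho.
have -> : (k.+2.*2 <= N)%N = false by lia.
have -> : (k.+1.*2 <= N)%N = false by lia.
have -> : (N <= k.+1.*2)%N by lia.
rewrite h; lia.
Qed.

Lemma neg_2rho_mirror k : (k < N)%N -> neg_2rho (mirror N k) = - neg_2rho k.
Proof.
move=> kN; suff : neg_2rho k + neg_2rho (mirror N k) = 0 by lia.
rewrite /neg_2rho /mirror; case: (leqP k.+1.*2 N) => h1.
  case: (leqP (N.-1 - k).+1.*2 N) => h2.
    have -> : N = k.+1.*2 by lia.
    have -> : ((k.+1.*2).-1 - k)%N = k.+1 by lia.
    lia.
  have -> : (N <= (N.-1 - k).*2)%N by lia.
  by case: sp; lia.
case: (leqP N k.*2) => h3.
  have -> : ((N.-1 - k).+1.*2 <= N)%N by lia.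
  by case: sp; lia.
have -> : ((N.-1 - k).+1.*2 <= N)%N = false by lia.
by have -> : (N <= (N.-1 - k).*2)%N = false by lia.
Qed.

End Exponents.

Section QuantumWeights.
Variables (C : fieldType) (q : C) (N : nat) (sp : bool).
Hypothesis q0 : q != 0.
Hypothesis spN : sp ==> ~~ odd N.
Let lam := q - q^-1.

Definition pwt k : C := q ^ neg_2rho N sp k.
Definition esign : C := if sp then -1 else 1.

Lemma esign2 : esign * esign = 1.
Proof. by rewrite /esign; case: sp; rewrite ?mulrNN mulr1. Qed.

Lemma qzD z x : q ^ (z + x) = q ^ z * q ^ x.
Proof. exact: expfzDr. Qed.

Lemma q2E : q ^ (2 : int) = q ^+ 2. Proof. by []. Qed.

Lemma pS k k' : neg_2rho N sp k' = neg_2rho N sp k + 2 -> pwt k' = q ^+ 2 * pwt k.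
Proof. by rewrite /pwt => ->; rewrite qzD mulrC. Qed.

Lemma pwt_first k : (k.+2.*2 <= N)%N -> pwt k.+1 = q ^+ 2 * pwt k.
Proof. by move=> /neg_2rho_first/pS. Qed.

Lemma pwt_last k : (N <= k.*2)%N -> pwt k.+1 = q ^+ 2 * pwt k.
Proof. by move=> /neg_2rho_last/pS. Qed.

Lemma pwt_center k : k = mirror N k -> (k < N)%N -> pwt k = 1.
Proof.
rewrite /mirror => e kN; rewrite /pwt /neg_2rho.
have -> : (k.+1.*2 <= N)%N = false by lia.
by have -> : (N <= k.*2)%N = false by lia.
Qed.

Lemma pwt_mirror k : (k < N)%N -> pwt k * pwt (mirror N k) = 1.
Proof. by move=> kN; rewrite /pwt -qzD neg_2rho_mirror // subrr. Qed.

Definition cc k : C := if k == mirror N k then 1 else q^-1.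

(* A primitive of [lam * pwt], see [FsumS]; the second term absorbs the jump of rho
   at the centre. *)
Definition Fsum k : C := cc k * pwt k + (if (mirror N k < k)%N then esign * lam else 0).

Lemma pwt_odd k : k.+1 = mirror N k.+1 -> (k.+1 < N)%N ->
  [/\ sp = false, pwt k = q^-1, pwt k.+1 = 1 & pwt k.+2 = q].
Proof.
rewrite /mirror => e kN.
have sp0 : sp = false.
  apply/negP => h; move: spN; rewrite h /=; lia.
split=> //; rewrite /pwt /neg_2rho sp0.
- have -> : (k.+1.*2 <= N)%N by lia.
  by have -> : k.+1.*2%:Z - N%:Z = - 1 by lia.
- have -> : (k.+2.*2 <= N)%N = false by lia.
  by have -> : (N <= k.+1.*2)%N = false by lia.
- have -> : (k.+3.*2 <= N)%N = false by lia.
  have -> : (N <= k.+2.*2)%N by lia.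
  by have -> : k.+2.*2%:Z - N%:Z + 0 = 1 by lia.
Qed.

Lemma pwt_even k : k = mirror N k.+1 -> (k.+1 < N)%N ->
  pwt k = (if sp then q ^- 2 else 1) /\ pwt k.+1 = (if sp then q ^+ 2 else 1).
Proof.
rewrite /mirror => e kN; rewrite /pwt /neg_2rho.
have -> : (k.+1.*2 <= N)%N by lia.
have -> : (k.+2.*2 <= N)%N = false by lia.
have -> : (N <= k.+1.*2)%N by lia.
case: sp; first by split; [have -> : k.+1.*2%:Z - N.+2%:Z = - 2 by lia | have -> : k.+1.*2%:Z - N%:Z + 2 = 2 by lia].
by split; [have -> : k.+1.*2%:Z - N%:Z = 0 by lia | have -> : k.+1.*2%:Z - N%:Z + 0 = 0 by lia].
Qed.

(** Away from the centre this is a geometric progression. At the centre the weights are [q^-1, 1, q]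
    for odd [N], [1, 1] for so(N) with [N] even, and [q^-2, q^2] for sp(N); the change of [cc] and
    the term [esign * lam] compensate for the irregular step. *)
Lemma FsumS k : (k < N)%N -> Fsum k.+1 = Fsum k + lam * pwt k.
Proof.
move=> kN; rewrite /Fsum /cc.
case: (ltngtP k (mirror N k)) => h1; last first.
- have -> : (k.+1 == mirror N k.+1) = false by move: h1; rewrite /mirror; lia.
  have -> : (mirror N k.+1 < k.+1)%N by move: h1; rewrite /mirror; lia.
  have sp0 : sp = false.
    by apply/negP => h; move: spN h1; rewrite h /mirror /=; lia.
  have pk := pwt_center h1 kN.
  have -> : pwt k.+1 = q.
    case: (k) h1 kN => [|k'] h1 kN; last by case: (pwt_odd h1 kN).
    have N1 : N = 1%N by move: h1 kN; rewrite /mirror; lia.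
    by rewrite /pwt /neg_2rho N1 /= sp0 addr0.
  by rewrite pk /esign sp0 /lam; field.
- have -> : (k.+1 == mirror N k.+1) = false by move: h1; rewrite /mirror; lia.
  have -> : (mirror N k.+1 < k.+1)%N by move: h1; rewrite /mirror; lia.
  by rewrite pwt_last /lam; [field | move: h1; rewrite /mirror; lia].
case: (ltngtP k.+1 (mirror N k.+1)) => h2.
- by rewrite pwt_first /lam; [field | move: h2; rewrite /mirror; lia].
- have e : k = mirror N k.+1 by move: h1 h2; rewrite /mirror; lia.
  have k1 : (k.+1 < N)%N by move: h1 h2; rewrite /mirror; lia.
  by case: (pwt_even e k1) => -> ->; rewrite /esign /lam; case: sp; field.
- have k1 : (k.+1 < N)%N by move: h1 h2; rewrite /mirror; lia.
  by case: (pwt_odd h2 k1) => _ -> -> _; rewrite /lam; field.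
Qed.

Lemma psum_1 m k : (m <= k <= N)%N -> lam * psum pwt (fun=> 1) m k = Fsum k - Fsum m.
Proof.
move=> /andP[]; elim: k => [|k IHk] h1 h2.
  have -> : m = 0%N by lia.
  by rewrite psumnn mulr0 subrr.
case: (ltngtP m k.+1) h1 => // [lt _ | <- _]; last by rewrite psumnn mulr0 subrr.
rewrite psumS ?mulrDr ?IHk ?FsumS; try lia.
ring.
Qed.

Lemma Fsum_mirror k : (k < N)%N ->
  cc (mirror N k) * pwt (mirror N k) - (Fsum (mirror N k) - esign * (if (k < mirror N k)%N then lam else 0)) = 0.
Proof.
move=> kN; rewrite /Fsum mirrorK // /cc.
by case: ifP; case: ifP => _ _; ring.
Qed.

(** The middle block of [S] is that of the algebra with [N - m.*2] in place of [N], and constants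
    are its trivial vectors; if the block is nonempty, [Fsum_first] turns the eigenvalue into the
    corresponding [eps q^(-N+eps)]. *)
Lemma phiSmid_1 m a : (m.*2 <= N)%N -> (m <= a < N - m)%N ->
  phiSmid q N m esign pwt (fun=> 1) a = esign * Fsum m.
Proof.
move=> mN ha; have aN : (a < N)%N by lia.
have e : lam * psum pwt (fun=> 1) m (mirror N a) = Fsum (mirror N a) - Fsum m.
  by apply: psum_1; rewrite /mirror; lia.
rewrite /phiSmid -/lam e mulr1 mulr1.
have -> : (if a == mirror N a then 1 else q^-1) = cc (mirror N a) by rewrite /cc mirrorK // eq_sym.
move: (Fsum_mirror aN) esign2; case: ifP => _; set c := cc _; set f := Fsum (mirror N a); move=> F E.
  transitivity (esign * (c * pwt (mirror N a) - (f - esign * lam)) + (lam - esign * esign * lam) + esign * Fsum m).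
    by ring.
  by rewrite F E mul1r subrr mulr0 !add0r.
transitivity (esign * (c * pwt (mirror N a) - (f - esign * 0)) + esign * Fsum m); first by ring.
by rewrite F mulr0 add0r.
Qed.

Let e1 : int := if sp then -1 else 1.

Lemma Fsum_first m : (m.*2 < N)%N -> Fsum m = q ^ (m.*2%:Z - N%:Z + e1).
Proof.
move=> h; rewrite /Fsum /cc.
have -> : (mirror N m < m)%N = false by rewrite /mirror; lia.
case: eqP => hm.
  have sp0 : sp = false.
    by apply/negP => h'; move: spN hm; rewrite h' /mirror /=; lia.
  rewrite pwt_center //; last by lia.
  rewrite /e1 sp0; have -> : m.*2%:Z - N%:Z + 1 = 0 by move: hm; rewrite /mirror; lia.
  by rewrite mulr1 addr0.
rewrite addr0 /pwt /neg_2rho; have -> : (m.+1.*2 <= N)%N by move: hm; rewrite /mirror; lia.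
rewrite -[q^-1]/(q ^ (-1)) -qzD; congr (_ ^ _).
by rewrite /e1; case: sp; lia.
Qed.

Lemma pwt_Nm m : (m.*2 <= N)%N -> pwt (N - m)%N = q ^ (N%:Z - m.*2%:Z + (if sp then 2 else 0)).
Proof.
move=> h; rewrite /pwt /neg_2rho.
have -> : ((N - m).+1.*2 <= N)%N = false by lia.
have -> : (N <= (N - m).*2)%N by lia.
by congr (_ ^ _); lia.
Qed.

Lemma Fsum_last m : (m.*2 < N)%N -> Fsum (N - m)%N = q^-1 * pwt (N - m)%N + esign * lam.
Proof.
move=> h; rewrite /Fsum /cc.
have -> : (mirror N (N - m) < N - m)%N by rewrite /mirror; lia.
by have -> : (N - m == mirror N (N - m))%N = false by rewrite /mirror; lia.
Qed.

(** * The three possible middle blocks: scalar, empty, and two central indices *)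

Section WeightsInstances.
Variables (m : nat) (tw : bool) (dp dt : nat -> C) (al be : C).
Hypotheses (mN : (m.*2 <= N)%N) (w_tw : tw ==> ~~ odd m && ~~ odd N).
Hypothesis dp1 : forall a, (a < m)%N -> dp a = 0.
Hypothesis dp2 : forall a, (N - m <= a < N)%N -> dp a = al - be.
Hypothesis dt1 : forall a, (a < m)%N -> dt a = al - be.
Hypothesis dt2 : forall a, (N - m <= a < N)%N -> dt a = 0.
Let th : C := if tw then - q^-1 else q.

(** For a scalar block [Tdp] reads [al * (esign * Fsum m) = th * be]. Since [esign * th = q ^ e1],
    this is the relation between [be] and [al]. *)
Lemma weights_scalar :
  tw = sp -> be = al * q ^ (m.*2%:Z - N%:Z) ->
  (forall a, (m <= a < N - m)%N -> dp a = al) ->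
  weights q N m tw esign pwt dp dt al be.
Proof.
move=> twE beE dpm.
have thE : esign * th = q ^ e1.
  by rewrite /th twE /esign /e1; case: sp; rewrite ?mul1r // mulN1r opprK.
have alF : (m.*2 < N)%N -> al * Fsum m = esign * th * be.
  by move=> h; rewrite Fsum_first // thE beE qzD; ring.
split=> //.
- exact: esign2.
- by move=> k h; apply: pwt_first; lia.
- by move=> k h; apply: pwt_last; lia.
- exact: pwt_mirror.
- by move=> a h; rewrite dpm // subrr mul0r.
- move=> a h; transitivity (phiSmid q N m esign pwt (fun=> al * 1) a).
    by apply: phiSmid_ext => // j hj; rewrite dpm // mulr1.
  rewrite phiSmid_Z phiSmid_1 // dpm // -/th.
  have -> : al - (al - be) = be by ring.
  rewrite mulrCA alF; last by lia.
  by rewrite !mulrA esign2 mul1r.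
- move=> f a h.
  have e g : phiSmid q N m esign pwt (fun j => dp j * g j) a = al * phiSmid q N m esign pwt g a.
    rewrite -phiSmid_Z; apply: phiSmid_ext => // j hj; by rewrite dpm.
  rewrite !e dpm //; congr (_ * _); rewrite -phiSmid_Z; apply: phiSmid_ext => // j hj.
  by rewrite -phiSmid_Z; apply: phiSmid_ext => // i hi; rewrite dpm.
- rewrite -/th.
  have -> : psum pwt dp m (N - m) = al * psum pwt (fun=> 1) m (N - m).
    by rewrite -psumZ; apply: psum_ext => j hj; rewrite dpm // mulr1.
  case: (ltngtP m.*2 N) mN => // [lt|eq] _.
    rewrite mulrCA psum_1; last by lia.
    rewrite mulrBr alF // Fsum_last // pwt_Nm //.
    have aE : al = be * q ^ (N%:Z - m.*2%:Z).
      rewrite beE -mulrA -qzD; have -> : m.*2%:Z - N%:Z + (N%:Z - m.*2%:Z) = 0 by lia.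
      by rewrite mulr1.
    rewrite qzD [in RHS]mulrBl.
    have -> : al * (esign * th + q^-1 * (q ^ (N%:Z - m.*2%:Z) * q ^ (if sp then 2 else 0))) =
       al * esign * th + q^-1 * q ^ (if sp then 2 else 0) * (al * q ^ (N%:Z - m.*2%:Z)) by ring.
    by rewrite aE /th twE /esign /lam; case: (sp); rewrite ?q2E ?expr0z; field; rewrite ?q0.
  have -> : (N - m = m)%N by lia.
  rewrite psumnn.
  have -> : be = al by rewrite beE eq subrr mulr1.
  by ring.
Qed.

Lemma weights_empty : m.*2 = N -> be = al -> weights q N m tw esign pwt dp dt al be.
Proof.
move=> m2 beE.
split=> //; try by move=> *; lia.
- exact: esign2.
- by move=> k h; apply: pwt_first; lia.
- by move=> k h; apply: pwt_last; lia.
- exact: pwt_mirror.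
- have -> : (N - m = m)%N by lia.
  by rewrite psumnn beE subrr mulr0 mul0r.
Qed.

(** Both central weights are [1], and on these two indices [S] is the exchange with factor [q^-1],
    the [lam] terms cancelling; the opposite values of [dp] turn the factor into [th = - q^-1]. *)
Lemma weights_center : m.+1.*2 = N -> be = al -> sp = false -> tw ->
  dp m * dp m = al * al -> dp m.+1 = - dp m ->
  weights q N m tw esign pwt dp dt al be.
Proof.
move=> m2 beE sp0 tw1 dm dm1.
have rm : mirror N m = m.+1 by rewrite /mirror; lia.
have rm1 : mirror N m.+1 = m by rewrite /mirror; lia.
have [pm pm1] : pwt m = 1 /\ pwt m.+1 = 1.
  by have := @pwt_even m; rewrite rm1 sp0; apply => //; lia.
have ep : esign = 1 by rewrite /esign sp0.
have mid2 a : (m <= a < N - m)%N -> a = m \/ a = m.+1.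
  by move=> h; case: (eqVneq a m) => [->|ne]; [left | right; lia].
have T0 f : phiSmid q N m esign pwt f m = q^-1 * f m.+1.
  rewrite /phiSmid rm pm1 ltnSn psumS // psumnn pm ep.
  have -> : (m == m.+1) = false by lia.
  by ring.
have T1 f : phiSmid q N m esign pwt f m.+1 = q^-1 * f m.
  rewrite /phiSmid rm1 pm psumnn ep.
  have -> : (m.+1 == m) = false by lia.
  have -> : (m.+1 < m)%N = false by lia.
  by ring.
split=> //.
- exact: esign2.
- by move=> k h; apply: pwt_first; lia.
- by move=> k h; apply: pwt_last; lia.
- exact: pwt_mirror.
- move=> a /mid2[] ->; rewrite beE ?dm1.
    by transitivity (dp m * dp m - al * al); [ring | rewrite dm subrr].
  by transitivity (dp m * dp m - al * al); [ring | rewrite dm subrr].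
- by move=> a /mid2[] ->; rewrite ?T0 ?T1 tw1 beE ?dm1; ring.
- by move=> f a /mid2[] ->; rewrite !(T0, T1) dm1; ring.
- have -> : (N - m = m.+2)%N by lia.
  by rewrite !psumS // psumnn pm pm1 dm1 beE; ring.
Qed.

End WeightsInstances.

(** * Eigenvectors of [S] on [phi] *)

Section Eigen.
Variables (f : nat -> C) (c : C).
Hypothesis c2 : (c - q) * (c + q^-1) != 0.
Hypothesis fT : forall a, (a < N)%N -> phiS q N esign pwt f a = c * f a.

Let D k := f k - f k.+1.

Lemma phiS_diff a : (a.+1 < N)%N -> c * D a =
  esign * (cc a * pwt (mirror N a.+1).+1 * f (mirror N a.+1).+1 - (lam + cc a.+1) * pwt (mirror N a.+1) * f (mirror N a.+1))
  + (if (a < (mirror N a.+1).+1)%N then lam else 0) * f a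
  - (if (a.+1 < mirror N a.+1)%N then lam else 0) * f a.+1.
Proof.
move=> aN; rewrite /D mulrBr -!fT //; last by lia.
have e : mirror N a = (mirror N a.+1).+1 by rewrite /mirror; lia.
rewrite /phiS -/(cc a) -/(cc a.+1) e psumS // -/lam.
ring.
Qed.

(* Subtracting consecutive rows of the eigenvalue equation leaves closed systems in
   the differences [D a] and [D (mirror N a.+1)]. *)
Lemma D_pair a : (a.+1 <= mirror N a.+1)%N -> (a.+1 < N)%N -> D a = 0 /\ D (mirror N a.+1) = 0.
Proof.
move=> h aN; set k := mirror N a.+1.
have kN : (k.+1 < N)%N by move: h; rewrite /k /mirror; lia.
have rk : mirror N k.+1 = a by rewrite /k /mirror; lia.
(* The system in [D a] and [D k] has determinant [c ^+ 2 - lam * c - 1 = (c - q) * (c + q^-1)],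
   because [u * w = 1] and [esign ^+ 2 = 1]. *)
have [u [w [uw e1' e2']]] : exists u w, [/\ u * w = 1,
    c * D a = - esign * u * D k + lam * D a & c * D k = - esign * w * D a].
  have E1 := phiS_diff aN; have E2 := phiS_diff kN.
  rewrite -/k in E1; rewrite rk in E2.
  have ca : cc a = q^-1 by rewrite /cc; have -> : (a == mirror N a) = false by move: h; rewrite /mirror; lia.
  have ck : cc k.+1 = q^-1 by rewrite /cc rk; have -> : (k.+1 == a) = false by move: h; rewrite -/k; lia.
  have l1 : (a < k.+1)%N by move: h; rewrite -/k; lia.
  have l2 : (k < a.+1)%N = false by move: h; rewrite -/k; lia.
  have l3 : (k.+1 < a)%N = false by move: h; rewrite -/k; lia.
  rewrite ca l1 in E1; rewrite ck l2 l3 in E2.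
  case: (ltngtP a.+1 k) => h'; [| by move: h; rewrite -/k; lia|].
    have ca1 : cc a.+1 = q^-1 by rewrite /cc -/k; have -> : (a.+1 == k) = false by lia.
    have ck' : cc k = q^-1.
      by rewrite /cc /k mirrorK //; have -> : (mirror N a.+1 == a.+1) = false by rewrite -/k; lia.
    have pk : pwt k.+1 = q ^+ 2 * pwt k by apply: pwt_last; move: h'; rewrite /k /mirror; lia.
    have pa : pwt a.+1 = q ^+ 2 * pwt a by apply: pwt_first; move: h'; rewrite /k /mirror; lia.
    have pp : pwt a.+1 * pwt k = 1 by exact: pwt_mirror.
    rewrite ca1 h' pk in E1; rewrite ck' pa in E2.
    exists (q * pwt k), (q * pwt a); split.
    - by rewrite -pp pa; ring.
    - by rewrite E1 /D /lam; field.
    - by rewrite E2 /D /lam; field.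
  have [sp0 pa pa1 pa2] := pwt_odd h' aN.
  have ck' : cc k = 1 by rewrite /cc -h' -/k -h' eqxx.
  have ca1 : cc a.+1 = 1 by rewrite /cc -/k h' eqxx.
  rewrite ca1 -h' pa1 pa2 ltnn /esign sp0 in E1; rewrite ck' -h' pa1 pa /esign sp0 in E2.
  exists 1, 1; rewrite -h' /esign sp0; split; first by rewrite mulr1.
    by rewrite E1 /D /lam; field.
  by rewrite E2 /D /lam; field.
have [c0 c1] : c - q != 0 /\ c + q^-1 != 0 by apply/andP; rewrite -negb_or -mulf_eq0.
have z : (c - q) * (c + q^-1) * D a = 0.
  transitivity (c * (c * D a) - lam * (c * D a) - D a); first by rewrite /lam; field.
  rewrite {1 2}e1'.
  transitivity (- esign * u * (c * D k) + lam * (c * D a) - lam * (- esign * u * D k + lam * D a) - D a);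
    first by ring.
  rewrite e2' -e1'.
  transitivity ((esign * esign * (u * w) - 1) * D a); first by ring.
  by rewrite esign2 uw mulr1 subrr mul0r.
have Da : D a = 0 by move/eqP: z; rewrite mulf_eq0 (negPf c2) => /eqP.
split=> //; move: e1'; rewrite Da !mulr0 addr0 => /eqP.
rewrite eq_sym !mulf_eq0 oppr_eq0.
have -> : esign == 0 = false by rewrite /esign; case: sp; rewrite ?oppr_eq0 oner_eq0.
have -> : u == 0 = false.
  by apply/negP => /eqP u0; move/eqP: uw; rewrite u0 mul0r eq_sym oner_eq0.
by move/eqP.
Qed.

(** The two central rows for even [N]: the system reduces to one equation, whose factor is [c - q]
    for sp(N) and [c + q^-1] for so(N). *)
Lemma D_self a : a = mirror N a.+1 -> (a.+1 < N)%N -> D a = 0.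
Proof.
move=> e aN; have E := phiS_diff aN.
have [c0 c1] : c - q != 0 /\ c + q^-1 != 0 by apply/andP; rewrite -negb_or -mulf_eq0.
have ca : cc a = q^-1 by rewrite /cc; have -> : (a == mirror N a) = false by move: e; rewrite /mirror; lia.
have ca1 : cc a.+1 = q^-1 by rewrite /cc -e; have -> : (a.+1 == a) = false by lia.
have [pa pa1] := pwt_even e aN.
rewrite -e ca ca1 pa pa1 ltnSn in E.
have l : (a.+1 < a)%N = false by lia.
rewrite l /esign in E.
case: (sp) E => E.
  have /eqP : (c - q) * D a = 0 by rewrite mulrBl E /D /lam; field.
  by rewrite mulf_eq0 (negPf c0) => /eqP.
have /eqP : (c + q^-1) * D a = 0 by rewrite mulrDl E /D /lam; field.
by rewrite mulf_eq0 (negPf c1) => /eqP.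
Qed.

Lemma eigen_const a : (a < N)%N -> f a = f 0%N.
Proof.
elim: a => // a IHa aN; rewrite -IHa; last by lia.
suff : D a = 0 by move/eqP; rewrite subr_eq0 => /eqP ->.
case: (ltngtP a (mirror N a.+1)) => h.
- by case: (D_pair h aN).
- have h' : ((mirror N a.+1).+1 <= mirror N (mirror N a.+1).+1)%N by move: h; rewrite /mirror; lia.
  have e : mirror N (mirror N a.+1).+1 = a by move: h; rewrite /mirror; lia.
  by case: (D_pair h'); rewrite ?e //; move: h; rewrite /mirror; lia.
- exact: D_self.
Qed.

End Eigen.

End QuantumWeights.

(** * Matrices on the tensor square *)

Section Tensor.
Variables (C : fieldType) (n : nat).
Local Notation N := n.+1.
Local Notation ti a b := (mxtens_index (a, b)).

Lemma delta_tens_mul k (M : 'M[C]_(N * N, k)) (i j i' j' a b : 'I_N) c :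
  ((delta_mx i j *t delta_mx i' j') *m M) (ti a b) c =
  ((a == i) && (b == i'))%:R * M (ti j j') c.
Proof.
rewrite mxE (bigD1 (ti j j')) //= big1 ?addr0.
  by rewrite tensmxE !mxE !eqxx !andbT -natrM mulnb.
move=> x; case: (mxtens_indexP x) => u v ne.
rewrite tensmxE !mxE; case: (eqVneq u j) => [e1|_]; last by rewrite andbF !mul0r.
case: (eqVneq v j') => [e2|_]; last by rewrite andbF mulr0 mul0r.
by rewrite e1 e2 eqxx in ne.
Qed.

Lemma sum_delta2 (P : rel 'I_N) (F : 'I_N -> 'I_N -> C) (a b : 'I_N) :
  \sum_i \sum_(j | P i j) ((a == i) && (b == j))%:R * F i j = (P a b)%:R * F a b.
Proof.
rewrite (bigD1 a) //= [X in _ + X]big1 ?addr0; last first.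
  by move=> i ne; rewrite big1 // => j _; rewrite eq_sym (negPf ne) mul0r.
rewrite big_mkcond (bigD1 b) //= big1 ?addr0; last first.
  by move=> j ne; rewrite (eq_sym b) (negPf ne) andbF mul0r; case: ifP.
by rewrite !eqxx; case: ifP; rewrite ?mul1r ?mul0r.
Qed.

Lemma sum2_mul k (M : 'M[C]_(N * N, k)) (P : rel 'I_N) (G : 'I_N -> 'I_N -> 'M[C]_(N * N)) x c :
  ((\sum_i \sum_(j | P i j) G i j) *m M) x c = \sum_i \sum_(j | P i j) (G i j *m M) x c.
Proof.
rewrite mulmx_suml summxE; apply: eq_bigr => i _.
by rewrite mulmx_suml summxE.
Qed.

Lemma flip_mul k (M : 'M[C]_(N * N, k)) (a b : 'I_N) c :
  (flip_mx C N *m M) (ti a b) c = M (ti b a) c.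
Proof.
rewrite /flip_mx (sum2_mul M (fun _ _ => true)).
under eq_bigr => i _ do under eq_bigr => j _ do rewrite delta_tens_mul.
by rewrite (sum_delta2 (fun _ _ => true) (fun i j => M (ti j i) c)) mul1r.
Qed.

Lemma addmxE k l (X Y : 'M[C]_(k, l)) i j : (X + Y) i j = X i j + Y i j.
Proof. by rewrite mxE. Qed.

Lemma scalemxE k l x (X : 'M[C]_(k, l)) i j : (x *: X) i j = x * X i j.
Proof. by rewrite mxE. Qed.

Lemma Rmx_SL_mul k (M : 'M[C]_(N * N, k)) (s : C) (a b : 'I_N) c :
  (Rmx N SL s *m M) (ti a b) c =
  s ^+ 2 * (a == b)%:R * M (ti a a) c + (b != a)%:R * M (ti a b) c
  + (s ^+ 2 - (s ^+ 2)^-1) * ((b < a)%N%:R * M (ti b a) c).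
Proof.
rewrite /Rmx !mulmxDl -!scalemxAl !addmxE !scalemxE; congr (_ + _ + _).
- rewrite mulmx_suml summxE -mulrA; congr (_ * _).
  rewrite (bigD1 a) //= big1 ?addr0.
    by rewrite delta_tens_mul eqxx eq_sym.
  by move=> i ne; rewrite delta_tens_mul eq_sym (negPf ne) mul0r.
- rewrite -(sum_delta2 (fun i j => j != i) (fun i j => M (ti i j) c)) sum2_mul.
  by apply: eq_bigr => i _; apply: eq_bigr => j _; rewrite delta_tens_mul.
- congr (_ * _); rewrite -(sum_delta2 (fun i j => (i < j)%N) (fun i j => M (ti i j) c)).
  rewrite (sum2_mul M (fun i j => (i < j)%N)).
  by apply: eq_bigr => i _; apply: eq_bigr => j _; rewrite delta_tens_mul andbC.
Qed.

Lemma Rmx_mul k (M : 'M[C]_(N * N, k)) (g : lie_type) (s : C) (a b : 'I_N) c :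
  g <> SL ->
  (Rmx N g s *m M) (ti a b) c =
  (s ^+ 2) ^ ((a == b)%:Z - (a == rev_ord b)%:Z) * M (ti a b) c
  + (s ^+ 2 - (s ^+ 2)^-1) * ((b < a)%N%:R * M (ti b a) c
   - (b == rev_ord a)%:R * \sum_(j < N | (j < a)%N)
       kappa_sign C g a * kappa_sign C g j * s ^ (two_rho g a - two_rho g j)
        * M (ti j (rev_ord j)) c).
Proof.
move=> gS; have -> : Rmx N g s = \sum_(i < N) \sum_(j < N)
        (s ^+ 2) ^ ((i == j)%:Z - (i == rev_ord j)%:Z)
          *: (delta_mx i i *t delta_mx j j)
      + (s ^+ 2 - (s ^+ 2)^-1) *:
          (\sum_(i < N) \sum_(j < N | (j < i)%N)
             (delta_mx i j *t delta_mx j i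
              - (kappa_sign C g i * kappa_sign C g j * s ^ (two_rho g i - two_rho g j))
                  *: (delta_mx i j *t delta_mx (rev_ord i) (rev_ord j)))).
  by case: g gS.
rewrite mulmxDl addmxE -scalemxAl scalemxE; congr (_ + _ * _).
  rewrite (sum2_mul M (fun _ _ => true)).
  under eq_bigr => i _ do under eq_bigr => j _ do
    rewrite -scalemxAl scalemxE delta_tens_mul mulrCA.
  by rewrite (sum_delta2 (fun _ _ => true)
    (fun i j => (s ^+ 2) ^ ((i == j)%:Z - (i == rev_ord j)%:Z) * M (ti i j) c)) mul1r.
rewrite (sum2_mul M (fun i j => (j < i)%N)).
under eq_bigr => i _ do under eq_bigr => j _ do
  rewrite mulmxBl -scaleN1r addmxE scalemxE -scalemxAl scalemxE mulN1r !delta_tens_mul.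
under eq_bigr => i _ do rewrite sumrB.
rewrite sumrB (sum_delta2 (fun i j => (j < i)%N) (fun i j => M (ti j i) c)).
congr (_ - _).
rewrite (bigD1 a) //= [X in _ + X]big1 ?addr0; last first.
  by move=> i ne; rewrite big1 // => j _; rewrite eq_sym (negPf ne) mul0r mulr0.
rewrite mulr_sumr; apply: eq_bigr => j _.
by rewrite eqxx; ring.
Qed.

Lemma leg2_mul k (A : 'M[C]_N) (M : 'M[C]_(N * N, k)) (a b : 'I_N) c :
  (leg2 A *m M) (ti a b) c = \sum_e A b e * M (ti a e) c.
Proof.
rewrite mxE (reindex (fun x : 'I_N * 'I_N => ti x.1 x.2)) /=; last first.
  exists (@mxtens_unindex N N) => x _; last by rewrite -surjective_pairing mxtens_unindexK.
  by rewrite -surjective_pairing mxtens_indexK.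
rewrite -(pair_big xpredT xpredT (fun i j => leg2 A (ti a b) (ti i j) * M (ti i j) c)) /=.
rewrite (bigD1 a) //= [X in _ + X]big1 ?addr0.
  by apply: eq_bigr => e _; rewrite tensmxE mxE eqxx mul1r.
by move=> i ne; rewrite big1 // => e _; rewrite tensmxE mxE eq_sym (negPf ne) !mul0r.
Qed.

(** Natural numbers as indices let [mirror] and [twist] be plain arithmetic; only values with
    [a, b < N] are ever compared. *)
Definition vec k (M : 'M[C]_(N * N, k)) c (a b : nat) : C := M (ti (inord a) (inord b)) c.

Lemma leg2_vec k (A : 'M[C]_N) (M : 'M[C]_(N * N, k)) (sg : nat -> nat) (d y : nat -> C) c a b :
  (forall i j : 'I_N, A i j = d i *+ (j == i) + y i *+ (nat_of_ord j == sg i)) ->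
  (forall i, (i < N)%N -> (sg i < N)%N \/ y i = 0) ->
  (a < N)%N -> (b < N)%N ->
  vec (leg2 A *m M) c a b = actA sg d y (vec M c) a b.
Proof.
move=> AE sgN aN bN; rewrite /vec leg2_mul /actA.
under eq_bigr => e _ do rewrite AE mulrDl.
rewrite big_split /=; congr (_ + _).
  rewrite (bigD1 (inord b)) //= big1 ?addr0.
    by rewrite eqxx inordK.
  by move=> i ne; rewrite (negPf ne) mul0r.
rewrite inordK //; case: (sgN b bN) => [h | ->]; last first.
  by rewrite mul0r big1 // => i _; rewrite mul0rn mul0r.
rewrite (bigD1 (inord (sg b))) //= big1 ?addr0.
  by rewrite inordK // eqxx.
move=> i ne; case: eqP => [e|]; last by rewrite mul0r.
by move: ne; rewrite -e inord_val eqxx.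
Qed.

End Tensor.

(** * From identities of arrays to matrix equations *)

Section MatrixEquations.
Variables (C : fieldType) (n : nat) (s : C).
Local Notation N := n.+1.
Local Notation ti a b := (mxtens_index (a, b)).
Hypothesis s0 : s != 0.
Let q := s ^+ 2.
Let lam := q - q^-1.
Let q0 : q != 0. Proof. by rewrite expf_neq0. Qed.

Lemma vec_val k (M : 'M[C]_(N * N, k)) c (a b : 'I_N) : vec M c a b = M (ti a b) c.
Proof. by rewrite /vec !inord_val. Qed.

Lemma vec_inj k (X Y : 'M[C]_(N * N, k)) :
  (forall c a b, (a < N)%N -> (b < N)%N -> vec X c a b = vec Y c a b) -> X = Y.
Proof.
move=> e; apply/matrixP => x c; case: (mxtens_indexP x) => a b.
by rewrite -!vec_val e.
Qed.

Lemma Smx_SL_vec k (M : 'M[C]_(N * N, k)) c a b : (a < N)%N -> (b < N)%N ->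
  vec (Smx N SL s *m M) c a b = hecke q (vec M c) a b.
Proof.
move=> aN bN; rewrite /vec /Smx -mulmxA flip_mul Rmx_SL_mul /hecke -/q.
rewrite -!(inj_eq val_inj) /= !inordK // (eq_sym b).
case: (eqVneq a b) => [->|ne] /=; first by rewrite ltnn mulr0n; ring.
by case: ifP => _; rewrite ?mulr1n ?mulr0n; ring.
Qed.

Definition isSP (g : lie_type) : bool := if g is SP then true else false.

Lemma two_rhoE g (i : 'I_N) : g <> SL -> two_rho g i = - neg_2rho N (isSP g) i.
Proof.
rewrite /two_rho /neg_2rho /isSP.
have e : (rev_ord i).+1 = (N - i)%N by rewrite /=; have := ltn_ord i; lia.
have h := ltn_ord i.
rewrite !e; case: g => // _; case: (leqP i.+1.*2 N) => h1; try lia.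
  case: (leqP (N - i).*2 N) => h2; [have -> : (N <= i.*2)%N by lia | have -> : (N <= i.*2)%N = false by lia]; lia.
case: (leqP (N - i).*2 N) => h2; [have -> : (N <= i.*2)%N by lia | have -> : (N <= i.*2)%N = false by lia]; lia.
Qed.

Definition kappa (sp : bool) (a : nat) : C := if sp && ~~ (a < N./2)%N then -1 else 1.

Lemma kappaE g (i : 'I_N) : kappa_sign C g i = kappa (isSP g) i.
Proof. by rewrite /kappa_sign /kappa; case: g => //=; case: ifP. Qed.

(** Since [s ^+ 2 = q], this is [kappa_{a'} q^(rho_a)]. *)
Definition nrm (sp : bool) (a : nat) : C := kappa sp (mirror N a) * s ^ (- neg_2rho N sp a).

Lemma kappa_neq0 sp a : kappa sp a != 0.
Proof. by rewrite /kappa; case: ifP; rewrite ?oppr_eq0 oner_eq0. Qed.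

Lemma kappa2 sp a : kappa sp a * kappa sp a = 1.
Proof. by rewrite /kappa; case: ifP; rewrite ?mulrNN mulr1. Qed.

Lemma kappa_mirror sp a : (sp ==> ~~ odd N) -> (a < N)%N -> kappa sp a = esign C sp * kappa sp (mirror N a).
Proof.
rewrite /kappa /esign /mirror; case: sp => /=; last by rewrite mul1r.
move=> h aN; case: (ltnP a N./2) => h1.
  by have -> : (n - a < N./2)%N = false by [lia]; rewrite mulrNN mulr1.
by have -> : (n - a < N./2)%N by [lia]; rewrite mulr1.
Qed.

Lemma nrm_neq0 sp a : nrm sp a != 0.
Proof. by rewrite mulf_neq0 ?kappa_neq0 // expfz_neq0. Qed.

Lemma qzE z : q ^ z = s ^ z * s ^ z.
Proof. by rewrite /q expr2 expfzMl. Qed.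

Lemma szN z : s ^ (- z) * s ^ z = 1.
Proof. by rewrite -expfzDr // addNr. Qed.

Lemma nrm_mirror sp a : (sp ==> ~~ odd N) -> (a < N)%N ->
  nrm sp (mirror N a) = esign C sp * pwt q N sp a * nrm sp a.
Proof.
move=> h aN; rewrite /nrm mirrorK // (kappa_mirror h aN) neg_2rho_mirror // opprK /pwt qzE.
transitivity (esign C sp * kappa sp (mirror N a) * s ^ neg_2rho N sp a * (s ^ (- neg_2rho N sp a) * s ^ neg_2rho N sp a)).
  by rewrite szN mulr1.
by ring.
Qed.

Lemma Smx_vec k g (M : 'M[C]_(N * N, k)) c a b :
  g <> SL -> (a < N)%N -> (b < N)%N ->
  vec (Smx N g s *m M) c a b = Sop q N (nrm (isSP g)) (vec M c) a b.
Proof.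
move=> gS aN bN; rewrite /vec /Smx -mulmxA flip_mul Rmx_mul // /Sop /hecke -/q.
have ea : (inord a == rev_ord (inord b : 'I_N)) = (b == mirror N a).
  rewrite -(inj_eq val_inj) /= !inordK // /mirror /=; apply/eqP/eqP; lia.
have eb : (inord b == rev_ord (inord a : 'I_N)) = (b == mirror N a).
  by rewrite -(inj_eq val_inj) /= !inordK // /mirror /=.
have eab : (inord b == inord a :> 'I_N) = (a == b).
  by rewrite -(inj_eq val_inj) /= !inordK // eq_sym.
rewrite ea eb eab !inordK //.
case: (eqVneq b (mirror N a)) => e; last first.
  case: (eqVneq a b) => e'; first by rewrite e' ltnn subr0 expr1z mulr0n; ring.
  by rewrite subr0 expr0z; case: ifP => _; rewrite ?mulr1n ?mulr0n; ring.
rewrite -e -(mulrA (q - q^-1)).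
(* The coefficient [kappa_b kappa_j q^(rho_b - rho_j)] of [R] at [b = a'] factors as the inverse of
   [nrm] at [a] times [nrm] at [j'], because [rho] is odd under [mirror] and [kappa] is its own
   inverse. *)
have -> : (nrm (isSP g) a)^-1 *
   (\sum_(0 <= j < b) nrm (isSP g) (mirror N j) * M (ti (inord j) (inord (mirror N j))) c) =
   \sum_(j < N | (j < b)%N) kappa_sign C g (inord b : 'I_N) * kappa_sign C g j *
     s ^ (two_rho g (inord b : 'I_N) - two_rho g j) * M (ti j (rev_ord j)) c.
  rewrite mulr_sumr (big_nat_widen _ _ N) /=; last by lia.
  rewrite big_mkord; apply: eq_bigr => j _.
  rewrite !kappaE !two_rhoE // inordK // e.
  have jN := ltn_ord j.
  have -> : inord (mirror N j) = rev_ord j.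
    by apply: val_inj; rewrite /= inordK ?mirror_lt //= /mirror; lia.
  rewrite inord_val mulrA; congr (_ * _).
  rewrite /nrm mirrorK // !neg_2rho_mirror // !opprK invfM.
  have -> : (kappa (isSP g) (mirror N a))^-1 = kappa (isSP g) (mirror N a).
    by apply: (mulfI (kappa_neq0 (isSP g) (mirror N a))); rewrite kappa2 mulfV ?kappa_neq0.
  rewrite invr_expz !opprK expfzDr //.
  by ring.
rewrite e; case: (eqVneq a (mirror N a)) => e'.
  by rewrite -e' subrr expr0z ltnn !mulr0n mulr1n; ring.
rewrite sub0r -[q ^ (- 1)]/(q^-1); case: ifP => _; rewrite ?mulr0n !mulr1n; ring.
Qed.

Lemma hecke_ext u w a b : (a < N)%N -> (b < N)%N ->
  (forall i j, (i < N)%N -> (j < N)%N -> u i j = w i j) -> hecke q u a b = hecke q w a b.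
Proof. by move=> aN bN e; rewrite /hecke !e. Qed.

Lemma Sop_ext f u w a b : (a < N)%N -> (b < N)%N ->
  (forall i j, (i < N)%N -> (j < N)%N -> u i j = w i j) -> Sop q N f u a b = Sop q N f w a b.
Proof.
move=> aN bN e; rewrite /Sop !e // (hecke_ext aN bN e); case: ifP => // _.
congr (_ - _ * _); apply: eq_big_nat => j /andP[_ h].
have jN : (j < N)%N by apply: ltn_trans h (mirror_lt aN).
by rewrite e ?mirror_lt.
Qed.

Definition entries (A : 'M[C]_N) (sg : nat -> nat) (d y : nat -> C) : Prop :=
  (forall i j : 'I_N, A i j = d i *+ (j == i) + y i *+ (nat_of_ord j == sg i)) /\
  (forall i, (i < N)%N -> (sg i < N)%N \/ y i = 0).

Lemma actA_ext sg (d y : nat -> C) u w a b : (a < N)%N -> (b < N)%N ->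
  (forall i, (i < N)%N -> (sg i < N)%N \/ y i = 0) ->
  (forall i j, (i < N)%N -> (j < N)%N -> u i j = w i j) -> actA sg d y u a b = actA sg d y w a b.
Proof.
move=> aN bN sgN e; rewrite /actA e //.
by case: (sgN b bN) => [h | ->]; [rewrite e | rewrite !mul0r].
Qed.

Lemma flip_leg1 (A : 'M[C]_N) : flip_mx C N *m leg1 A = leg2 A *m flip_mx C N.
Proof.
apply/matrixP => x z; case: (mxtens_indexP x) => a b; case: (mxtens_indexP z) => c d.
rewrite flip_mul leg2_mul tensmxE mxE (bigD1 c) //= big1 ?addr0.
  rewrite -[flip_mx C N]mulmx1 flip_mul mxE (inj_eq (can_inj (@mxtens_indexK _ _))).
  by rewrite xpair_eqE eqxx.
move=> e ne; rewrite -[flip_mx C N]mulmx1 flip_mul mxE (inj_eq (can_inj (@mxtens_indexK _ _))).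
by rewrite xpair_eqE (negPf ne) mulr0.
Qed.

Lemma RE_braided g (A : 'M[C]_N) :
  Smx N g s *m leg2 A *m Smx N g s *m leg2 A = leg2 A *m Smx N g s *m leg2 A *m Smx N g s ->
  R21 N g s *m leg1 A *m Rmx N g s *m leg2 A = leg2 A *m R21 N g s *m leg1 A *m Rmx N g s.
Proof.
have e : R21 N g s *m leg1 A *m Rmx N g s = Smx N g s *m leg2 A *m Smx N g s.
  by rewrite /R21 /Smx -!mulmxA (mulmxA _ (leg1 A)) flip_leg1 !mulmxA.
move=> h; rewrite e h.
have -> : leg2 A *m R21 N g s *m leg1 A *m Rmx N g s =
   leg2 A *m (R21 N g s *m leg1 A *m Rmx N g s) by rewrite !mulmxA.
by rewrite e !mulmxA.
Qed.

Lemma RE_of_vec g (A : 'M[C]_N) sg d y (S : (nat -> nat -> C) -> nat -> nat -> C) :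
  entries A sg d y ->
  (forall k (M : 'M[C]_(N * N, k)) c a b, (a < N)%N -> (b < N)%N ->
     vec (Smx N g s *m M) c a b = S (vec M c) a b) ->
  (forall u w a b, (a < N)%N -> (b < N)%N ->
     (forall i j, (i < N)%N -> (j < N)%N -> u i j = w i j) -> S u a b = S w a b) ->
  (forall v a b, (a < N)%N -> (b < N)%N ->
     S (actA sg d y (S (actA sg d y v))) a b = actA sg d y (S (actA sg d y (S v))) a b) ->
  R21 N g s *m leg1 A *m Rmx N g s *m leg2 A = leg2 A *m R21 N g s *m leg1 A *m Rmx N g s.
Proof.
move=> [AE sgN] SE Sx RE; apply: RE_braided; move: (Smx N g s) SE => X SE.
rewrite -[LHS]mulmx1 -[RHS]mulmx1 -!mulmxA; apply: vec_inj => c a b aN bN.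
have LE k (M : 'M[C]_(N * N, k)) c' i j : (i < N)%N -> (j < N)%N ->
    vec (leg2 A *m M) c' i j = actA sg d y (vec M c') i j.
  by move=> *; apply: leg2_vec.
have Ax u w i j : (i < N)%N -> (j < N)%N ->
  (forall i j, (i < N)%N -> (j < N)%N -> u i j = w i j) -> actA sg d y u i j = actA sg d y w i j.
  by move=> *; apply: actA_ext.
transitivity (S (actA sg d y (S (actA sg d y (vec 1%:M c)))) a b).
  rewrite SE //; apply: (Sx) => // i j iN jN; rewrite LE //; apply: (Ax) => // {}i {}j {}iN {}jN.
  rewrite SE //; apply: (Sx) => // {}i {}j {}iN {}jN; exact: LE.
rewrite RE // LE //; apply: (Ax) => // i j iN jN.
rewrite SE //; apply: (Sx) => // {}i {}j {}iN {}jN.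
rewrite LE //; apply: (Ax) => // {}i {}j {}iN {}jN.
by rewrite SE.
Qed.

Section Ortho.
Variables (g : lie_type) (gS : g <> SL).
Variables (A : 'M[C]_N) (m : nat) (sg : nat -> nat) (d y : nat -> C) (al be : C) (tw : bool).
Let sp := isSP g.
Hypothesis spN : sp ==> ~~ odd N.
Hypothesis Aent : entries A sg d y.
Hypothesis D : datum q N m sg d y al be tw (esign C sp) (pwt q N sp) (nrm sp).

Lemma ortho_RE :
  R21 N g s *m leg1 A *m Rmx N g s *m leg2 A = leg2 A *m R21 N g s *m leg1 A *m Rmx N g s.
Proof.
apply: (RE_of_vec Aent (S := Sop q N (nrm sp))).
- by move=> *; apply: Smx_vec.
- by move=> *; apply: Sop_ext.
- by move=> *; apply: (orthosymplectic_RE q0 D).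
Qed.

Lemma eigen_trivial c k (M : 'M[C]_(N * N, k)) :
  (c - q) * (c + q^-1) != 0 -> al * be * (if tw then - q^-1 else q) = c ->
  Smx N g s *m M = c *: M ->
  leg2 A *m Smx N g s *m leg2 A *m M = c *: M.
Proof.
move=> c2 ec SM; have [AE sgN] := Aent.
have SX k' (M' : 'M[C]_(N * N, k')) l a b : (a < N)%N -> (b < N)%N ->
    vec (Smx N g s *m M') l a b = Sop q N (nrm sp) (vec M' l) a b.
  by move=> *; apply: Smx_vec.
move: (Smx N g s) SM SX => X SM SX.
apply: vec_inj => l a b aN bN.
have SE i j : (i < N)%N -> (j < N)%N -> Sop q N (nrm sp) (vec M l) i j = c * vec M l i j.
  by move=> iN jN; rewrite -SX // SM /vec mxE.
(* At these coordinates [S] is the Hecke braiding, whose eigenvalues are [q] and [- q^-1]; [c] is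
   neither. *)
have v0 i j : (i < N)%N -> (j < N)%N -> j != mirror N i -> vec M l i j = 0.
  move=> iN jN ne.
  have ne' : i != mirror N j by rewrite mirror_swap.
  have := SE _ _ iN jN; have := SE _ _ jN iN.
  rewrite !Sop_hecke // /hecke.
  have [c0 c1] : c - q != 0 /\ c + q^-1 != 0 by apply/andP; rewrite -negb_or -mulf_eq0.
  case: (ltngtP i j) => h E1 E2; last first.
  - apply/eqP; rewrite -(inj_eq (mulfI c0)) mulr0; apply/eqP.
    by rewrite mulrBl -E2 h subrr.
  - apply/eqP; rewrite -(inj_eq (mulfI c2)) mulr0; apply/eqP.
    transitivity (c * (c * vec M l i j) - lam * (c * vec M l i j) - vec M l i j).
      by rewrite /lam; field.
    by rewrite -E2 mul0r addr0 -E1; rewrite /lam; ring.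
  - apply/eqP; rewrite -(inj_eq (mulfI c2)) mulr0; apply/eqP.
    transitivity (c * (c * vec M l i j) - lam * (c * vec M l i j) - vec M l i j).
      by rewrite /lam; field.
    rewrite mul0r addr0 in E1.
    by rewrite -{1}E2 mulrDr -E1 /lam; ring.
have ph i : (i < N)%N -> phi N (nrm sp) (vec M l) i = phi N (nrm sp) (vec M l) 0.
  apply: (eigen_const q0 spN c2) => j jN.
  by rewrite -(phi_S D) // /phi SE ?mirror_lt //; ring.
have V := ASA_trivial q0 D v0 ph aN bN.
have LE k' (M' : 'M[C]_(N * N, k')) c' i j : (i < N)%N -> (j < N)%N ->
    vec (leg2 A *m M') c' i j = actA sg d y (vec M' c') i j.
  by move=> *; apply: leg2_vec.
rewrite -!mulmxA LE //.
transitivity (actA sg d y (Sop q N (nrm sp) (actA sg d y (vec M l))) a b).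
  apply: actA_ext => // i j iN jN; rewrite SX //; apply: Sop_ext => // {}i {}j {}iN {}jN.
  exact: LE.
by rewrite V ec /vec mxE.
Qed.

End Ortho.

End MatrixEquations.

(** * Symmetry of S and the trivial submodule *)

Local Notation ti a b := (mxtens_index (a, b)).

Section Transpose.
Variables (C : fieldType) (n : nat) (s : C).
Local Notation N := n.+1.
Hypothesis s0 : s != 0.
Let q := s ^+ 2.
Let lam := q - q^-1.
Let q0 : q != 0. Proof. by rewrite expf_neq0. Qed.

(** The coordinates of [e_c (x) e_d]; applying [Sop] to it gives the matrix entries of [S]. *)
Let dlt c d (x y : nat) : C := ((x == c) && (y == d))%:R.

(** Up to the sign [esign], [nrm] at [mirror N x] is the inverse of [nrm] at [x], so both sides are
    [esign] times the product of the two inverses. This is the symmetry of [S] between [v a a'] and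
    [v c c']. *)
Lemma nrm_mirror_sym sp a c : (sp ==> ~~ odd N) -> (a < N)%N -> (c < N)%N ->
  (nrm n s sp a)^-1 * nrm n s sp (mirror N c) = (nrm n s sp c)^-1 * nrm n s sp (mirror N a).
Proof.
move=> h aN cN.
have e x : (x < N)%N -> nrm n s sp (mirror N x) = esign C sp * (nrm n s sp x)^-1.
  move=> xN; apply: (mulIf (nrm_neq0 n s0 sp x)).
  rewrite divfK ?nrm_neq0 // /nrm mirrorK // neg_2rho_mirror // opprK (kappa_mirror s0 h xN).
  transitivity (esign C sp * (kappa C n sp (mirror N x) * kappa C n sp (mirror N x)) *
    (s ^ (- neg_2rho N sp x) * s ^ neg_2rho N sp x)); first by ring.
  by rewrite kappa2 szN // !mulr1.
by rewrite !e //; ring.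
Qed.

Lemma dlt_off a b c d : b = mirror N a -> (c < N)%N -> (a < N)%N -> d != mirror N c ->
  dlt a b c d = 0 /\ dlt a b d c = 0.
Proof.
move=> -> cN aN ne; rewrite /dlt; split.
  have -> // : (c == a) && (d == mirror N a) = false.
  by apply/negP => /andP[/eqP e1 /eqP e2]; move: ne; rewrite e1 e2 eqxx.
have -> // : (d == a) && (c == mirror N a) = false.
by apply/negP => /andP[/eqP e1 /eqP e2]; move: ne; rewrite e1 e2 mirrorK // eqxx.
Qed.

Lemma Sop_dlt_off f a b c d : (a < N)%N -> (c < N)%N -> b = mirror N a -> d != mirror N c ->
  Sop q N f (dlt c d) a b = 0.
Proof.
move=> aN cN -> ne; rewrite /Sop eqxx /dlt.
have h1 : (a == c) && (mirror N a == d) = false.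
  by apply/negP => /andP[/eqP-> /eqP e]; rewrite e eqxx in ne.
have h2 : (mirror N a == c) && (a == d) = false.
  by apply/negP => /andP[/eqP e /eqP e']; move: ne; rewrite -e -e' mirrorK // eqxx.
rewrite h1 h2 big1_seq ?mulr0 ?subr0 ?addr0 // => j _.
case: (eqVneq j c) => [->|] /=; last by rewrite mulr0.
by rewrite eq_sym (negPf ne) mulr0.
Qed.

Lemma hecke_dlt a b c d : hecke q (dlt c d) a b = hecke q (dlt a b) c d.
Proof.
have off (x y z : nat) : x != y -> (z == x) && (z == y) = false.
  by move=> ne; apply: contraNF ne => /andP[/eqP<- /eqP<-].
have off' (x y z : nat) : x != y -> (x == z) && (y == z) = false.
  by move=> ne; rewrite eq_sym [y == z]eq_sym off.
rewrite /hecke /dlt.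
case: (eqVneq a b) => [<-|ne]; case: (eqVneq c d) => [<-|ne'].
- by rewrite (eq_sym a).
- have ne'' : d != c by rewrite eq_sym.
  by rewrite (off _ _ a ne') (off' _ _ a ne') (off' _ _ a ne'') !mulr0 addr0.
- have ne'' : b != a by rewrite eq_sym.
  by rewrite (off _ _ c ne) (off' _ _ c ne) (off' _ _ c ne'') !mulr0 addr0.
- rewrite (eq_sym b) (eq_sym a d) andbC; congr (_ + _).
  rewrite (eq_sym c) (eq_sym d); case: (boolP ((a == c) && (b == d))) => [|_]; last first.
    by rewrite !mulr0.
  by move=> /andP[/eqP-> /eqP->].
Qed.

Lemma Sop_dlt_sym sp a b c d : (sp ==> ~~ odd N) ->
  (a < N)%N -> (b < N)%N -> (c < N)%N -> (d < N)%N ->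
  Sop q N (nrm n s sp) (dlt c d) a b = Sop q N (nrm n s sp) (dlt a b) c d.
Proof.
move=> h aN bN cN dN.
case: (eqVneq b (mirror N a)) => e1; case: (eqVneq d (mirror N c)) => e2.
- subst b d; rewrite /Sop !eqxx /dlt.
  have sumE x y : (x < N)%N -> (y < N)%N ->
    \sum_(0 <= j < mirror N x) nrm n s sp (mirror N j) * ((j == y) && (mirror N j == mirror N y))%:R
     = if (y < mirror N x)%N then nrm n s sp (mirror N y) else 0.
    move=> xN yN; rewrite big_mkord; case: ltnP => hy.
      rewrite (bigD1 (Ordinal hy)) //= !eqxx mulr1 big1 ?addr0 // => j.
      by rewrite -(inj_eq val_inj) /= => /negPf->; rewrite mulr0.
    rewrite big1 // => j _; have -> : (j == y :> nat) = false by have := ltn_ord j; lia.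
    by rewrite mulr0.
  rewrite !sumE //.
  have -> : (mirror N a == c) = (mirror N c == a) by apply/eqP/eqP => <-; rewrite mirrorK.
  have -> : (a == mirror N c) = (mirror N c == a) by rewrite eq_sym.
  have -> : (c == mirror N a) = (mirror N c == a) by apply/eqP/eqP => [->|<-]; rewrite mirrorK.
  have -> : (c < mirror N a)%N = (a < mirror N c)%N by rewrite /mirror; lia.
  rewrite (eq_sym c a) (eq_sym (mirror N c) (mirror N a)) !andbb.
  congr (_ + _ - _).
  - by case: (eqVneq (mirror N c) a) => [<-|_]; rewrite ?mulr0 // !mirrorK // (eq_sym c).
  - case: (eqVneq a c) => [->|_] //; by rewrite !mulr0.
  - rewrite -!mulrA; congr (_ * _); case: ifP => _; last by rewrite !mulr0.
    exact: nrm_mirror_sym.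
- rewrite Sop_dlt_off // Sop_hecke // /hecke.
  have [-> ->] := dlt_off e1 cN aN e2.
  by rewrite !mulr0 addr0; case: ifP.
- rewrite [RHS]Sop_dlt_off // Sop_hecke // /hecke.
  have [-> ->] := dlt_off e2 aN cN e1.
  by rewrite !mulr0 addr0; case: ifP.
- by rewrite !Sop_hecke // hecke_dlt.
Qed.

Lemma Smx_tr g : g <> SL -> (isSP g ==> ~~ odd N) -> (Smx N g s)^T = Smx N g s.
Proof.
move=> gS h; apply/matrixP => x z; case: (mxtens_indexP x) => a b; case: (mxtens_indexP z) => c d.
have E (i j k l : 'I_N) : Smx N g s (ti i j) (ti k l) = Sop q N (nrm n s (isSP g)) (dlt k l) i j.
  rewrite -[Smx N g s]mulmx1 -vec_val Smx_vec //.
  apply: Sop_ext => // x' z' xN zN.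
  rewrite /vec mxE (inj_eq (can_inj (@mxtens_indexK _ _))) xpair_eqE /dlt.
  by rewrite -!(inj_eq val_inj) /= !inordK.
by rewrite mxE !E Sop_dlt_sym.
Qed.

Lemma projector_eigen k (X : 'M[C]_k) c W : spectral_projector X c W -> X *m W = c *: W.
Proof.
case=> WW _ Weig; apply/matrixP => i j.
have /Weig e : W *m col j W = col j W.
  by rewrite !colE mulmxA WW.
have := congr1 (fun v : 'cV[C]_k => v i 0) e.
by rewrite !colE mulmxA -!colE !mxE.
Qed.

(** [W] commutes with the symmetric [X], so its rows are eigenvectors too. *)
Lemma projector_eigen_tr k (X : 'M[C]_k) c W :
  X^T = X -> spectral_projector X c W -> X *m W^T = c *: W^T.
Proof.
move=> Xt h; have e := projector_eigen h; case: h => _ comm _.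
by rewrite -[X]Xt -trmx_mul comm e linearZ.
Qed.

Section TransposedDatum.
Variables (m : nat) (sg : nat -> nat) (d y : nat -> C) (al be : C) (tw : bool).
Variables (eps : C) (p nu : nat -> C).
Hypothesis D : datum q N m sg d y al be tw eps p nu.

(** The off-diagonal entries of [A^T]: as [sg] is an involution on the paired indices, row [i] has
    its entry again in column [sg i]. *)
Definition ytr (i : nat) : C := if paired N m i then y (sg i) else 0.

Lemma datum_tr : datum q N m sg d ytr al be tw eps p nu.
Proof.
have sh := dm_sh D; have mN := sh_m sh.
case: (D) => [_ W n0 nr nt yt sgE dm]; split=> //.
  case: (sh) => *; split=> //.
    by move=> a aN pa; rewrite /ytr pa (paired_sg sh) // (sh_inv sh) // mulrC (sh_y sh).
  by move=> a aN pa; rewrite /ytr (negPf pa).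
move=> a aN tw1 pa; rewrite /ytr pa.
have pt : paired N m (twist tw a) by apply: (twist_pairedE D).
rewrite pt.
have -> : sg (twist tw a) = twist tw (sg a).
  by rewrite sgE ?(twist_lt D) // sgE // -(twist_mirrorE D) // twistK.
by rewrite yt ?(sg_ltN sh) ?(paired_sg sh).
Qed.

Lemma entries_tr (A : 'M[C]_N) : entries A sg d y -> entries A^T sg d ytr.
Proof.
have sh := dm_sh D.
case=> AE sgN; split=> [i j|i iN]; last first.
  rewrite /ytr; case: ifP => pi; last by right.
  by left; rewrite (sg_ltN sh).
rewrite mxE AE eq_sym; congr (_ + _); first by case: eqP => [->|].
have iN := ltn_ord i; have jN := ltn_ord j.
rewrite /ytr; case: ifP => pi; last first.
  rewrite mul0rn; case: eqP => // e.
  rewrite (sh_y0 sh) //; apply/negP => pj.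
  by move: pi; rewrite e (paired_sg sh).
case: (eqVneq (nat_of_ord j) (sg i)) => e.
  by rewrite e (sh_inv sh) // eqxx.
case: eqP => // e'; case: (boolP (paired N m j)) => pj; last by rewrite (sh_y0 sh).
by move: e; rewrite e' (sh_inv sh) // eqxx.
Qed.

End TransposedDatum.

Section Varpi.
Variables (g : lie_type) (gS : g <> SL).
Variables (A : 'M[C]_N) (m : nat) (sg : nat -> nat) (d y : nat -> C) (al be : C) (tw : bool).
Let sp := isSP g.
Hypothesis spN : sp ==> ~~ odd N.
Hypothesis Aent : entries A sg d y.
Hypothesis D : datum q N m sg d y al be tw (esign C sp) (pwt q N sp) (nrm n s sp).

(** The second equation, transposed, is [eigen_trivial] for [A^T] and [W^T], to which [datum_tr],
    [Smx_tr] and [projector_eigen_tr] give access. *)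
Lemma varpi_eq c W :
  (c - q) * (c + q^-1) != 0 -> al * be * (if tw then - q^-1 else q) = c ->
  spectral_projector (Smx N g s) c W ->
  leg2 A *m Smx N g s *m leg2 A *m W = c *: W /\
  W *m (leg2 A *m Smx N g s *m leg2 A) = c *: W.
Proof.
move=> c2 ec h; have St := Smx_tr gS spN; split.
  exact: (eigen_trivial s0 gS spN Aent D c2 ec (projector_eigen h)).
have E := eigen_trivial s0 gS spN (entries_tr D Aent) (datum_tr D) c2 ec
  (projector_eigen_tr St h).
have Lt : leg2 A^T = (leg2 A)^T by rewrite /leg2 trmx_tens trmx1.
move: (Smx N g s) St E => X St E.
by apply: trmx_inj; rewrite linearZ /= -E Lt !trmx_mul St !mulmxA.
Qed.

End Varpi.

End Transpose.

(** * The four families *)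

Section TwistShape.
Variables (C : fieldType) (n : nat).
Local Notation N := n.+1.
Variables (m : nat) (tw : bool).
Hypotheses (mN : (m.*2 <= N)%N) (tw_m : tw ==> ~~ odd m && ~~ odd N).
Lemma twist_mirror_comm a : (a < N)%N -> paired N m a -> twist tw (mirror N a) = mirror N (twist tw a).
Proof.
move: tw_m mN; rewrite /paired /twist /mirror; case: tw => //= /andP[om oN] mN' aN h.
case: (boolP (odd a)) => oa.
  have -> : odd (n - a) = false by lia.
  by lia.
by have -> : odd (n - a) by [lia]; lia.
Qed.

Lemma twist_stable a : (a < N)%N -> paired N m a -> (twist tw a < N)%N && paired N m (twist tw a).
Proof.
move: tw_m mN; rewrite /paired /twist; case: tw => /=; last by move=> _ _ -> ->.
move=> /andP[om oN] mN' aN h.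
by case: (boolP (odd a)) => oa; lia.
Qed.

Let sg a := twist tw (mirror N a).
Variables (d y : nat -> C) (al be : C).
Hypothesis d1 : forall a, (a < m)%N -> d a = al - be.
Hypothesis d2 : forall a, (N - m <= a < N)%N -> d a = 0.
Hypothesis y1 : forall a, (a < N)%N -> paired N m a -> y a * y (sg a) = al * be.
Hypothesis y0 : forall a, (a < N)%N -> ~~ paired N m a -> y a = 0.
Hypothesis dm : forall a, (a < N)%N -> ~~ paired N m a -> (d a - al) * (d a + be) = 0.
Hypothesis ab : al * be != 0.

Lemma shape_twist : shape N m sg d y al be.
Proof.
split=> //.
- move=> a am; rewrite /sg /twist /mirror; move: tw_m mN; case: tw => /=; last by lia.
  by move=> /andP[om oN] mN'; case: (boolP (odd _)) => oa; lia.
- move=> a am; rewrite /sg /twist /mirror; move: tw_m mN; case: tw => /=; last by lia.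
  by move=> /andP[om oN] mN'; case: (boolP (odd _)) => oa; lia.
- move=> a aN pa; rewrite /sg.
  have /andP[lt pt] := twist_stable (mirror_lt aN) (etrans (paired_mirror mN aN) pa).
  by rewrite twist_mirror_comm // twistK mirrorK.
- by move=> a aN pa; rewrite /sg twist_mirror_comm ?mirror_lt ?paired_mirror.
- move=> a b am bm lt; rewrite /sg mirrorK; last by lia.
  rewrite /twist /mirror; move: tw_m mN; case: tw => /=; last by lia.
  move=> /andP[om oN] mN'.
  have -> : odd (n - a) = ~~ odd a by lia.
  have -> : odd (n - b) = ~~ odd b by lia.
  by case: (boolP (odd a)) => oa; case: (boolP (odd b)) => ob /= ne; lia.
Qed.

End TwistShape.

Section Families.
Variables (C : fieldType) (n : nat) (s : C).
Local Notation N := n.+1.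
Hypothesis s0 : s != 0.
Let q := s ^+ 2.
Let q0 : q != 0. Proof. by rewrite expf_neq0. Qed.

Section TwistDatum.
Variables (m : nat) (tw : bool) (d y : nat -> C) (al be : C).
Hypotheses (mN : (m.*2 <= N)%N) (tw_m : tw ==> ~~ odd m && ~~ odd N).
Let sg a := twist tw (mirror N a).
Hypothesis d1 : forall a, (a < m)%N -> d a = al - be.
Hypothesis d2 : forall a, (N - m <= a < N)%N -> d a = 0.
Hypothesis y1 : forall a, (a < N)%N -> paired N m a -> y a * y (sg a) = al * be.
Hypothesis y0 : forall a, (a < N)%N -> ~~ paired N m a -> y a = 0.
Hypothesis dm : forall a, (a < N)%N -> ~~ paired N m a -> (d a - al) * (d a + be) = 0.
Hypothesis ab : al * be != 0.

Lemma datum_twist g : g <> SL -> (isSP g ==> ~~ odd N) ->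
  weights q N m tw (esign C (isSP g)) (pwt q N (isSP g)) (fun a => d (mirror N a)) (fun a => d (twist tw a)) al be ->
  (forall a, (a < N)%N -> tw -> paired N m a -> y (twist tw a) = - y a) ->
  (forall a b, (a < N)%N -> (b < N)%N -> ~~ paired N m a -> ~~ paired N m b ->
     b != mirror N a -> d a = d b) ->
  datum q N m sg d y al be tw (esign C (isSP g)) (pwt q N (isSP g)) (nrm n s (isSP g)).
Proof.
move=> gS spN W yt dmid; split=> //.
- exact: shape_twist.
- by move=> a _; apply: nrm_neq0.
- by move=> a aN; apply: nrm_mirror.
move=> a aN tw1 pa oa.
have /andP[om oN] : ~~ odd m && ~~ odd N by move: tw_m; rewrite tw1.
(* A twisted pair never straddles the centre, so [kappa] agrees on its two indices and [rho] drops
   by one. *)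
have [a1 pz1 kp] : [/\ (a.+1 < N)%N, neg_2rho N (isSP g) a.+1 = neg_2rho N (isSP g) a + 2 &
   kappa C n (isSP g) (mirror N a.+1) = kappa C n (isSP g) (mirror N a)].
  move: pa; rewrite /paired => /orP[] h; split.
  - by move: h om mN oa; clear; lia.
  - by apply: neg_2rho_first; move: h om mN oa; clear; lia.
  - rewrite /kappa /mirror; case: (isSP g) => //=.
    have -> : (n.+1.-1 - a.+1 < uphalf n)%N = false by move: h om mN oa oN; clear; rewrite /=; lia.
    by have -> : (n.+1.-1 - a < uphalf n)%N = false by move: h om mN oa oN; clear; rewrite /=; lia.
  - by move: h aN oN oa; clear; rewrite /=; lia.
  - by apply: neg_2rho_last; move: h mN; clear; lia.
  - rewrite /kappa /mirror; case: (isSP g) => //=.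
    have -> : (n.+1.-1 - a.+1 < uphalf n)%N by move: h mN oa oN om aN; clear; rewrite /=; lia.
    by have -> : (n.+1.-1 - a < uphalf n)%N by move: h mN oa oN om aN; clear; rewrite /=; lia.
rewrite /nrm kp pz1 opprD expfzDr // mulrCA; congr (_ * _).
rewrite mulrCA -[s ^ (- 2)]/((s ^+ 2)^-1) mulfV ?mulr1 //.
Qed.

End TwistDatum.

Lemma sum_delta_row (P : pred 'I_N) (F : 'I_N -> C) (f : 'I_N -> 'I_N) (i j : 'I_N) :
  (\sum_(k | P k) F k *: delta_mx k (f k) : 'M[C]_N) i j = (if P i then F i else 0) *+ (j == f i).
Proof.
rewrite summxE big_mkcond (bigD1 i) //= big1 ?addr0.
  by case: ifP => _; rewrite ?mul0rn // !mxE eqxx /= mulr_natr.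
move=> k ne; case: ifP => // _; rewrite !mxE eq_sym (negPf ne) /= mulr0 //.
Qed.

Lemma diag_part_entries m (i j : 'I_N) : (m.*2 <= N)%N ->
  diag_part N m q i j = (if (i < m)%N then q ^- m * (1 - q ^ (- N%:Z + m.*2%:Z))
    else if (i < N - m)%N then q ^- m else 0) *+ (j == i).
Proof.
move=> mN; rewrite /diag_part mxE.
rewrite (sum_delta_row (fun i => (i < m)%N) (fun=> _) id).
rewrite (sum_delta_row (fun i : 'I_N => (m <= i)%N && (i < N - m)%N) (fun=> _) id).
case: (ltnP i m) => h /=; first by rewrite mul0rn addr0.
by rewrite mul0rn add0r.
Qed.

Lemma y_part_entries t (y : 'I_N -> C) (i j : 'I_N) :
  y_part t y i j = (if occurs t i then y i else 0) *+ (nat_of_ord j == mirror N i).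
Proof. by rewrite /y_part (sum_delta_row (occurs t) y (@rev_ord N)). Qed.

(** The entry of [z_part] in row [a]: an odd row comes from the second matrix unit of the summand
    [a.-1], whence the sign. *)
Definition zval (y : 'I_N -> C) (a : nat) : C :=
  if odd a then - y (inord a.-1) else y (inord a).

(** The condition on [m] keeps [paired] from splitting a pair [2k, 2k+1]: either [m] is even, or
    [m.*2 = N] and every index is paired. *)
Lemma z_part_entries t m (y : 'I_N -> C) (i j : 'I_N) :
  ~~ odd N -> ~~ odd m || (m.*2 == N) -> (m.*2 <= N)%N ->
  (forall i : 'I_N, occurs t i = ~~ odd i && paired N m i) ->
  z_part t y i j = (if paired N m i then zval y i else 0) *+ (nat_of_ord j == twist true (mirror N i)).
Proof.
move=> oN om mN occ.
have predE (k : 'I_N) : ~~ odd k -> nat_of_ord (ord_pred (rev_ord k)) = (mirror N k).-1.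
  move=> ok; rewrite /= /mirror /=; have kN := ltn_ord k.
  have -> : ((n.+1 - k.+1 + n.+1).-1 = (n - k).-1 + n.+1)%N by move: ok oN kN; clear; lia.
  by rewrite modnDr modn_small //; move: kN; clear; lia.
have succE (k : 'I_N) : ~~ odd k -> nat_of_ord (ordS k) = k.+1.
  move=> ok; rewrite /= modn_small //; have := ltn_ord k; move: ok oN; clear; lia.
have iN := ltn_ord i.
rewrite /z_part summxE big_mkcond /=.
case: (boolP (odd i)) => oi.
  have i1N : (i.-1 < N)%N by move: iN; clear; lia.
  have oi1 : ~~ odd (Ordinal i1N) by move: oi; clear; rewrite /=; lia.
  rewrite (bigD1 (Ordinal i1N)) //= big1 ?addr0; last first.
    move=> k ne; case: ifP => //; rewrite occ => /andP[ok _].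
    have e1 : (i == k) = false by apply/negP => /eqP e; rewrite e (negPf ok) in oi.
    have e2 : (i == ordS k) = false.
      apply/negP => /eqP e; move: ne; rewrite -(inj_eq val_inj) /=.
      by have := succE k ok; rewrite -e => ->; rewrite eqxx.
    by rewrite !mxE e1 e2 /= subrr mulr0.
  rewrite occ oi1 /=.
  have -> : paired N m i.-1 = paired N m i.
    by move: oi om oN mN iN; rewrite /paired; clear; lia.
  case: ifP => _; last by rewrite mul0rn.
  rewrite !mxE /zval oi.
  have -> : (i == Ordinal i1N) = false.
    by rewrite -(inj_eq val_inj) /=; move: oi; clear; lia.
  have -> : i == ordS (Ordinal i1N).
    by apply/eqP/val_inj; apply: etrans (esym (succE _ oi1)); move: oi; clear; rewrite /=; lia.
  have -> : (j == rev_ord (Ordinal i1N)) = (nat_of_ord j == twist true (mirror N i)).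
    rewrite -(inj_eq val_inj) /= /twist /mirror /=.
    have -> : odd (n - i) = false by move: oi oN iN; clear; rewrite /=; lia.
    have -> // : (n.+1 - i.-1.+1 = (n - i).+1)%N by move: oi iN; clear; lia.
  have -> : Ordinal i1N = inord i.-1 by apply: val_inj; rewrite /= inordK.
  by case: eqP => _ /=; ring.
rewrite (bigD1 i) //= big1 ?addr0; last first.
  move=> k ne; case: ifP => //; rewrite occ => /andP[ok _].
  have e2 : (i == ordS k) = false.
    apply/negP => /eqP e; move: oi; rewrite e succE //=.
    by rewrite ok.
  by rewrite !mxE (eq_sym i) (negPf ne) e2 /= subrr mulr0.
rewrite occ oi /=; case: ifP => _; last by rewrite mul0rn.
have e2 : (i == ordS i) = false.
  by apply/negP => /eqP e; have := succE i oi; rewrite -e; clear; lia.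
rewrite !mxE eqxx e2 /zval (negPf oi) inord_val.
have -> : (j == ord_pred (rev_ord i)) = (nat_of_ord j == twist true (mirror N i)).
  rewrite -(inj_eq val_inj) -[val (ord_pred _)]/(nat_of_ord (ord_pred _)) predE // /twist.
  by have -> : odd (mirror N i) by move: oi oN iN; clear; rewrite /mirror /=; lia.
by case: eqP => _ /=; ring.
Qed.

End Families.

Section ScalarDiagonal.
Variables (C : fieldType) (n : nat).
Local Notation N := n.+1.

Lemma paired_ord m (i : 'I_N) : (m <= N)%N -> (i < m)%N || (rev_ord i < m)%N = paired N m i.
Proof. by move=> mN; rewrite /paired /=; have := ltn_ord i; case: ltnP => //= h; lia. Qed.

Definition dS (m : nat) (al be : C) (a : nat) : C :=
  if (a < m)%N then al - be else if (a < N - m)%N then al else 0.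

Lemma dS_1 m al be a : (a < m)%N -> dS m al be a = al - be.
Proof. by rewrite /dS => ->. Qed.

Lemma dS_2 m al be a : (m.*2 <= N)%N -> (N - m <= a < N)%N -> dS m al be a = 0.
Proof.
move=> mN h; rewrite /dS; have -> : (a < m)%N = false by lia.
by have -> : (a < N - m)%N = false by lia.
Qed.

Lemma dS_mid m al be a : (m <= a < N - m)%N -> dS m al be a = al.
Proof. by move=> h; rewrite /dS; have -> : (a < m)%N = false by [lia]; case/andP: h => _ ->. Qed.

Lemma dS_unpaired m al be a : ~~ paired N m a -> dS m al be a = al.
Proof. by move=> h; apply: dS_mid; move: h; rewrite /paired; lia. Qed.

End ScalarDiagonal.

Section Types.
Variables (C : fieldType) (n : nat) (s : C).
Local Notation N := n.+1.
Hypothesis s0 : s != 0.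
Let q := s ^+ 2.
Local Notation dS := (dS n).
Let q0 : q != 0. Proof. by rewrite expf_neq0. Qed.

(** The eigenvalues of types (1) and (2) are [alS] and [- beS], that is, up to the overall sign
    [q^-m] and [- q^(m-N)]. *)
Definition alS (neg : bool) m : C := (-1) ^+ neg * q ^- m.
Definition beS (neg : bool) m : C := alS neg m * q ^ (m.*2%:Z - N%:Z).

Definition yS (m : nat) (neg : bool) (z : nat -> C) (a : nat) : C :=
  if paired N m a then (-1) ^+ neg * z a else 0.

Lemma sgn2 (neg : bool) : (-1) ^+ neg * (-1) ^+ neg = 1 :> C.
Proof. by rewrite -expr2 sqrr_sign. Qed.

Lemma alS_beS neg m : alS neg m * beS neg m = q ^- N.
Proof.
rewrite /beS /alS; have := sgn2 neg.
move: ((-1) ^+ neg) => e e2.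
transitivity ((e * e) * (q ^- m * q ^- m * q ^ (m.*2%:Z - N%:Z))); first by ring.
by rewrite e2 mul1r !exprnN -!expfzDr //; congr (_ ^ _); lia.
Qed.

Lemma dS_scalar_diag (neg : bool) m (i : 'I_N) : (m.*2 <= N)%N ->
  (-1) ^+ neg * (if (i < m)%N then q ^- m * (1 - q ^ (- N%:Z + m.*2%:Z))
    else if (i < N - m)%N then q ^- m else 0) = dS m (alS neg m) (beS neg m) i.
Proof.
move=> mN; rewrite /dS /beS /alS [- N%:Z + _]addrC; case: ifP => _; first by ring.
by case: ifP => _; rewrite ?mulr0.
Qed.

Lemma twist_lt_N tw m a : (m.*2 <= N)%N -> (tw ==> ~~ odd m && ~~ odd N) ->
  (a < N)%N -> paired N m a -> (twist tw (mirror N a) < N)%N.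
Proof.
move=> mN twm aN pa.
by have /andP[] := twist_stable mN twm (mirror_lt aN) (etrans (paired_mirror mN aN) pa).
Qed.

Lemma type1_entries m neg (y : 'I_N -> C) : (m.*2 <= N)%N ->
  entries (Amx (Type1 m neg) q y) (fun a => twist false (mirror N a))
    (dS m (alS neg m) (beS neg m)) (yS m neg (fun a => y (inord a))).
Proof.
move=> mN; split=> [i j | i iN]; last first.
  rewrite /yS; case: ifP => pi; last by right.
  by left; apply: (@twist_lt_N _ m).
rewrite /Amx scalemxE addmxE diag_part_entries // y_part_entries -dS_scalar_diag // /yS /twist.
rewrite /occurs paired_ord; last by lia.
rewrite inord_val mulrDr !mulrnAr; congr (_ + _ *+ _).
by case: ifP; rewrite ?mulr0.
Qed.

Lemma type2_entries m neg (y : 'I_N -> C) : (m.*2 <= N)%N -> ~~ odd m -> ~~ odd N ->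
  entries (Amx (Type2 m neg) q y) (fun a => twist true (mirror N a))
    (dS m (alS neg m) (beS neg m)) (yS m neg (zval y)).
Proof.
move=> mN om oN; split=> [i j | i iN]; last first.
  rewrite /yS; case: ifP => pi; last by right.
  by left; apply: (@twist_lt_N _ m); rewrite ?om.
rewrite /Amx scalemxE addmxE diag_part_entries // (@z_part_entries _ _ _ m) ?om //; last first.
  by move=> k; rewrite /occurs paired_ord //; lia.
rewrite -dS_scalar_diag // /yS.
rewrite mulrDr !mulrnAr; congr (_ + _ *+ _).
by case: ifP; rewrite ?mulr0.
Qed.

Section Scalar.
Variables (m : nat) (neg tw : bool) (z : nat -> C).
Hypotheses (mN : (m.*2 <= N)%N) (twm : tw ==> ~~ odd m && ~~ odd N).
Hypothesis zz : forall a, (a < N)%N -> paired N m a -> z a * z (twist tw (mirror N a)) = q ^- N.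
Let al := alS neg m.
Let be := beS neg m.

Lemma yS_mul a : (a < N)%N -> paired N m a ->
  yS m neg z a * yS m neg z (twist tw (mirror N a)) = al * be.
Proof.
move=> aN pa; rewrite /yS pa.
have /andP[_ ->] := twist_stable mN twm (mirror_lt aN) (etrans (paired_mirror mN aN) pa).
by rewrite mulrACA sgn2 mul1r zz // alS_beS.
Qed.

Lemma scalar_shape : shape N m (fun a => twist tw (mirror N a)) (dS m al be) (yS m neg z) al be.
Proof.
apply: shape_twist => //.
- exact: dS_1.
- by move=> a; apply: dS_2.
- exact: yS_mul.
- by move=> a _ pa; rewrite /yS (negPf pa).
- by move=> a _ pa; rewrite dS_unpaired // subrr mul0r.
- by rewrite alS_beS invr_neq0 // expf_neq0.
Qed.

Lemma scalar_datum g : g <> SL -> (isSP g ==> ~~ odd N) -> tw = isSP g ->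
  (tw -> forall a, (a < N)%N -> paired N m a -> z (twist tw a) = - z a) ->
  datum q N m (fun a => twist tw (mirror N a)) (dS m al be) (yS m neg z) al be tw
    (esign C (isSP g)) (pwt q N (isSP g)) (nrm n s (isSP g)).
Proof.
move=> gS spN twE zt; apply: datum_twist => //.
- exact: dS_1.
- by move=> a; apply: dS_2.
- exact: yS_mul.
- by move=> a _ pa; rewrite /yS (negPf pa).
- by move=> a _ pa; rewrite dS_unpaired // subrr mul0r.
- by rewrite alS_beS invr_neq0 // expf_neq0.
- apply: weights_scalar => //.
  + by move=> a h; rewrite dS_2 // /mirror; lia.
  + by move=> a h; rewrite dS_1 // /mirror; lia.
  + move=> a h; rewrite dS_1 //.
    move: twm mN h; rewrite /twist; case: tw => //= /andP[om oN] mN'.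
    by case: ifP => oa; lia.
  + move=> a h; rewrite dS_2 //.
    move: twm mN h; rewrite /twist; case: tw => //= /andP[om oN] mN'.
    by case: ifP => oa; lia.
  + by move=> a h; rewrite dS_mid // /mirror; lia.
- move=> a aN tw1 pa; rewrite /yS pa.
  have /andP[_ ->] := twist_stable mN twm aN pa.
  by rewrite zt // mulrN.
- by move=> a b _ _ pa pb _; rewrite !dS_unpaired.
Qed.

End Scalar.

Lemma zval_twist (y : 'I_N -> C) a : zval y (twist true a) = - zval y a.
Proof.
rewrite /zval /twist; case: (boolP (odd a)) => oa; last first.
  by have -> : odd a.+1 by clear -oa; lia.
by have -> : odd a.-1 = false by [clear -oa; lia]; rewrite opprK.
Qed.

Lemma zval_mul (y : 'I_N -> C) (P : nat -> bool) c : ~~ odd N ->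
  (forall i : 'I_N, ~~ odd i -> P i -> y i * y (ord_pred (rev_ord i)) = c) ->
  (forall a, (a < N)%N -> odd a -> P a.-1 = P a) ->
  forall a, (a < N)%N -> P a -> zval y a * zval y (twist true (mirror N a)) = c.
Proof.
move=> oN yy Pp a aN Pa.
have predE (k : 'I_N) : ~~ odd k -> ord_pred (rev_ord k) = inord (mirror N k).-1.
  move=> ok; apply: val_inj; have kN := ltn_ord k.
  rewrite /= inordK /mirror /=; last by move: kN; clear; lia.
  have -> : ((n.+1 - k.+1 + n.+1).-1 = (n - k).-1 + n.+1)%N by move: ok oN kN; clear; lia.
  by rewrite modnDr modn_small //; move: kN; clear; lia.
rewrite /zval /twist; case: (boolP (odd a)) => oa.
  have -> : odd (mirror N a) = false by move: oa oN aN; clear; rewrite /mirror /=; lia.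
  have -> : odd (mirror N a).+1 by move: oa oN aN; clear; rewrite /mirror /=; lia.
  have a1 : (a.-1 < N)%N by move: aN; clear; lia.
  have oa1 : ~~ odd (inord a.-1 : 'I_N) by rewrite inordK //; move: oa; clear; lia.
  have := yy (inord a.-1) oa1; rewrite inordK // Pp // => /(_ Pa) <-.
  rewrite mulrNN predE //; congr (_ * y _); apply: val_inj.
  rewrite /= !inordK // /mirror /=; move: aN oa oN; clear; rewrite /=; lia.
have -> : odd (mirror N a) by move: oa oN aN; clear; rewrite /mirror /=; lia.
have -> : odd (mirror N a).-1 = false by move: oa oN aN; clear; rewrite /mirror /=; lia.
have oa1 : ~~ odd (inord a : 'I_N) by rewrite inordK.
by have := yy (inord a) oa1; rewrite predE // inordK // => /(_ Pa).
Qed.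

(** [param_rel] covers the first half of the indices; [i -> i'-1] maps the other half into it, and
    the product is symmetric. *)
Lemma type4_rel (y : 'I_N -> C) : ~~ odd N -> param_rel Type4 q y ->
  forall i : 'I_N, ~~ odd i -> y i * y (ord_pred (rev_ord i)) = - q ^ (- N%:Z + 2).
Proof.
move=> oN rel i oi; case: (ltnP i N./2) => hi; first exact: rel.
set j := ord_pred (rev_ord i).
have iN := ltn_ord i.
have predE (k : 'I_N) : ~~ odd k -> nat_of_ord (ord_pred (rev_ord k)) = (mirror N k).-1.
  move=> ok; rewrite /= /mirror /=; have kN := ltn_ord k.
  have -> : ((n.+1 - k.+1 + n.+1).-1 = (n - k).-1 + n.+1)%N by move: ok oN kN; clear; lia.
  by rewrite modnDr modn_small //; move: kN; clear; lia.
have jE : nat_of_ord j = (mirror N i).-1 by apply: predE.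
have oj : ~~ odd j by rewrite jE; move: oi oN iN; clear; rewrite /mirror /=; lia.
have jh : (j < N./2)%N by rewrite jE; move: oi oN iN hi; clear; rewrite /mirror /=; lia.
have -> : i = ord_pred (rev_ord j).
  apply: val_inj; apply: etrans (esym (predE j oj)).
  by rewrite jE; move: oi oN iN; clear; rewrite /mirror /=; lia.
by rewrite mulrC; apply: rel.
Qed.

Section Monomial.
Variables (al : C) (z : nat -> C) (tw : bool).
Hypothesis al0 : al != 0.
Hypothesis oN : ~~ odd N.
Hypothesis zz : forall a, (a < N)%N -> z a * z (twist tw (mirror N a)) = al * al.
Let h := N./2.

Let h2 : h.*2 = N. Proof. by rewrite /h even_halfK //; apply/negPf. Qed.

Lemma paired_half a : paired N h a.
Proof. by rewrite /paired -{1}h2; clear; case: ltnP => //= e; rewrite -addnn addKn. Qed.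

Lemma monomial_datum g : (tw ==> ~~ odd h) ->
  g <> SL -> (tw -> forall a, (a < N)%N -> z (twist tw a) = - z a) ->
  datum q N h (fun a => twist tw (mirror N a)) (fun=> 0) z al al tw
    (esign C (isSP g)) (pwt q N (isSP g)) (nrm n s (isSP g)).
Proof.
move=> twh gS zt.
have twm : tw ==> ~~ odd h && ~~ odd N by case: tw twh => //= ->.
have spN : isSP g ==> ~~ odd N by rewrite oN implybT.
apply: datum_twist; rewrite ?h2 //.
- by move=> *; rewrite subrr.
- by move=> a aN _; apply: zz.
- by move=> a _; rewrite paired_half.
- by move=> a _; rewrite paired_half.
- by rewrite mulf_neq0.
- by apply: weights_empty; rewrite ?h2 // => *; rewrite subrr.
- by move=> a aN tw1 _; apply: zt.
Qed.

End Monomial.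

(* In type (4) with [N./2] odd, [i |-> sg i] fixes the two central indices, whose
   entries have to be counted as diagonal ones. *)
Section Central.
Variables (al : C) (z : nat -> C) (m : nat).
Hypotheses (al0 : al != 0) (om : ~~ odd m) (m2 : m.+1.*2 = N).
Hypothesis zz : forall a, (a < N)%N -> z a * z (twist true (mirror N a)) = al * al.
Hypothesis zt : forall a, z (twist true a) = - z a.

Definition dC a : C := if paired N m a then 0 else z a.
Definition yC a : C := if paired N m a then z a else 0.

Let mid2 a : (a < N)%N -> ~~ paired N m a -> a = m \/ a = m.+1.
Proof.
move=> aN pa; case: (eqVneq a m) => [->|ne]; [by left | right].
by move: m2 aN pa ne; rewrite /paired; clear; lia.
Qed.

Let pm : ~~ paired N m m.
Proof. by move: m2; rewrite /paired; clear; lia. Qed.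

Let pm1 : ~~ paired N m m.+1.
Proof. by move: m2; rewrite /paired; clear; lia. Qed.

Let dm2 : dC m * dC m = al * al.
Proof.
have mN : (m < N)%N by move: m2; clear; lia.
rewrite /dC (negPf pm) -(zz mN); congr (_ * z _).
have -> : mirror N m = m.+1 by move: m2; rewrite /mirror /=; clear; lia.
by rewrite /twist /= om.
Qed.

Let dm1 : dC m.+1 = - dC m.
Proof. by rewrite /dC (negPf pm) (negPf pm1) -zt /twist (negPf om). Qed.

Let dC_quad a : (a < N)%N -> ~~ paired N m a -> (dC a - al) * (dC a + al) = 0.
Proof.
move=> aN pa; transitivity (dC a * dC a - al * al); first by ring.
by case: (mid2 aN pa) => ->; rewrite ?dm1 ?mulrNN dm2 subrr.
Qed.

Let mN : (m.*2 <= N)%N. Proof. by rewrite -m2; clear; lia. Qed.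
Let oN : ~~ odd N. Proof. by rewrite -m2 odd_double. Qed.

Let d1 a : (a < m)%N -> dC a = al - al.
Proof. by move=> h; rewrite subrr /dC /paired h. Qed.

Let d2 a : (N - m <= a < N)%N -> dC a = 0.
Proof. by move=> /andP[h _]; rewrite /dC /paired h orbT. Qed.

Let yy a : (a < N)%N -> paired N m a -> yC a * yC (twist true (mirror N a)) = al * al.
Proof.
move=> aN pa; rewrite /yC pa.
have twm : true ==> ~~ odd m && ~~ odd N by rewrite om oN.
have /andP[_ ->] := twist_stable mN twm (mirror_lt aN) (etrans (paired_mirror mN aN) pa).
exact: zz.
Qed.

Lemma central_datum g : g = SO ->
  datum q N m (fun a => twist true (mirror N a)) dC yC al al true
    (esign C (isSP g)) (pwt q N (isSP g)) (nrm n s (isSP g)).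
Proof.
move=> gE; have spF : isSP g = false by rewrite gE.
apply: datum_twist; rewrite ?om ?oN ?gE //.
- by move=> a _ pa; rewrite /yC (negPf pa).
- by rewrite mulf_neq0.
- apply: weights_center; rewrite ?om ?oN //.
  + by move=> a h; rewrite d2 // /mirror; move: h mN; clear; rewrite /=; lia.
  + by move=> a h; rewrite d1 // /mirror; move: h mN; clear; rewrite /=; lia.
  + move=> a h; rewrite d1 // /twist.
    by case: ifP => oa; move: oa h om; clear; lia.
  + move=> a h; rewrite d2 // /twist.
    by case: ifP => oa; move: oa h om oN; clear; lia.
  + have -> : mirror N m = m.+1 by move: m2; rewrite /mirror /=; clear; lia.
    by rewrite dm1 mulrNN dm2.
  + have -> : mirror N m = m.+1 by move: m2; rewrite /mirror /=; clear; lia.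
    have -> : mirror N m.+1 = m by move: m2; rewrite /mirror /=; clear; lia.
    by rewrite dm1 opprK.
- move=> a aN _ pa; rewrite /yC pa.
  have twm : true ==> ~~ odd m && ~~ odd N by rewrite om oN.
  have /andP[_ ->] := twist_stable mN twm aN pa.
  exact: zt.
- move=> a b aN bN pa pb; case: (mid2 aN pa) => ->; case: (mid2 bN pb) => -> //.
    have -> : mirror N m = m.+1 by move: m2; rewrite /mirror /=; clear; lia.
    by rewrite eqxx.
  have -> : mirror N m.+1 = m by move: m2; rewrite /mirror /=; clear; lia.
  by rewrite eqxx.
Qed.

End Central.

Lemma type3_entries (y : 'I_N -> C) :
  entries (Amx Type3 q y) (fun a => twist false (mirror N a)) (fun=> 0) (fun a => y (inord a)).
Proof.
split=> [i j | i iN]; last by left; rewrite /twist mirror_lt.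
by rewrite /Amx y_part_entries /= mul0rn add0r inord_val.
Qed.

Lemma type4_entriesE (y : 'I_N -> C) i j : ~~ odd N ->
  Amx Type4 q y i j = zval y i *+ (nat_of_ord j == twist true (mirror N i)).
Proof.
move=> oN; rewrite /Amx (@z_part_entries _ _ _ N./2) ?paired_half //.
- by rewrite even_halfK ?eqxx ?orbT //; apply/negPf.
- by rewrite even_halfK //; apply/negPf.
- by move=> k; rewrite paired_half // andbT.
Qed.

Lemma type4_entries_even (y : 'I_N -> C) : ~~ odd N ->
  entries (Amx Type4 q y) (fun a => twist true (mirror N a)) (fun=> 0) (zval y).
Proof.
move=> oN; split=> [i j | i iN]; last first.
  by left; move: oN iN; rewrite /twist /mirror; clear; case: ifP; rewrite /=; lia.
by rewrite type4_entriesE // mul0rn add0r.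
Qed.

Lemma type4_entries_odd (y : 'I_N -> C) m : ~~ odd m -> m.+1.*2 = N ->
  entries (Amx Type4 q y) (fun a => twist true (mirror N a)) (dC (zval y) m) (yC (zval y) m).
Proof.
move=> om m2; have oN : ~~ odd N by rewrite -m2 odd_double.
split=> [i j | i iN]; last first.
  by left; move: oN iN; rewrite /twist /mirror; clear; case: ifP; rewrite /=; lia.
rewrite type4_entriesE // /dC /yC; case: ifP => pi; first by rewrite mul0rn add0r.
rewrite mul0rn addr0; congr (_ *+ _).
have -> : twist true (mirror N i) = i; last by [].
have iN := ltn_ord i; move: pi iN om m2; rewrite /paired /twist /mirror; clear.
by case: ifP; rewrite /=; lia.
Qed.

End Types.

(** * Quadratic relation and q-trace *)

Section Quadratic.
Variables (C : fieldType) (n : nat).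
Local Notation N := n.+1.
Variables (m : nat) (sg : nat -> nat) (d y : nat -> C) (al be : C) (A : 'M[C]_N).
Hypotheses (Aent : entries A sg d y) (sh : shape N m sg d y al be).

Lemma row_sum (i : 'I_N) (F : 'I_N -> C) :
  \sum_j A i j * F j = d i * F i + y i * F (inord (sg i)).
Proof.
have [AE sgN] := Aent.
under eq_bigr => j _ do rewrite AE mulrDl.
rewrite big_split /=; congr (_ + _).
  by rewrite (bigD1 i) //= eqxx big1 ?addr0 // => j ne; rewrite (negPf ne) mul0r.
case: (sgN i (ltn_ord i)) => [h | ->]; last by rewrite mul0r big1 // => j _; rewrite mul0rn mul0r.
rewrite (bigD1 (inord (sg i))) //= inordK // eqxx big1 ?addr0 // => j ne.
case: eqP => [e|]; last by rewrite mul0r.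
by move: ne; rewrite -e inord_val eqxx.
Qed.

Lemma entry_diag (i : 'I_N) : A i i = d i.
Proof.
have [AE _] := Aent; rewrite AE eqxx; case: eqP => [e|]; last by rewrite addr0.
case: (boolP (paired N m i)) => pi; last by rewrite (sh_y0 sh) // mul0rn addr0.
have iN := ltn_ord i; have mN := sh_m sh.
case: (paired_cases iN pi) => h; first by have := sh_12 sh h; rewrite -e; lia.
by have := sh_21 sh h; rewrite -e; lia.
Qed.

Lemma shape_quadratic : A *m A = (al - be) *: A + (al * be)%:M.
Proof.
have [AE sgN] := Aent.
apply/matrixP => i k; rewrite mxE row_sum addmxE scalemxE [in RHS]mxE.
have iN := ltn_ord i; have mN := sh_m sh.
case: (boolP (paired N m i)) => pi; last first.
  rewrite (sh_y0 sh iN pi) mul0r addr0 AE (sh_y0 sh iN pi) mul0rn addr0 [k == i]eq_sym.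
  case: eqP => _; last by rewrite !mulr0n !mulr0 addr0.
  rewrite !mulr1n; apply/eqP; rewrite -subr_eq0; apply/eqP.
  by rewrite -[RHS](sh_dm sh iN pi); ring.
have sN : (sg i < N)%N by apply: (sg_ltN sh).
have ks : (k == inord (sg i)) = (nat_of_ord k == sg i) by rewrite -(inj_eq val_inj) /= inordK.
rewrite !AE ks !inordK // (sh_inv sh iN pi).
rewrite -[nat_of_ord k == i]/(k == i) [i == k]eq_sym.
have [dd ds] : d i * d i = (al - be) * d i /\ d i + d (sg i) = al - be.
  case: (paired_cases iN pi) => h.
    by rewrite (sh_d1 sh h) (sh_d2 sh (sh_12 sh h)) addr0.
  by rewrite (sh_d2 sh h) (sh_d1 sh (sh_21 sh h)) add0r !mulr0.
have yy := sh_y sh iN pi.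
rewrite !mulrDr !mulrnAr dd yy.
transitivity ((al - be) * d i *+ (k == i) + (al * be) *+ (k == i)
   + y i * (d i + d (sg i)) *+ (nat_of_ord k == sg i)); last by rewrite ds; ring.
by rewrite mulrDr mulrnDl (mulrC (d i) (y i)); ring.
Qed.

(** Both orders are stated because the overall sign decides which factor becomes [A + q^-P]. *)
Lemma shape_factor : (A - al%:M) *m (A + be%:M) = 0 /\ (A + be%:M) *m (A - al%:M) = 0.
Proof.
rewrite !mulmxDl !mulmxDr !mulNmx !mulmxN shape_quadratic !mul_mx_scalar !mul_scalar_mx.
have e : al *: be%:M = (al * be)%:M :> 'M[C]_N by rewrite scale_scalar_mx.
have e' : be *: al%:M = (al * be)%:M :> 'M[C]_N by rewrite scale_scalar_mx mulrC.
by split; rewrite ?e ?e' scalerBl; apply/matrixP => i j; rewrite !mxE; ring.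
Qed.

End Quadratic.

Section Trace.
Variables (C : fieldType) (n : nat) (s : C).
Local Notation N := n.+1.
Hypothesis s0 : s != 0.
Let q := s ^+ 2.
Let lam := q - q^-1.
Let q0 : q != 0. Proof. by rewrite expf_neq0. Qed.

(** Up to reversal of the index the q-trace is the sum of [dp] with weights [p]. The first block
    contributes nothing, the middle one [w_sum], the last one a geometric sum, and the terms in the
    weight at [N - m] cancel. *)
Lemma qtrace_datum g (A : 'M[C]_N) m sg d y al be tw : g <> SL -> (isSP g ==> ~~ odd N) ->
  entries A sg d y ->
  datum q N m sg d y al be tw (esign C (isSP g)) (pwt q N (isSP g)) (nrm n s (isSP g)) ->
  lam * qtrace g q A =
  (al - be) * (esign C (isSP g) * (if tw then - q^-1 else q) + q^-1 * pwt q N (isSP g) N).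
Proof.
move=> gS spN Aent D; have sh := dm_sh D; have W := dm_W D; have mN := sh_m sh.
have -> : qtrace g q A = psum (pwt q N (isSP g)) (fun a => d (mirror N a)) 0 N.
  rewrite /psum big_nat_rev /= big_mkord /qtrace; apply: eq_bigr => i _.
  have iN := ltn_ord i.
  have -> : (0 + N - i.+1 = mirror N i)%N by rewrite /mirror /=; clear; lia.
  rewrite mirrorK // (entry_diag Aent sh); congr (_ * _).
  by rewrite (two_rhoE s0) // /pwt neg_2rho_mirror.
rewrite (@psum_cat _ _ _ 0 m) 1?(@psum_cat _ _ _ m (N - m) N) ?mulrDr; try lia.
rewrite psum0; last by move=> j hj; rewrite (w_dp1 W).
rewrite mulr0 add0r (w_sum W).
have -> : psum (pwt q N (isSP g)) (fun a => d (mirror N a)) (N - m) N =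
    psum (pwt q N (isSP g)) (fun=> (al - be) * 1) (N - m) N.
  by apply: psum_ext => j hj; rewrite (w_dp2 W) // mulr1.
rewrite psumZ mulrCA.
have -> : lam * psum (pwt q N (isSP g)) (fun=> 1) (N - m) N =
   q^-1 * (pwt q N (isSP g) N - pwt q N (isSP g) (N - m)%N).
  by apply: (psum_const2 q0 (w_m W) (w_tw W) (w_p2 W)); rewrite leqnn leq_subr.
by ring.
Qed.

Lemma geometric_sum k : lam * \sum_(0 <= i < k) q ^ (N.+1%:Z - i.+1.*2%:Z) =
  q ^ N%:Z - q ^ (N%:Z - k.*2%:Z).
Proof.
elim: k => [|k IHk]; first by rewrite big_geq // subr0 mulr0 subrr.
rewrite big_nat_recr //= mulrDr IHk.
have -> : N.+1%:Z - k.+1.*2%:Z = (N%:Z - k.*2%:Z) - 1 by lia.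
have -> : N%:Z - k.+1.*2%:Z = (N%:Z - k.*2%:Z) - 2 by lia.
rewrite !expfzDr // /lam -[q ^ (- 1)]/(q^-1) -[q ^ (- 2)]/((q ^+ 2)^-1).
by field.
Qed.

Lemma qtrace_SL (A : 'M[C]_N) m sg y al be : (m.*2 <= N)%N ->
  entries A sg (dS n m al be) y -> shape N m sg (dS n m al be) y al be ->
  lam * qtrace SL q A = (al - be) * q ^ N%:Z + be * q ^ (N%:Z - m.*2%:Z) - al * q ^ (m.*2%:Z - N%:Z).
Proof.
move=> mN Aent sh.
pose G i := q ^ (N.+1%:Z - i.+1.*2%:Z).
have -> : qtrace SL q A = \sum_(0 <= i < N) G i * dS n m al be i.
  by rewrite big_mkord /qtrace; apply: eq_bigr => i _; rewrite (entry_diag Aent sh).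
rewrite (@big_cat_nat _ _ _ m) //=; last by lia.
rewrite (@big_cat_nat _ _ _ (N - m) m N) //=; try lia.
have -> : \sum_(0 <= i < m) G i * dS n m al be i = (al - be) * \sum_(0 <= i < m) G i.
  by rewrite mulr_sumr; apply: eq_big_nat => i h; rewrite dS_1 // mulrC.
have -> : \sum_(m <= i < N - m) G i * dS n m al be i = al * \sum_(m <= i < N - m) G i.
  by rewrite mulr_sumr; apply: eq_big_nat => i h; rewrite dS_mid // mulrC.
have -> : \sum_(N - m <= i < N) G i * dS n m al be i = 0.
  by rewrite big_nat big1 // => i h; rewrite dS_2 ?mulr0.
have e1 := geometric_sum m.
have e2 := geometric_sum (N - m).
rewrite (@big_cat_nat _ _ _ m) //= in e2; last by lia.
have e3 : N%:Z - (N - m).*2%:Z = m.*2%:Z - N%:Z by lia.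
rewrite e3 mulrDr e1 in e2.
rewrite addr0 mulrDr !(mulrCA lam) e1.
have -> : lam * \sum_(m <= i < N - m) G i = q ^ (N%:Z - m.*2%:Z) - q ^ (m.*2%:Z - N%:Z).
  by apply: (addrI (q ^ N%:Z - q ^ (N%:Z - m.*2%:Z))); rewrite e2; ring.
by ring.
Qed.

End Trace.

(** The roots of the characteristic polynomial are [1] and [-1]; their number and their sum, the
    trace, determine how often each occurs. *)
Lemma mup_involution (C : numClosedFieldType) n (A : 'M[C]_n.+1) (a b : nat) :
  A *m A = 1%:M -> \tr A = a%:R - b%:R -> (a + b = n.+1)%N ->
  mup 1 (char_poly A) = a /\ mup (-1) (char_poly A) = b.
Proof.
move=> A2 trA ab.
have [rs rsE] := closed_field_poly_normal (char_poly A).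
rewrite (monicP (char_poly_monic A)) scale1r in rsE.
have szrs : size rs = n.+1.
  have := size_char_poly A; rewrite rsE size_prod_XsubC; exact: succn_inj.
have sumrs : \sum_(x <- rs) x = a%:R - b%:R.
  rewrite -trA; apply: oppr_inj; rewrite -char_poly_trace // rsE -szrs.
  by rewrite coefPn_prod_XsubC // szrs.
have pm x : x \in rs -> x = 1 \/ x = -1.
  move=> xrs; have : root (char_poly A) x by rewrite rsE root_prod_XsubC.
  rewrite -eigenvalue_root_char => /eigenvalueP[v vA v0].
  have /eqP : (x ^+ 2 - 1) *: v = 0.
    rewrite scalerBl scale1r expr2 -scalerA -vA.
    by rewrite scalemxAl -vA -mulmxA A2 mulmx1 subrr.
  rewrite scaler_eq0 (negPf v0) orbF subr_eq0 sqrf_eq1.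
  by case/orP => /eqP; [left | right].
have n1 : (1 : C) != -1.
  by rewrite -subr_eq0 opprK -[1 + 1]/(2%:R) pnatr_eq0.
pose cp (r : seq C) := count_mem (1 : C) r.
pose cm (r : seq C) := count_mem (- 1 : C) r.
have cnt : (cp rs + cm rs)%N = n.+1 /\ \sum_(x <- rs) x = (cp rs)%:R - (cm rs)%:R.
  rewrite -szrs; elim: rs pm {rsE szrs sumrs} => [|x rs IH] pm.
    by rewrite /cp /cm big_nil /= subrr.
  have [|e1 e2] := IH; first by move=> z zrs; apply: pm; rewrite inE zrs orbT.
  rewrite /cp /cm in e1 e2 *.
  rewrite big_cons /= e2; case: (pm x); rewrite ?inE ?eqxx // => ->.
    by rewrite eqxx (negPf n1) add0n; split; [rewrite -e1 | rewrite natrD mulr1n; ring].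
  by rewrite eqxx eq_sym (negPf n1) add0n; split; [rewrite -e1 -addnS | rewrite natrD mulr1n; ring].
rewrite rsE !mu_prod_XsubC -/(cp rs) -/(cm rs).
case: cnt => c1 c2.
(* Number plus sum of the roots counts the root [1] twice; characteristic zero brings the equality
   back to [nat]. *)
have : (2 * cp rs)%:R = (2 * a)%:R :> C.
  have e : (n.+1)%:R + \sum_(x <- rs) x = (n.+1)%:R + (a%:R - b%:R) :> C by rewrite sumrs.
  rewrite {1}c2 -{1}c1 -ab !natrD in e.
  rewrite !natrM; transitivity ((cp rs)%:R + (cm rs)%:R + ((cp rs)%:R - (cm rs)%:R) : C); first by ring.
  by rewrite e; ring.
by move/eqP; rewrite eqr_nat => /eqP e; lia.
Qed.

(** * Limits *)

Section Limits.
Variables (K : numFieldType) (T : Type) (F : set_system T).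
Hypothesis FF : ProperFilter F.

Lemma cvg_entry n (f : T -> 'M[K]_n) (A : 'M[K]_n) i j :
  f x @[x --> F] --> A -> f x i j @[x --> F] --> A i j.
Proof. by move=> h; apply: (cvg_comp _ _ h (@coord_continuous K n n i j A)). Qed.

Lemma cvg_bigsum (I : Type) (r : seq I) (P : pred I) (f : I -> T -> K) (l : I -> K) :
  (forall i, f i x @[x --> F] --> l i) ->
  \sum_(i <- r | P i) f i x @[x --> F] --> \sum_(i <- r | P i) l i.
Proof.
move=> h; elim: r => [|a r IH].
  rewrite big_nil; under eq_cvg do rewrite big_nil; exact: cvg_cst.
rewrite big_cons; under eq_cvg do rewrite big_cons.
by case: ifP => // _; apply: cvgD.
Qed.

Lemma cvg_pow (f : T -> K) (l : K) k : f x @[x --> F] --> l -> f x ^+ k @[x --> F] --> l ^+ k.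
Proof.
move=> h; elim: k => [|k IH]; first by rewrite expr0; exact: cvg_cst.
by rewrite exprS; under eq_cvg do rewrite exprS; apply: cvgM.
Qed.

Lemma cvg_pow1 (f : T -> K) k : f x @[x --> F] --> (1 : K) -> f x ^+ k @[x --> F] --> (1 : K).
Proof. by move=> /(@cvg_pow _ _ k); rewrite expr1n. Qed.

Lemma cvg_inv1 (f : T -> K) k : f x @[x --> F] --> (1 : K) -> f x ^- k @[x --> F] --> (1 : K).
Proof. by move=> /cvg_pow1-/(_ k) h; rewrite -[X in _ --> X]invr1; apply: cvgV => //; rewrite oner_neq0. Qed.

Lemma cvg_muln (f : T -> K) (l : K) k : f x @[x --> F] --> l -> f x *+ k @[x --> F] --> l *+ k.
Proof.
move=> h; elim: k => [|k IH]; first by rewrite mulr0n; under eq_cvg do rewrite mulr0n; exact: cvg_cst.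
by rewrite mulrS; under eq_cvg do rewrite mulrS; apply: cvgD.
Qed.

Lemma cvg_eq_near (f g : T -> K) (a b : K) :
  f x @[x --> F] --> a -> g x @[x --> F] --> b -> F [set x | f x = g x] -> a = b.
Proof.
move=> fa gb e.
have ga : g x @[x --> F] --> a.
  apply: cvg_trans fa; apply: near_eq_cvg; apply: filterS e => x /= ->; exact: erefl.
exact: (cvg_unique _ ga gb).
Qed.

End Limits.

(** Real numbers slightly above [1] are generic, since their powers exceed [1]. *)
Lemma near_one_proper (R : realType) : ProperFilter (near_one R).
Proof.
apply: within_nbhs_proper => B /nbhs_ballP[e /= e0 eB].
have e2 : 0 < e / 2 by rewrite divr_gt0.
exists (1 + e / 2); split; last first.
  apply: eB; rewrite /ball /= opprD addrA subrr sub0r normrN gtr0_norm //.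
  by rewrite ltr_pdivrMr // ltr_pMr // ltr1n.
split; first by rewrite gt_eqF // addr_gt0.
by move=> k k0; rewrite gt_eqF // exprn_egt1 -?lt0n // ltrDl.
Qed.

(** * Types (1) and (2) as instances of the abstract data *)

Section ScalarFamilies.
Variables (C : fieldType) (n : nat) (s : C).
Local Notation N := n.+1.
Hypothesis s0 : s != 0.
Let q := s ^+ 2.
Let q0 : q != 0. Proof. by rewrite expf_neq0. Qed.
Variables (g : lie_type) (m : nat) (neg : bool) (t : mx_family) (y : 'I_N -> C).
Hypotheses (tE : t = Type1 m neg \/ t = Type2 m neg) (ht : family_ok g N t) (hg : simple_type g N).
Hypothesis y_rel : param_rel t q y.
Let al := alS s neg m.
Let be := beS n s neg m.
Let sg a := twist (isSP g) (mirror N a).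

(** Type (1) belongs to sl(N) and so(N), type (2) to sp(N), so [isSP g] also decides the twist. *)
Lemma scalar_family : (m.*2 <= N)%N /\
  exists yv, [/\ entries (Amx t q y) sg (dS n m al be) yv,
    shape N m sg (dS n m al be) yv al be &
    g <> SL -> datum q N m sg (dS n m al be) yv al be (isSP g)
      (esign C (isSP g)) (pwt q N (isSP g)) (nrm n s (isSP g))].
Proof.
case: tE => e; subst t; move: ht y_rel => /=.
  move=> [hgg mN] rel; split=> //.
  have twm : false ==> ~~ odd m && ~~ odd N by [].
  have zz a : (a < N)%N -> paired N m a ->
      y (inord a) * y (inord (twist false (mirror N a))) = q ^- N.
    move=> aN pa; rewrite /twist.
    have -> : inord (mirror N a) = rev_ord (inord a : 'I_N).
      by apply: val_inj; rewrite /= !inordK // /mirror /= ltnS leq_subr.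
    apply: rel; rewrite paired_ord ?inordK //; move: mN; clear; lia.
  have sF : isSP g = false by case: hgg => ->.
  exists (yS n m neg (fun a => y (inord a))); rewrite /sg sF; split.
  - exact: type1_entries.
  - exact: (scalar_shape s0 neg mN twm zz).
  - move=> gS; have spN : isSP g ==> ~~ odd N by rewrite sF.
    by have := scalar_datum s0 neg mN twm zz gS spN (esym sF); rewrite sF; apply.
move=> [gE om mN] rel; split=> //.
have oN : ~~ odd N by move: hg; rewrite gE => /andP[].
have twm : true ==> ~~ odd m && ~~ odd N by rewrite om oN.
have zz a : (a < N)%N -> paired N m a -> zval y a * zval y (twist true (mirror N a)) = q ^- N.
  apply: (zval_mul oN).
    move=> i oi pi; apply: rel; rewrite oi /= paired_ord //; move: mN; clear; lia.
  by move=> b bN ob; move: om oN mN bN ob; rewrite /paired; clear; lia.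
have sT : isSP g = true by rewrite gE.
exists (yS n m neg (zval y)); rewrite /sg sT; split.
- exact: type2_entries.
- exact: (scalar_shape s0 neg mN twm zz).
- move=> gS; have spN : isSP g ==> ~~ odd N by rewrite oN implybT.
  have := scalar_datum s0 neg mN twm zz gS spN (esym sT); rewrite sT; apply.
  by move=> _ a _ _; apply: zval_twist.
Qed.

End ScalarFamilies.

Section TraceValues.
Variables (C : fieldType) (n : nat) (s : C).
Local Notation N := n.+1.
Hypothesis s0 : s != 0.
Let q := s ^+ 2.
Let q0 : q != 0. Proof. by rewrite expf_neq0. Qed.
Let lam := q - q^-1.
Hypothesis lam0 : lam != 0.

Lemma qintM z : lam * qint q z = q ^ z - (q ^ z)^-1.
Proof. by rewrite /qint invr_expz mulrC divfK. Qed.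

(** One identity for the three q-traces: [k] is [0] for sl(N), [1] for so(N) and [-1] for sp(N). *)
Lemma qint_diff (neg : bool) m k x : (m <= N)%N ->
  lam * x = (alS s neg m - beS n s neg m) * (q ^ k * (1 + q ^ N%:Z * (q ^ k * q ^ k)^-1)) ->
  let PM := if neg then (m, N - m)%N else (N - m, m)%N in
  x = qint q (PM.1%:Z - k) - qint q (PM.2%:Z - k).
Proof.
move=> mN xE PM; apply: (mulfI lam0); rewrite mulrBr !qintM {}xE /beS /alS.
have X0 : q ^+ m != 0 by rewrite expf_neq0.
have Y0 : q ^ N%:Z != 0 by rewrite expfz_neq0.
have K0 : q ^ k != 0 by rewrite expfz_neq0.
have e : ((N - m)%N%:Z = N%:Z - m%:Z) by rewrite subzn.
have e2 : m.*2%:Z = m%:Z + m%:Z by rewrite -addnn PoszD.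
rewrite {}/PM e2; case: neg => /=; rewrite ?expr0 ?expr1 ?e !expfzDr // -?invr_expz !exprnP;
  move: X0 Y0 K0; rewrite exprnP; move: (q ^ m%:Z) (q ^ N%:Z) (q ^ k) => X Y Z X0 Y0 Z0;
  by field; rewrite X0 Y0 Z0.
Qed.

End TraceValues.

Lemma generic_pow (C : fieldType) (q : C) k : generic_q C q -> (0 < k)%N ->
  q ^+ k != 1 /\ q ^+ k != -1.
Proof.
case=> _ h k0; split; first exact: h.
apply/eqP => e; have := h (k * 2)%N; rewrite muln_gt0 k0 => /(_ isT).
by rewrite exprM e sqrrN expr1n eqxx.
Qed.

Lemma generic_lam (C : fieldType) (q : C) : generic_q C q -> q - q^-1 != 0.
Proof.
move=> gq; have [q0 _] := gq; have [h _] := generic_pow gq (isT : (0 < 2)%N).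
apply: contra_neq h => e; transitivity (1 + q * (q - q^-1)); first by field.
by rewrite e mulr0 addr0.
Qed.

(* [q] and [- q^-1] are the eigenvalues of the Hecke braiding. *)
Lemma trivial_eigenvalue (C : fieldType) (q c : C) g N :
  generic_q C q -> simple_type g N -> g <> SL ->
  c = (eps_sign g)%:~R * q ^ (- N%:Z + eps_sign g) ->
  (c - q) * (c + q^-1) != 0.
Proof.
move=> gq hg gS cD; have [q0 _] := gq.
rewrite mulf_eq0 negb_or.
have [gE|gE] : g = SO \/ g = SP by case: (g) gS; [| left | right].
all: subst g.
- case: N hg cD => [|[|[|N'']]] // _ cD; set N' := N''.+1.
  have cE : c = (q ^+ N'.+1)^-1.
    rewrite cD mul1r; have -> : - N'.+2%:Z + eps_sign SO = - N'.+1%:Z by rewrite /=; lia.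
    by rewrite -invr_expz.
  have X0 : q ^+ N'' != 0 by rewrite expf_neq0.
  rewrite cE; apply/andP; split.
    have [h _] := generic_pow gq (isT : (0 < N'.+2)%N).
    apply: contra_neq h => e.
    transitivity (1 - q ^+ N'.+1 * ((q ^+ N'.+1)^-1 - q)); last by rewrite e mulr0 subr0.
    by rewrite !exprS; field; rewrite q0 X0.
  have [_ h] := generic_pow gq (isT : (0 < N')%N).
  apply: contra_neq h => e.
  transitivity (q ^+ N'.+1 * ((q ^+ N'.+1)^-1 + q^-1) - 1); last by rewrite e mulr0 sub0r.
  by rewrite !exprS; field; rewrite q0 X0.
- have N0 : (0 < N)%N by case: (N) hg.
  have cE : c = - (q ^+ N.+1)^-1.
    rewrite cD mulN1r; have -> : - N%:Z + eps_sign SP = - N.+1%:Z by rewrite /=; lia.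
    by rewrite -invr_expz.
  have X0 : q ^+ N != 0 by rewrite expf_neq0.
  rewrite cE; apply/andP; split.
    have [_ h] := generic_pow gq (isT : (0 < N.+2)%N).
    apply: contra_neq h => e.
    transitivity (- 1 - q ^+ N.+1 * (- (q ^+ N.+1)^-1 - q)); last by rewrite e mulr0 subr0.
    by rewrite !exprS; field; rewrite q0 X0.
  have [h _] := generic_pow gq N0.
  apply: contra_neq h => e.
  transitivity (q ^+ N.+1 * (- (q ^+ N.+1)^-1 + q^-1) + 1); last by rewrite e mulr0 add0r.
  by rewrite !exprS; field; rewrite q0 X0.
Qed.

(** * Types (3) and (4) as instances of the abstract data *)

Section MonomialFamilies.
Variables (C : fieldType) (n : nat) (s : C).
Local Notation N := n.+1.
Hypothesis s0 : s != 0.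
Let q := s ^+ 2.
Let q0 : q != 0. Proof. by rewrite expf_neq0. Qed.

Lemma monomial_family (g : lie_type) (t : mx_family) (y : 'I_N -> C) (al : C) :
  t = Type3 \/ t = Type4 -> family_ok g N t -> simple_type g N -> param_rel t q y ->
  al * al = - q ^ (- N%:Z + eps_sign g + eps_sign g) ->
  exists m sg d yv tw, [/\ entries (Amx t q y) sg d yv,
    datum q N m sg d yv al al tw (esign C (isSP g)) (pwt q N (isSP g)) (nrm n s (isSP g)) &
    al * al * (if tw then - q^-1 else q) = (eps_sign g)%:~R * q ^ (- N%:Z + eps_sign g)].
Proof.
move=> tE ht hg rel al2.
have al0 : al != 0.
  suff : al * al != 0 by rewrite mulf_eq0 orbb.
  by rewrite al2 oppr_eq0 expfz_neq0.
case: tE => e; subst t; move: ht rel => /=.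
  move=> gE rel; subst g; have oN : ~~ odd N by move: hg => /andP[].
  have zz a : (a < N)%N -> y (inord a) * y (inord (twist false (mirror N a))) = al * al.
    move=> aN; rewrite /twist.
    have -> : inord (mirror N a) = rev_ord (inord a : 'I_N).
      by apply: val_inj; rewrite /= !inordK // /mirror /= ltnS leq_subr.
    by rewrite rel // al2; congr (- (_ ^ _)); rewrite /=; lia.
  exists N./2, (fun a => twist false (mirror N a)), (fun=> 0), (fun a => y (inord a)), false; split.
  - exact: type3_entries.
  - exact: (monomial_datum s0 al0 oN zz).
  - rewrite al2 mulN1r mulNr; congr (- _).
    by rewrite -[X in _ * X]expr1z -expfzDr //; congr (_ ^ _); rewrite /=; lia.
move=> [gE oN] rel; subst g.
have zz a : (a < N)%N -> zval y a * zval y (twist true (mirror N a)) = al * al.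
  move=> aN; apply: (@zval_mul _ _ y (fun=> true)) => // i oi _.
  by rewrite (type4_rel oN rel oi) al2; congr (- (_ ^ _)); rewrite /=; lia.
have ceq : al * al * (- q^-1) = (eps_sign SO)%:~R * q ^ (- N%:Z + eps_sign SO).
  rewrite al2 mulrNN mul1r -[q^-1]/(q ^ (- 1)) -expfzDr //.
  by congr (_ ^ _); rewrite /=; lia.
case: (boolP (odd N./2)) => oh.
  have m2 : (N./2).-1.+1.*2 = N.
    have -> : (N./2).-1.+1 = N./2 by case: (N./2) oh.
    by rewrite even_halfK //; apply/negPf.
  have om : ~~ odd (N./2).-1 by move: oh; clear; case: (N./2) => //= k; rewrite negbK.
  exists (N./2).-1, (fun a => twist true (mirror N a)), (dC n (zval y) (N./2).-1),
    (yC n (zval y) (N./2).-1), true; split=> //.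
  - exact: type4_entries_odd.
  - exact: (central_datum s0 al0 om m2 zz (zval_twist y)).
exists N./2, (fun a => twist true (mirror N a)), (fun=> 0), (zval y), true; split=> //.
- exact: type4_entries_even.
- by apply: (monomial_datum s0 al0 oN zz) => // _ a _; apply: zval_twist.
Qed.

End MonomialFamilies.

(** * Eigenvalue multiplicities of the limit matrix *)

Section Limit.
Variables (R : realType) (g : lie_type) (n : nat) (t : mx_family).
Local Notation N := n.+1.
Variables (y : 'I_N -> Cplx R -> Cplx R) (A0 : 'M[Cplx R]_N) (m : nat) (neg : bool).
Hypotheses (hg : simple_type g N) (ht : family_ok g N t).
Hypothesis y_rel : forall q : Cplx R, generic_q (Cplx R) q ->
  param_rel t q (fun i : 'I_N => y i q).
Hypothesis A_lim : Amx t q (fun i : 'I_N => y i q) @[q --> near_one R] --> A0.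
Hypothesis tE : t = Type1 m neg \/ t = Type2 m neg.
Let A q := Amx t q (fun i : 'I_N => y i q).
Let sgn : Cplx R := (-1) ^+ neg.
Let al (q : Cplx R) := sgn * q ^- m.
Let be (q : Cplx R) := sgn * q ^- m * q ^- (N - m.*2).

Lemma family_at q : generic_q (Cplx R) q ->
  [/\ (m.*2 <= N)%N,
    A q *m A q = (al q - be q) *: A q + (q ^- N)%:M &
    \tr (A q) = (al q - be q) *+ m + al q *+ (N - m.*2)].
Proof.
move=> gq; have [q0 _] := gq.
(* The abstract data are built from a square root of [q]; the relations to be passed to the limit
   involve [q] alone, so any root will do. *)
set s := sqrtC q; have sq : s ^+ 2 = q by rewrite sqrtCK.
have s0 : s != 0 by apply: contra_neq q0 => e; rewrite -sq e expr0n.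
have rel := y_rel gq; rewrite -sq in rel.
have [mN [yv [ent sh _]]] := scalar_family s0 tE ht hg rel.
have alE : alS s neg m = al q by rewrite /alS sq.
have beE : beS n s neg m = be q.
  rewrite /beS /alS sq /be -/sgn; congr (_ * _).
  by rewrite exprnN; congr (_ ^ _); move: mN; clear; lia.
rewrite sq in ent; rewrite alE beE in ent sh; split=> //.
  have ab : al q * be q = q ^- N by rewrite -alE -beE alS_beS // sq.
  by rewrite -ab; apply: (shape_quadratic ent sh).
rewrite /mxtrace.
rewrite (eq_bigr (fun i : 'I_N => dS n m (al q) (be q) i)); last first.
  by move=> i _; apply: (entry_diag ent sh).
rewrite -(big_mkord xpredT (dS n m (al q) (be q))) /=.
rewrite (@big_cat_nat _ _ _ m) //=; last by move: mN; clear; lia.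
rewrite (@big_cat_nat _ _ _ (N - m) m N) //=; [| move: mN; clear; lia | exact: leq_subr].
rewrite [X in _ + (_ + X)]big_nat [X in _ + (_ + X)]big1; last by move=> i h; rewrite dS_2.
have -> : \sum_(0 <= i < m) dS n m (al q) (be q) i = (al q - be q) *+ m.
  under eq_big_nat => i h do rewrite dS_1 //.
  by rewrite sumr_const_nat subn0.
have -> : \sum_(m <= i < N - m) dS n m (al q) (be q) i = al q *+ (N - m.*2).
  under eq_big_nat => i h do rewrite dS_mid //.
  by rewrite sumr_const_nat; congr (_ *+ _); clear; lia.
by rewrite addr0.
Qed.

Let FF : ProperFilter (near_one R) := near_one_proper R.

Let id_lim : (q : Cplx R) @[q --> near_one R] --> (1 : Cplx R).
Proof. exact: cvg_within. Qed.

Let al_lim : al q @[q --> near_one R] --> sgn.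
Proof.
rewrite -[X in _ --> X]mulr1; apply: cvgM; first exact: cvg_cst.
exact: (cvg_inv1 FF m id_lim).
Qed.

Let be_lim : be q @[q --> near_one R] --> sgn.
Proof.
rewrite -[X in _ --> X]mulr1; apply: cvgM; first exact: al_lim.
exact: (cvg_inv1 FF _ id_lim).
Qed.

Let ab_lim : al q - be q @[q --> near_one R] --> sgn - sgn.
Proof. exact: (cvgB al_lim be_lim). Qed.

Lemma near_generic (P : Cplx R -> Prop) :
  (forall q, generic_q (Cplx R) q -> P q) -> near_one R [set q | P q].
Proof. by move=> h; apply: (filterS h); apply: withinT. Qed.

Let entry_lim i j : A q i j @[q --> near_one R] --> A0 i j.
Proof. exact (@cvg_entry (Cplx R) (Cplx R) (near_one R) N A A0 i j A_lim). Qed.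

(** [al] and [be] have the same limit [sgn], so the linear term of the quadratic relation disappears
    while [q ^- N] tends to [1]. *)
Lemma limit_involution : A0 *m A0 = 1%:M.
Proof.
apply/matrixP => i j.
have L : \sum_k A q i k * A q k j @[q --> near_one R] --> \sum_k A0 i k * A0 k j.
  apply: (@cvg_bigsum (Cplx R) _ _ FF _ _ _ (fun k q => A q i k * A q k j)
    (fun k => A0 i k * A0 k j)) => k.
  by apply: cvgM; [exact: (@entry_lim i k) | exact: (@entry_lim k j)].
have Rr : (al q - be q) * A q i j + q ^- N *+ (i == j) @[q --> near_one R] -->
   (sgn - sgn) * A0 i j + 1 *+ (i == j).
  have h1 : (al q - be q) * A q i j @[q --> near_one R] --> (sgn - sgn) * A0 i j.
    exact: (cvgM ab_lim (@entry_lim i j)).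
  have h2 := cvg_muln FF (k := (i == j : nat)) (cvg_inv1 FF N id_lim).
  exact: (cvgD h1 h2).
rewrite mxE (cvg_eq_near FF L Rr); first by rewrite subrr mul0r add0r !mxE.
apply: near_generic => q gq; have [_ e _] := family_at gq.
by move/matrixP: e => /(_ i j); rewrite !mxE.
Qed.

Lemma limit_trace : \tr A0 = sgn *+ (N - m.*2).
Proof.
have L : \sum_i A q i i @[q --> near_one R] --> \sum_i A0 i i.
  apply: (@cvg_bigsum (Cplx R) _ _ FF _ _ _ (fun k q => A q k k) (fun k => A0 k k)) => k.
  exact: (@entry_lim k k).
have Rr : (al q - be q) *+ m + al q *+ (N - m.*2) @[q --> near_one R] -->
   (sgn - sgn) *+ m + sgn *+ (N - m.*2).
  have h1 := cvg_muln FF (k := m) ab_lim; have h2 := cvg_muln FF (k := (N - m.*2)%N) al_lim.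
  exact: (cvgD h1 h2).
rewrite /mxtrace (cvg_eq_near FF L Rr); first by rewrite subrr mul0rn add0r.
by apply: near_generic => q gq; have [_ _ e] := family_at gq.
Qed.

Lemma limit_multiplicities : (m.*2 <= N)%N ->
  (mup 1 (char_poly A0), mup (-1) (char_poly A0)) = if neg then (m, N - m)%N else (N - m, m)%N.
Proof.
move=> mN; have mN' : (m <= N)%N by move: mN; clear; lia.
have e : (N - m.*2)%:R = (N - m)%:R - m%:R :> Cplx R.
  by rewrite -natrB; [congr (_%:R) | ]; move: mN; clear; lia.
have tr := limit_trace; rewrite /sgn in tr; case: neg tr => tr.
  have tr' : \tr A0 = m%:R - (N - m)%:R by rewrite tr expr1 mulNrn e opprB.
  by have [-> ->] := mup_involution limit_involution tr' (subnKC mN').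
have tr' : \tr A0 = (N - m)%:R - m%:R by rewrite tr expr0 e.
by have [-> ->] := mup_involution limit_involution tr' (subnK mN').
Qed.

End Limit.

(** * The four assertions at a fixed generic [q] *)

Section Conclusions.
Variables (C : fieldType) (n : nat) (s : C).
Local Notation N := n.+1.
Hypothesis s0 : s != 0.
Let q := s ^+ 2.
Let q0 : q != 0. Proof. by rewrite expf_neq0. Qed.
Variables (g : lie_type) (t : mx_family) (y : 'I_N -> C).
Hypotheses (hg : simple_type g N) (ht : family_ok g N t) (rel : param_rel t q y).
Hypothesis gq : generic_q C q.
Let A := Amx t q y.

Let spN : isSP g ==> ~~ odd N.
Proof. by move: hg; rewrite /isSP; case: (g) => //= /andP[]. Qed.

Lemma half_even : ~~ odd N -> N = (N./2 + N./2)%N.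
Proof. by move=> oN; rewrite addnn even_halfK //; apply/negPf. Qed.

Lemma im_root (im : C) : im * im = -1 -> t = Type3 \/ t = Type4 ->
  im * q ^ (- (N./2)%:Z + eps_sign g) * (im * q ^ (- (N./2)%:Z + eps_sign g)) =
  - q ^ (- N%:Z + eps_sign g + eps_sign g).
Proof.
move=> im2 tE; have oN : ~~ odd N.
  by case: tE (ht) => -> /= => [gE | [] //]; move: hg; rewrite gE => /andP[].
rewrite mulrACA im2 mulN1r -expfzDr //; congr (- (_ ^ _)).
by have := half_even oN; lia.
Qed.

(** For so(N) and sp(N), (i) and (ii) see a family only through such a datum and the value of
    [al * be * th]; [im] supplies the common value [al = be] for types (3) and (4). *)
Lemma family_datum (im : C) : im * im = -1 -> g <> SL ->
  exists m sg d yv al be tw, [/\ entries A sg d yv,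
    datum q N m sg d yv al be tw (esign C (isSP g)) (pwt q N (isSP g)) (nrm n s (isSP g)) &
    al * be * (if tw then - q^-1 else q) = (eps_sign g)%:~R * q ^ (- N%:Z + eps_sign g)].
Proof.
move=> im2 gS.
have scalar m neg : t = Type1 m neg \/ t = Type2 m neg ->
  exists m sg d yv al be tw, [/\ entries A sg d yv,
    datum q N m sg d yv al be tw (esign C (isSP g)) (pwt q N (isSP g)) (nrm n s (isSP g)) &
    al * be * (if tw then - q^-1 else q) = (eps_sign g)%:~R * q ^ (- N%:Z + eps_sign g)].
  move=> tE; have [mN [yv [ent _ /(_ gS) D]]] := scalar_family s0 tE ht hg rel.
  do 7 eexists; split; [exact: ent | exact: D | ].
  rewrite (alS_beS n s0) exprnN.
  have gE : g = SO \/ g = SP by case: (g) gS; [ | left | right].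
  case: gE => -> /=.
    by rewrite mul1r -[X in _ * X]expr1z -expfzDr.
  by rewrite mulN1r mulrN -[q^-1]/(q ^ (- 1)) -expfzDr.
have mono : t = Type3 \/ t = Type4 ->
  exists m sg d yv al be tw, [/\ entries A sg d yv,
    datum q N m sg d yv al be tw (esign C (isSP g)) (pwt q N (isSP g)) (nrm n s (isSP g)) &
    al * be * (if tw then - q^-1 else q) = (eps_sign g)%:~R * q ^ (- N%:Z + eps_sign g)].
  move=> tE.
  have [m [sg [d [yv [tw [? ? ?]]]]]] := monomial_family s0 tE ht hg rel (im_root im2 tE).
  by do 7 eexists; split; eassumption.
case: (t) scalar mono => [m neg|m neg||] scalar mono.
- exact: (scalar m neg (or_introl erefl)).
- exact: (scalar m neg (or_intror erefl)).
- exact: (mono (or_introl erefl)).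
- exact: (mono (or_intror erefl)).
Qed.

Lemma family_RE (im : C) : im * im = -1 ->
  R21 N g s *m leg1 A *m Rmx N g s *m leg2 A = leg2 A *m R21 N g s *m leg1 A *m Rmx N g s.
Proof.
move=> im2; case: (boolP (if g is SL then true else false)) => gE; last first.
  have gS : g <> SL by move=> e; rewrite e in gE.
  have [m [sg [d [yv [al [be [tw [ent D _]]]]]]]] := family_datum im2 gS.
  exact: (ortho_RE s0 gS ent D).
have {}gE : g = SL by case: (g) gE.
have [m [neg tE]] : exists m neg, t = Type1 m neg.
  by move: (ht); rewrite gE; case: (t) => [m neg _|m neg []||[]] //; exists m, neg.
have [mN [yv [ent sh _]]] := scalar_family s0 (or_introl tE) ht hg rel.
rewrite gE in ent sh *.
apply: (RE_of_vec ent (S := hecke q)).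
- by move=> k M c a b aN bN; apply: Smx_SL_vec.
- by move=> u w a b aN bN; apply: hecke_ext.
- move=> v a b aN bN; apply: (hecke_RE q0 sh) => // i j iN jN pi pj.
  by rewrite !dS_unpaired.
Qed.

Lemma family_varpi (im : C) W : im * im = -1 -> g = SO \/ g = SP -> is_varpi g s W ->
  leg2 A *m Smx N g s *m leg2 A *m W = ((eps_sign g)%:~R * q ^ (- N%:Z + eps_sign g)) *: W /\
  W *m (leg2 A *m Smx N g s *m leg2 A) = ((eps_sign g)%:~R * q ^ (- N%:Z + eps_sign g)) *: W.
Proof.
move=> im2 gE hW; have gS : g <> SL by case: gE => ->.
have [m [sg [d [yv [al [be [tw [ent D e]]]]]]]] := family_datum im2 gS.
exact: (varpi_eq s0 gS spN ent D (trivial_eigenvalue gq hg gS erefl) e hW).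
Qed.

Lemma scalar_family_class m neg : t = Type1 m neg \/ t = Type2 m neg ->
  let PM := if neg then (m, N - m)%N else (N - m, m)%N in
  (m.*2 <= N)%N /\ (A + (q ^- PM.1)%:M) *m (A - (q ^- PM.2)%:M) = 0 /\
  qtrace g q A = match g with
    | SL => qint q PM.1%:Z - qint q PM.2%:Z
    | SO => qint q (PM.1%:Z - 1) - qint q (PM.2%:Z - 1)
    | SP => qint q (PM.1%:Z + 1) - qint q (PM.2%:Z + 1)
    end.
Proof.
move=> tE PM; have [mN [yv [ent sh D]]] := scalar_family s0 tE ht hg rel.
have mN' : (m <= N)%N by move: mN; clear; lia.
split=> //; split.
  have [f1 f2] := shape_factor ent sh.
  (* In this form [al] and [- be] are [q^-M] and [- q^-P] for the sign [+], and the same two in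
     reverse order for the sign [-]. *)
  have beE : beS n s neg m = (-1) ^+ neg * q ^- (N - m).
    rewrite /beS /alS -mulrA; congr (_ * _).
    by rewrite !exprnN -expfzDr //; congr (_ ^ _); move: mN; clear; lia.
  rewrite beE /alS -/q in f1 f2; rewrite /PM; case: (neg) f1 f2 => /= f1 f2.
    by move: f1; rewrite !expr1 !mulN1r !raddfN /= opprK.
  by move: f2; rewrite !expr0 !mul1r.
have lam0 := generic_lam gq.
case: (eqVneq (if g is SL then true else false) true) => gE.
  have {}gE : g = SL by case: (g) gE.
  have qt := qtrace_SL s0 mN ent sh.
  rewrite gE -[PM.1%:Z]subr0 -[PM.2%:Z]subr0; apply: (qint_diff s0 lam0 mN'); rewrite qt expr0z !mulr1 invr1 mulr1 mul1r.
  have -> : beS n s neg m * q ^ (N%:Z - m.*2%:Z) = alS s neg m.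
    by rewrite /beS -mulrA -expfzDr // addrA subrK subrr expr0z mulr1.
  by rewrite -/(beS n s neg m); ring.
have gS : g <> SL by move=> e; move: gE; rewrite e eqxx.
have qt := qtrace_datum s0 gS spN ent (D gS).
have pN : pwt q N (isSP g) N = q ^ (N%:Z + (if isSP g then 2 else 0)).
  by have := pwt_Nm q0 spN (leq0n N : (0.*2 <= N)%N); rewrite subn0 !subr0 => ->.
case gE' : g gS gE qt pN => //= _ _ qt pN; rewrite pN /esign in qt.
  apply: (qint_diff s0 lam0 mN'); rewrite qt; congr (_ * _).
  by rewrite expr1z addr0 invfM; field.
rewrite -[1]opprK; apply: (qint_diff s0 lam0 mN'); rewrite qt; congr (_ * _).
rewrite expfzDr // -[q ^ (-1)]/(q^-1) -[q ^ 2]/(q * q) mulrNN mul1r.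
have e (z X : C) : z != 0 -> z^-1 + z^-1 * (X * (z * z)) = z^-1 * (1 + X / (z^-1 * z^-1)).
  by move=> z0; field; rewrite z0 oner_neq0.
exact: e.
Qed.

Lemma monomial_family_class (im : C) : im * im = -1 -> t = Type3 \/ t = Type4 ->
  (A - (im * q ^ (- (N./2)%:Z + eps_sign g))%:M)
    *m (A + (im * q ^ (- (N./2)%:Z + eps_sign g))%:M) = 0 /\ qtrace g q A = 0.
Proof.
move=> im2 tE; set al := im * _.
have gS : g <> SL by case: tE (ht) => -> /= => [-> | [-> _]].
have [m [sg [d [yv [tw [ent D _]]]]]] := monomial_family s0 tE ht hg rel (im_root im2 tE).
split; first by have [] := shape_factor ent (dm_sh D).
apply: (mulfI (generic_lam gq)); rewrite (qtrace_datum s0 gS spN ent D).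
by rewrite subrr mul0r mulr0.
Qed.

End Conclusions.

Theorem proposition3p6 (R : realType) (g : lie_type) (N : nat) (t : mx_family)
    (y : 'I_N -> Cplx R -> Cplx R) (A0 : 'M[Cplx R]_N)
    (hg : simple_type g N) (ht : family_ok g N t)
    (y_neq0 : forall i : 'I_N, occurs t i ->
       forall q : Cplx R, generic_q (Cplx R) q -> y i q != 0)
    (y_rel : forall q : Cplx R, generic_q (Cplx R) q ->
       param_rel t q (fun i : 'I_N => y i q))
    (y_lim : forall i : 'I_N, occurs t i ->
       exists2 l : Cplx R, l != 0 & y i q @[q --> near_one R] --> l)
    (A_lim : Amx t q (fun i : 'I_N => y i q) @[q --> near_one R] --> A0)
    (det_A0 : \det A0 = 1)
    (q s : Cplx R) (hq : generic_q (Cplx R) q) (hs : s ^+ 2 = q) :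
  let A : 'M[Cplx R]_N := Amx t q (fun i : 'I_N => y i q) in
  [/\ (* (i) *)
      R21 N g s *m leg1 A *m Rmx N g s *m leg2 A
        = leg2 A *m R21 N g s *m leg1 A *m Rmx N g s,
      (* (ii) *)
      g = SO \/ g = SP ->
        forall varpi : 'M[Cplx R]_(N * N), is_varpi g s varpi ->
          leg2 A *m Smx N g s *m leg2 A *m varpi
            = ((eps_sign g)%:~R * q ^ (- N%:Z + eps_sign g)) *: varpi
          /\ varpi *m (leg2 A *m Smx N g s *m leg2 A)
            = ((eps_sign g)%:~R * q ^ (- N%:Z + eps_sign g)) *: varpi,
      (* (iii) *)
      forall (m : nat) (neg : bool), t = Type1 m neg \/ t = Type2 m neg ->
        let P := mup 1 (char_poly A0) in
        let M := mup (-1) (char_poly A0) in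
        [/\ (P, M) = (if neg then (m, N - m) else (N - m, m))%N,
            (A + (q ^- P)%:M) *m (A - (q ^- M)%:M) = 0 &
            qtrace g q A =
              match g with
              | SL => qint q P%:Z - qint q M%:Z
              | SO => qint q (P%:Z - 1) - qint q (M%:Z - 1)
              | SP => qint q (P%:Z + 1) - qint q (M%:Z + 1)
              end]
    & (* (iv) *)
      t = Type3 \/ t = Type4 ->
        (A - ('i * q ^ (- (N./2)%:Z + eps_sign g))%:M)
          *m (A + ('i * q ^ (- (N./2)%:Z + eps_sign g))%:M) = 0
        /\ qtrace g q A = 0 ].
Proof.
have im2 : 'i * 'i = -1 :> Cplx R by rewrite -expr2 sqrCi.
case: N hg t ht y y_neq0 y_rel y_lim A0 A_lim det_A0 => [|n] hg0 {}t ht0 {}y _ rel _ {}A0 A_lim0 _.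
  by move: hg0; case: (g).
have [q0 _] := hq.
have s0 : s != 0 by apply: contra_neq q0 => e; rewrite -hs e expr0n.
have rq := rel q hq; rewrite -hs in rq hq q0 *.
split.
- exact: (family_RE s0 hg0 ht0 rq im2).
- by move=> gE W hW; apply: (family_varpi s0 hg0 ht0 rq hq im2).
- move=> m neg tE P M.
  have [mN [h1 h2]] := scalar_family_class s0 hg0 ht0 rq hq tE.
  have PM : (P, M) = (if neg then (m, n.+1 - m) else (n.+1 - m, m))%N.
    exact: (limit_multiplicities hg0 ht0 rel A_lim0 tE mN).
  by move: h1 h2; rewrite -PM.
- by move=> tE; apply: monomial_family_class.
Qed.
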